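(* Let $\sigma\in(0,1]$ and $n=2$. Consider the function $\tilde u(x,y):=xy$ and the set $\tilde E:=\{(x,y)\in\mathbb{R}^2 : xy>0\}$. There exists $K_o>2$ such that the following statement is true. Assume that $\Phi:[0,+\infty)\to[0,+\infty)$ is monotone nondecreasing, lower semicontinuous, with $\lim_{t\to+\infty}\Phi(t)=+\infty$, that $\Phi(t)=t^\gamma$ for any $t\in[0,1]$, for some $\gamma\in\left(0,\frac{4}{2-\sigma}\right)$, and that $\Phi(t)=1$ for any $t\in[2,K_o]$. Then there exist $R_o>r_o>0$ such that $(\tilde u,\tilde E)$ is a minimal pair in $B_{R_o}$ and is not a minimal pair in $B_r$ for any $r\in(0,r_o]$.
   Context: $B_r$ is the open ball of radius $r$ centered at the origin; $E^c:=\mathbb{R}^n\setminus E$. Here $n=2$. Fix $\Upsilon\in(0,\frac1{100}]$. For measurable $A,B\subseteq\mathbb{R}^n$ with $|A\cap B|=0$ and $\sigma\in(0,1)$, $L(A,B):=\iint_{A\times B}\frac{dx\,dy}{|x-y|^{n+\sigma}}$. For $\sigma\in(0,1)$, $\mathrm{Per}_\sigma(E,\Omega):=L(E\cap\Omega,E^c)+L(E^c\cap\Omega,E\cap\Omega^c)$; for $\sigma=1$, $\mathrm{Per}_1(E,\Omega)=\mathrm{Per}(E,\Omega)$ is the classical (De Giorgi) perimeter of $E$ in $\Omega$. For $\Omega\subset\mathbb{R}^n$ open, bounded and Lipschitz, let $\Omega_\Upsilon:=\bigcup_{p\in\Omega}B_\Upsilon(p)$ and let $\mathrm{Per}^\star_\sigma(E,\Omega):=\mathrm{Per}(E,\Omega_\Upsilon)$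 if $\sigma=1$, $\mathrm{Per}^\star_\sigma(E,\Omega):=\mathrm{Per}_\sigma(E,\Omega)$ if $\sigma\in(0,1)$. Energy: $\mathcal{E}_\Omega(u,E):=\int_\Omega|\nabla u|^2\,dx+\Phi\big(\mathrm{Per}^\star_\sigma(E,\Omega)\big)$. $(u,E)$ is an admissible pair (for $\Omega$) if $u:\mathbb{R}^n\to\mathbb{R}$ is measurable with $u\in H^1(\Omega)$, $E\subseteq\mathbb{R}^n$ is measurable with $\mathrm{Per}^\star_\sigma(E,\Omega)<+\infty$, and $u\ge0$ a.e. in $E$, $u\le0$ a.e. in $E^c$. $(u,E)$ is a minimal pair in $\Omega$ if it is admissible, $\mathcal{E}_\Omega(u,E)<+\infty$, and $\mathcal{E}_\Omega(u,E)\le\mathcal{E}_\Omega(v,F)$ for any admissible pair $(v,F)$ such that $v-u\in H^1_0(\Omega)$ and $F\setminus\Omega=E\setminus\Omega$ up to sets of measure zero. *)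

(* Defs.v *)
From HB Require Import structures.
From mathcomp Require Import all_boot all_order all_algebra.
From mathcomp Require Import all_classical all_reals all_analysis.
From mathcomp Require Import measurable_realfun.

Set Implicit Arguments.
Unset Strict Implicit.
Unset Printing Implicit Defensive.

Import Order.TTheory GRing.Theory Num.Theory.
Import numFieldNormedType.Exports.

Local Open Scope classical_set_scope.
Local Open Scope ring_scope.

Section Plane.
Context {R : realType}.
Local Notation plane := (R * R)%type.
Local Notation borel_plane := (measurableTypeR R * measurableTypeR R)%type.

(* The norm that the library puts on R * R is the sup norm, hence an explicit
   Euclidean norm. *)
Definition enorm (x : plane) : R := Num.sqrt (x.1 ^+ 2 + x.2 ^+ 2).

Definition eball (p : plane) (r : R) : set plane := [set x | enorm (x - p) < r].

Definition leb2 : set borel_plane -> \bar R :=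
  (@lebesgue_measure R \x @lebesgue_measure R)%E.

HB.instance Definition _ := Measure.on leb2.

(* The library instance for sigma-finite products is not found by inference,
   being shadowed by the one for subprobabilities. *)
Lemma leb2_sigma_finite : sigma_finite setT leb2.
Proof.
have /sigma_finiteP[F [TF ndF Foo]] := sigma_finiteT (@lebesgue_measure R).
exists (fun n => F n `*` F n).
  rewrite -setXTT TF predeqE => -[x y]; split.
    move=> [/= [n _ Fnx] [k _ Fky]]; exists (maxn n k) => //; split.
    - by move: x Fnx; exact/subsetPset/ndF/leq_maxl.
    - by move: y Fky; exact/subsetPset/ndF/leq_maxr.
  by move=> [n _ []/= ? ?]; split; exists n.
move=> k; have [mF Fk] := Foo k.
split; first exact: measurableX.
by rewrite /leb2 product_measure1E// lte_mul_pinfty// ge0_fin_numE.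
Qed.

HB.instance Definition _ :=
  Measure_isSigmaFinite.Build _ _ _ leb2 leb2_sigma_finite.

Definition leb4 : set (borel_plane * borel_plane)%type -> \bar R :=
  (leb2 \x leb2)%E.

HB.instance Definition _ := Measure.on leb4.

(* The plane with the Lebesgue sigma-algebra (the completion of the Borel one).
   The integral of the library is a supremum over Borel simple functions; on
   Lebesgue measurable functions it still takes the value of the Lebesgue
   integral, since such a function has a Borel minorant equal to it almost
   everywhere. *)
Definition lebesgue_plane := g_sigma_algebraType (completed_algebra_gen leb2).

Definition lmeasurable (A : set plane) : Prop :=
  measurable (A : set lebesgue_plane).

Definition lmeasurable_fun (D : set plane) (f : plane -> R) : Prop :=
  measurable_fun (D : set lebesgue_plane) (f : lebesgue_plane -> R).

Definition unit_vec (i : 'I_2) : plane := ((i == 0)%:R, (i == 1)%:R).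

Definition partial (i : 'I_2) (f : plane -> R) : plane -> R :=
  fun x => 'D_(unit_vec i) f x.

Definition iter_partial (s : seq 'I_2) (f : plane -> R) : plane -> R :=
  foldr partial f s.

Definition C_ (k : nat) (f : plane -> R) : Prop :=
  forall s : seq 'I_2,
    ((size s <= k)%N -> continuous (iter_partial s f)) /\
    ((size s < k)%N -> forall i x, derivable (iter_partial s f) x (unit_vec i)).

Definition supp (f : plane -> R) : set plane := closure [set x | f x != 0].

Definition Cc_ (k : nat) (Omega : set plane) (f : plane -> R) : Prop :=
  [/\ C_ k f, compact (supp f) & supp f `<=` Omega].

Definition Ccinfty (Omega : set plane) (f : plane -> R) : Prop :=
  forall k, Cc_ k Omega f.

Definition L2 (Omega : set plane) (f : plane -> R) : Prop :=
  lmeasurable_fun Omega f /\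
  (\int[leb2]_(x in Omega) ((f x) ^+ 2)%:E < +oo)%E.

Definition is_weak_partial (Omega : set plane) (i : 'I_2) (u g : plane -> R) :
    Prop :=
  L2 Omega g /\
  forall phi, Ccinfty Omega phi ->
    (\int[leb2]_(x in Omega) (u x * partial i phi x)%:E =
     - \int[leb2]_(x in Omega) (g x * phi x)%:E)%E.

Definition H1 (Omega : set plane) (u : plane -> R) : Prop :=
  L2 Omega u /\ forall i, exists g, is_weak_partial Omega i u g.

(* For u in H1 Omega, determined up to a null set in Omega. *)
Definition weak_partial (Omega : set plane) (i : 'I_2) (u : plane -> R) :
    plane -> R :=
  xget (cst 0) [set g | is_weak_partial Omega i u g].

Definition dirichlet (Omega : set plane) (u : plane -> R) : \bar R :=
  (\int[leb2]_(x in Omega) (\sum_(i < 2) (weak_partial Omega i u x) ^+ 2)%:E)%E.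

Definition sqr_H1_norm (Omega : set plane) (u : plane -> R) : \bar R :=
  (\int[leb2]_(x in Omega) ((u x) ^+ 2)%:E + dirichlet Omega u)%E.

Definition H10 (Omega : set plane) (w : plane -> R) : Prop :=
  H1 Omega w /\
  forall eps : R, 0 < eps ->
    exists2 phi, Ccinfty Omega phi &
      (sqr_H1_norm Omega (w \- phi)%R < eps%:E)%E.

(* On the diagonal, which is a null set, the integrand takes the value 0. *)
Definition interaction (sigma : R) (A B : set plane) : \bar R :=
  (\int[leb4]_(z in A `*` B) ((enorm (z.1 - z.2) `^ (2 + sigma))^-1)%:E)%E.

Definition frac_per (sigma : R) (E Omega : set plane) : \bar R :=
  (interaction sigma (E `&` Omega) (~` E) +
   interaction sigma (~` E `&` Omega) (E `&` ~` Omega))%E.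

Definition classical_per (E Omega : set plane) : \bar R :=
  ereal_sup [set (\int[leb2]_(x in E) (\sum_(i < 2) partial i (T i) x)%:E)%E
            | T in [set T : 'I_2 -> plane -> R |
                     (forall i, Cc_ 1 Omega (T i)) /\
                     (forall x, \sum_(i < 2) (T i x) ^+ 2 <= 1)]].

Definition thicken (Upsilon : R) (Omega : set plane) : set plane :=
  \bigcup_(p in Omega) eball p Upsilon.

Definition per_star (Upsilon sigma : R) (E Omega : set plane) : \bar R :=
  if sigma == 1 then classical_per E (thicken Upsilon Omega)
  else frac_per sigma E Omega.

(* er_map extends Phi by +oo at +oo. *)
Definition energy (Upsilon sigma : R) (Phi : R -> R) (Omega : set plane)
    (u : plane -> R) (E : set plane) : \bar R :=
  (dirichlet Omega u + er_map Phi (per_star Upsilon sigma E Omega))%E.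

Definition admissible_pair (Upsilon sigma : R) (Omega : set plane)
    (u : plane -> R) (E : set plane) : Prop :=
  [/\ lmeasurable_fun setT u /\ H1 Omega u,
      lmeasurable E,
      (per_star Upsilon sigma E Omega < +oo)%E,
      {ae leb2, forall x, E x -> 0 <= u x} &
      {ae leb2, forall x, (~` E) x -> u x <= 0}].

Definition minimal_pair (Upsilon sigma : R) (Phi : R -> R) (Omega : set plane)
    (u : plane -> R) (E : set plane) : Prop :=
  [/\ admissible_pair Upsilon sigma Omega u E,
      (energy Upsilon sigma Phi Omega u E < +oo)%E &
      forall v F, admissible_pair Upsilon sigma Omega v F ->
        H10 Omega (v \- u) ->
        leb2.-negligible ((F `\` Omega) `+` (E `\` Omega)) ->
        (energy Upsilon sigma Phi Omega u E <=
         energy Upsilon sigma Phi Omega v F)%E].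

Definition u_saddle (x : plane) : R := x.1 * x.2.

Definition E_saddle : set plane := [set x | 0 < x.1 * x.2].

(* Lower semicontinuity of the restriction of Phi to [0, +oo), for the subspace
   topology. *)
Definition lsc_halfline (Phi : R -> R) : Prop :=
  lower_semicontinuous
    (fun t : subspace [set t : R | 0 <= t] => (Phi (t : R))%:E).

End Plane.

(* Main.v *)
Require Import Defs.
From HB Require Import structures.
From mathcomp Require Import all_boot all_order all_algebra.
From mathcomp Require Import all_classical all_reals all_analysis.
From mathcomp Require Import measurable_realfun ring lra.

Set Implicit Arguments.
Unset Strict Implicit.
Unset Printing Implicit Defensive.

Import Order.TTheory GRing.Theory Num.Theory.
Import numFieldNormedType.Exports.

Local Open Scope classical_set_scope.
Local Open Scope ring_scope.

(** The saddle [u_saddle] is harmonic, hence it has the least Dirichlet energy among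
    all functions with its boundary values ([dirichlet_saddle_le]); whether the pair is
    minimal depends on the perimeter term only. Two facts about the perimeter p of the
    saddle set in a ball of radius r decide it.

    In a large ball p is finite, and every set that agrees with the saddle set outside
    the ball has perimeter at least 1 ([per_star_competitor_ge1]): the prescribed
    exterior consists of large portions of both phases, with which the interior has to
    interact. If Ko is at least p, then [Phi] is 1 on [1, Ko], by monotonicity and since
    [Phi 1 = 1]; hence [Phi] of the perimeter is at most 1 for the saddle set and at
    least 1 for each competitor. Both terms of the energy are then minimal.

    In a small ball p is at most 1, where [Phi] is the power of exponent gamma, and the
    crossing at the origin is not optimal for the perimeter. For sigma < 1, add to the
    saddle set two squares of side r / 4 at the origin in the other two quadrants.
    Reflections that leave a square invariant show that adding it alone does not cost
    anything; adding both saves their mutual interaction ([frac_per_square_gap]), which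
    is of order r^(2 - sigma), as is p itself ([frac_per_saddle_le]). For sigma = 1, cut
    off two opposite corners at the origin. By the divergence theorem the perimeter is a
    supremum of fluxes through the boundary, and a field bounded by 1 has a smaller flux
    through the hypotenuse of a corner than through its legs
    ([classical_per_chamfered_le]), while p = 4 (r + Upsilon). In both cases [Phi] of
    the perimeter decreases by at least a multiple of r^beta with beta < 4
    ([per_star_gap]).

    The function has to vanish where the set has been enlarged. The saddle flattened to
    0 on a square of size r / 4 has the right signs, and its energy is of order r^4
    ([dirichlet_flattened_le]), which is less than the gain r^beta if r is small. So the
    saddle pair is not minimal.

    The Dirichlet energy is defined through weak derivatives. The fundamental lemma of
    the calculus of variations ([fundamental_lemma]) identifies them with the classical
    ones for functions of class C^1, and the Dirichlet principle is proved directly from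
    the approximation of [v - u] by test functions. *)

(** * Integrals off null sets and the completed Borel sets of the plane *)

Section integral_arbitrary.
Local Open Scope ereal_scope.
Context d (T : measurableType d) (R : realType).
Variable mu : {measure set T -> \bar R}.
Implicit Types (f g : T -> \bar R) (D : set T).

Import HBNNSimple.

(** The integral of a nonnegative function is a supremum over the simple
    functions below it. The competitors are only Lebesgue measurable while integrals
    are taken for the Borel sigma-algebra, so that comparisons have to rest on this
    supremum. *)
Lemma le_integral_arbitrary D D' f g :
  (forall x, 0 <= (f \_ D) x) -> (forall x, (f \_ D) x <= (g \_ D') x) ->
  \int[mu]_(x in D) f x <= \int[mu]_(x in D') g x.
Proof.
move=> f0 fg.
have g0 x : 0 <= (g \_ D') x by exact: le_trans (f0 x) (fg x).
rewrite integral_mkcond [leRHS]integral_mkcond !ge0_integralTE//.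
apply: le_ereal_sup => _ [h /= hf <-]; exists h => // x.
exact: le_trans (hf x) (fg x).
Qed.

Let nnint_null N f g : measurable N -> mu N = 0 ->
  (forall x, 0 <= f x) -> (forall x, 0 <= g x) ->
  (forall x, ~ N x -> f x = g x) ->
  \int[mu]_x f x <= \int[mu]_x g x.
Proof.
move=> mN N0 f0 g0 fg.
rewrite !ge0_integralTE//; apply: ge_ereal_sup => _ [h /= hf <-].
have mNC : measurable (~` N) by exact: measurableC.
pose h1 := mul_nnsfun h (indic_nnsfun R mNC).
have -> : sintegral mu h = sintegral mu h1.
  rewrite -!integralT_nnsfun; apply: ae_eq_integral => //.
  - by apply/measurable_EFinP.
  - by apply/measurable_EFinP.
  - exists N; split => // x /= /not_implyP [_ hx].
    apply: contrapT => Nx; apply: hx.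
    rewrite /h1 /=. by rewrite mindicE mem_set//= mulr1.
apply: ereal_sup_ubound; exists h1 => //= x.
rewrite mindicE; have [/set_mem Nx|xN] := boolP (x \in ~` N).
  by rewrite mulr1 -fg.
by rewrite mulr0.
Qed.

Let nnint_null_eq N f g : measurable N -> mu N = 0 ->
  (forall x, 0 <= f x) -> (forall x, 0 <= g x) ->
  (forall x, ~ N x -> f x = g x) ->
  \int[mu]_x f x = \int[mu]_x g x.
Proof.
move=> mN N0 f0 g0 fg; apply/eqP; rewrite eq_le.
apply/andP; split; apply: (nnint_null mN) => // x Nx.
by rewrite fg.
Qed.

(** A simple function below [f] can be set to 0 on [N] without changing its
    integral, and is then below [g]. *)
Lemma eq_integral_off_null N D D' f g : measurable N -> mu N = 0 ->
  (forall x, ~ N x -> (f \_ D) x = (g \_ D') x) ->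
  \int[mu]_(x in D) f x = \int[mu]_(x in D') g x.
Proof.
move=> mN N0 fg; rewrite integralE [RHS]integralE; congr (_ - _);
rewrite integral_mkcond [RHS]integral_mkcond; apply: (nnint_null_eq mN) => // x.
- exact: erestrict_ge0.
- exact: erestrict_ge0.
- by move=> Nx; rewrite -!funepos_restrict !funeposE fg.
- exact: erestrict_ge0.
- exact: erestrict_ge0.
- by move=> Nx; rewrite -!funeneg_restrict !funenegE fg.
Qed.

End integral_arbitrary.

Section lebesgue_plane.
Context {R : realType}.
Local Notation plane := (R * R)%type.
Local Notation borel_plane := (measurableTypeR R * measurableTypeR R)%type.
Local Notation leb2 := (@leb2 R).

Lemma leb2_bigcup0 (N : (set borel_plane)^nat) : (forall k, measurable (N k)) ->
  (forall k, leb2 (N k) = 0%E) -> leb2 (\bigcup_k N k) = 0%E.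
Proof.
move=> mN N0; apply/negligibleP; first exact: bigcupT_measurable.
by apply: negligible_bigcup => k; apply/negligibleP; [exact: mN|exact: N0].
Qed.

(** The sets that are Borel off a Borel null set form a sigma-algebra, which
    contains the Borel sets and the negligible sets. *)
Lemma lmeasurable_borel (A : set plane) : lmeasurable A ->
  exists N : set borel_plane, [/\ measurable N, leb2 N = 0%E &
    measurable (A `&` ~` N : set borel_plane)].
Proof.
pose G := [set A : set plane | exists N : set borel_plane,
  [/\ measurable N, leb2 N = 0%E & measurable (A `&` ~` N : set borel_plane)]].
suff : (completed_algebra_gen leb2).-sigma.-measurable `<=` G by exact.
apply: smallest_sub => [|_ [B mB [N [M [mM M0 NM]]] <-]]; last first.
  exists M; split => //.
  rewrite setIUl (_ : N `&` ~` M = set0) ?setU0; last first.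
    by apply/seteqP; split => x // -[/NM].
  by apply: measurableI => //; exact: measurableC.
split.
- by exists set0; rewrite set0I measure0.
- move=> B [N [mN N0 mBN]]; exists N; split => //.
  rewrite setTD (_ : _ `&` _ = ~` N `\` (B `&` ~` N)).
    by apply: measurableD => //; exact: measurableC.
  apply/seteqP; split => x /=; first by move=> [Bx Nx]; split => // -[].
  by move=> [Nx BNx]; split => // Bx; apply: BNx.
- move=> B /choice[N hN].
  exists (\bigcup_k N k); split.
  + by apply: bigcupT_measurable => k; have [] := hN k.
  + by apply: leb2_bigcup0 => k; have [] := hN k.
  + rewrite (_ : _ `&` _ = (\bigcup_k (B k `&` ~` N k)) `\` (\bigcup_k N k)).
      by apply: measurableD; apply: bigcupT_measurable => k; have [] := hN k.
    apply/seteqP; split => x /=.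
      move=> [[k _ Bx] Nx]; split => //; exists k => //; split => // Nkx.
      by apply: Nx; exists k.
    by move=> [[k _ [Bx _]] Nx]; split => //; exists k.
Qed.

Lemma borel_lmeasurable (A : set borel_plane) : measurable A -> lmeasurable A.
Proof.
move=> mA; apply: sub_sigma_algebra; exists A => //; exists set0; rewrite ?setU0//.
exact: negligible_set0.
Qed.

Lemma borel_lmeasurable_fun (D : set borel_plane) (f : borel_plane -> R) :
  measurable_fun D f -> measurable D -> lmeasurable_fun D f.
Proof. by move=> mf mD _ Y mY; apply: borel_lmeasurable; exact: mf. Qed.

(** Rational superlevel sets suffice, so that the exceptional sets are only
    countably many. *)
Lemma lmeasurable_fun_borel (D : set borel_plane) (f : plane -> R) :
  measurable D -> lmeasurable_fun D f ->
  exists N : set borel_plane, [/\ measurable N, leb2 N = 0%E &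
    measurable_fun (D `\` N : set borel_plane) (f : borel_plane -> R)].
Proof.
move=> mD mf.
have mDl : measurable (D : set lebesgue_plane) by exact: borel_lmeasurable.
pose e k : R := ratr (odflt 0 (unpickle k)).
have /choice[N hN] : forall k : nat, exists N : set borel_plane,
   [/\ measurable N, leb2 N = 0%E &
    measurable ((D `&` f @^-1` `]e k, +oo[%classic) `&` ~` N : set borel_plane)].
  by move=> k; apply: lmeasurable_borel; exact: mf.
pose U := \bigcup_k N k : set borel_plane.
have mU : measurable U by apply: bigcupT_measurable => k; have [] := hN k.
have U0 : leb2 U = 0%E.
  by apply: leb2_bigcup0 => k; have [] := hN k.
exists U; split => // _.
have mDU : measurable (D `\` U) by exact: measurableD.
apply: (measurability _ (RGenOInfty.measurableE R)) => //.
move=> _ [_ [a ->] <-].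
rewrite [X in measurable X](_ : _ =
    \bigcup_(k in [set k | a <= e k]) (((D `&` f @^-1` `]e k, +oo[%classic) `&` ~` N k) `\` U)).
  apply: bigcup_measurable => k _; apply: measurableD => //.
  by have [] := hN k.
apply/seteqP; split => x /=.
  move=> [[Dx Ux]]; rewrite in_itv/= andbT => /rat_in_itvoo[q].
  rewrite in_itv/= => /andP[aq qf].
  have eq : e (pickle q) = ratr q by rewrite /e pickleK.
  exists (pickle q) => /=; rewrite ?eq ?ltW//.
  split=> //; split; rewrite ?in_itv/= ?eq ?qf//.
  by apply: contra_not Ux => Nx; exists (pickle q).
move=> [k /= aek [[[Dx]]]]; rewrite !in_itv/= !andbT => ef _ Ux.
by split => //; exact: le_lt_trans ef.
Qed.

End lebesgue_plane.

(** * Smooth plateau functions on the line *)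

Section smooth.
Context {R : realType}.
Implicit Types (f g : R -> R).

(** [diffn n f]: [f] is of class C^n on the line. The derivatives are given as
    witnesses, so that closure under the operations is an induction on [n]. *)
Fixpoint diffn n f : Prop :=
  if n is m.+1 then exists2 g, diffn m g & forall x : R, is_derive x 1 f (g x)
  else continuous f.

Definition smooth f := forall n, diffn n f.

Lemma is_derive_continuous f g : (forall x : R, is_derive x 1 f (g x)) -> continuous f.
Proof.
move=> fg x; apply: differentiable_continuous; apply/derivable1_diffP.
exact: ex_derive.
Qed.

Lemma is_derive_derive1 f g : (forall x : R, is_derive x 1 f (g x)) -> derive1 f = g.
Proof. by move=> fg; apply/funext => x; rewrite derive1E; exact: derive_val. Qed.

Lemma diffnW n f : diffn n.+1 f -> diffn n f.
Proof.
elim: n f => [|n IH] f [g gn fg]; first exact: is_derive_continuous fg.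
by exists g => //; exact: IH.
Qed.

Lemma smooth_continuous f : smooth f -> continuous f.
Proof. by move=> sf; exact: (sf 0%N). Qed.

Lemma smooth_is_derive f (x : R) : smooth f -> is_derive x 1 f (derive1 f x).
Proof. by move=> /(_ 1%N) [g _ fg]; rewrite (is_derive_derive1 fg). Qed.

Lemma smooth_derive1 f : smooth f -> smooth (derive1 f).
Proof. by move=> sf n; have [g gn fg] := sf n.+1; rewrite (is_derive_derive1 fg). Qed.

Lemma diffn_cst n a : diffn n (cst a).
Proof.
elim: n a => [|n IH] a; first by move=> ?; exact: cvg_cst.
by exists (cst 0) => [|x]; [exact: IH|exact: is_derive_cst].
Qed.

Lemma diffn_id n : diffn n id.
Proof.
case: n => [|n]; first by move=> ?; exact: cvg_id.
by exists (cst 1) => [|x]; [exact: diffn_cst|exact: is_derive_id].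
Qed.

Lemma diffnD n f g : diffn n f -> diffn n g -> diffn n (f \+ g).
Proof.
elim: n f g => [|n IH] f g; first by move=> cf cg x; apply: cvgD; [exact: cf|exact: cg].
by move=> [f' f'n ff'] [g' g'n gg']; exists (f' \+ g'); [exact: IH|move=> x; exact: is_deriveD].
Qed.

Lemma diffnM n f g : diffn n f -> diffn n g -> diffn n (f \* g).
Proof.
elim: n f g => [|n IH] f g; first by move=> cf cg x; apply: cvgM; [exact: cf|exact: cg].
move=> fn gn; have [fn' gn'] := (diffnW fn, diffnW gn).
have [f' f'n ff'] := fn; have [g' g'n gg'] := gn.
exists ((f \* g') \+ (g \* f')); last by move=> x; exact: is_deriveM.
by apply: diffnD; exact: IH.
Qed.

Lemma diffnV n f : (forall x, f x != 0) -> diffn n f -> diffn n (fun x => (f x)^-1).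
Proof.
move=> f0; elim: n => [|n IH]; first by move=> cf x; apply: cvgV => //; exact: cf.
move=> fn; have [f' f'n ff'] := fn.
pose i := fun x => (f x)^-1.
exists (cst (-1) \* ((i \* i) \* f')).
  have im := IH (diffnW fn).
  apply: diffnM; first exact: diffn_cst.
  by apply: diffnM => //; exact: diffnM.
move=> x; have := @is_deriveV _ f x (f' x) 1 (f0 x) (ff' x).
by move=> h; apply: (is_derive_eq h); rewrite /i /= /GRing.scale/=; field; exact: f0.
Qed.

Lemma diffn_affine n f a b : diffn n f -> diffn n (fun x => f (a * x + b)).
Proof.
have da (x : R) : is_derive x 1 (fun x : R => a * x + b) a.
  have h := is_deriveD (is_deriveZ a (is_derive_id x 1)) (is_derive_cst b x 1).
  by apply: (is_derive_eq h); rewrite addr0 /GRing.scale/= mulr1.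
elim: n f => [|n IH] f.
  move=> cf x; apply: continuous_comp; last exact: cf.
  exact: (is_derive_continuous da).
move=> [f' f'n ff']; exists (cst a \* (fun x => f' (a * x + b))).
  by apply: diffnM; [exact: diffn_cst|exact: IH].
move=> x; have h := @is_derive1_comp _ f (fun x => a * x + b) x _ _ (ff' _) (da x).
by apply: (is_derive_eq h); rewrite mulrC.
Qed.

(** The functions x^-n exp (-1/x) are flat at 0, and closed under derivation up
    to linear combinations: this is why the whole family is needed to see that
    exp (-1/x) is smooth. *)
Definition flat n (x : R) : R := if 0 < x then x ^- n * expR (- x^-1) else 0.

Lemma flat_ge0 n x : 0 <= flat n x.
Proof.
by rewrite /flat; case: ifP => // x0; rewrite mulr_ge0 ?expR_ge0// invr_ge0 exprn_ge0// ltW.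
Qed.

Lemma flat_gt0 n x : 0 < x -> 0 < flat n x.
Proof. by move=> x0; rewrite /flat x0 mulr_gt0 ?expR_gt0// invr_gt0 exprn_gt0. Qed.

(** Comparison of exp (1/x) with one term of its series. The quadratic bound
    makes the derivative at 0 vanish. *)
Lemma flat_le n x : `|flat n x| <= n.+2`!%:R * x ^+ 2.
Proof.
rewrite ger0_norm ?flat_ge0// /flat; case: ifPn => [x0|_]; last first.
  by rewrite mulr_ge0// ?sqr_ge0.
rewrite expRN ler_pdivrMr ?expR_gt0// -exprVn.
have := @expR_ge1Dxn R x^-1 n.+1; rewrite invr_ge0 ltW// => /(_ isT) h.
have N0 : (0 : R) < n.+2`!%:R by rewrite ltr0n fact_gt0.
apply: (@le_trans _ _ (n.+2`!%:R * x ^+ 2 * (x^-1 ^+ n.+2 / n.+2`!%:R))).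
  rewrite le_eqVlt; apply/orP; left; apply/eqP.
  by rewrite !exprVn !exprS; field; rewrite !gt_eqF ?exprn_gt0.
apply: ler_wpM2l; first by rewrite mulr_ge0 ?sqr_ge0// ltW.
by rewrite (le_trans _ h)// lerDr.
Qed.

Lemma flat_is_derive n (x : R) :
  is_derive x 1 (flat n) (flat n.+2 x - n%:R * flat n.+1 x).
Proof.
have [x0|x0|->] := ltgtP x 0.
- have -> : flat n.+2 x - n%:R * flat n.+1 x = 0.
    by rewrite /flat ltNge (ltW x0)/= mulr0 subr0.
  apply: (@near_eq_is_derive _ _ _ (cst 0)).
    near=> y; rewrite /flat/= ifF//; apply/negbTE; rewrite -leNgt ltW//.
    by near: y; exact: lt_nbhsl.
- have -> : flat n.+2 x - n%:R * flat n.+1 x =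
      x ^- n.+2 * expR (- x^-1) - n%:R * (x ^- n.+1 * expR (- x^-1)).
    by rewrite /flat x0.
  apply: (@near_eq_is_derive _ _ _ (fun y : R => (y ^+ n)^-1 * expR (- y^-1))).
    near=> y; rewrite /flat/= ifT//.
    by near: y; exact: lt_nbhsr.
  have x0' : x != 0 by rewrite gt_eqF.
  have xn0 : x ^+ n != 0 by rewrite expf_neq0.
  have d1 : is_derive x 1 (fun y : R => (y ^+ n)^-1) (- (x ^+ n) ^- 2 *: (n%:R * x ^+ n.-1)).
    apply: is_deriveV => //.
    have := is_deriveX n (is_derive_id x 1).
    by rewrite exprfctE => h; apply: (is_derive_eq h); rewrite /GRing.scale/= mulr1.
  have d2 : is_derive x 1 (fun y : R => expR (- y^-1)) (expR (- x^-1) * x ^- 2).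
    apply: (@is_derive1_comp _ expR (fun y => - y^-1)).
    have := @is_deriveV _ id x 1 1 x0' (is_derive_id _ _).
    move=> /is_deriveN h; apply: (is_derive_eq h).
    by rewrite /GRing.scale/= mulr1 opprK.
  apply: (is_derive_eq (@is_deriveM _ _ (fun y : R => (y ^+ n)^-1) (fun y : R => expR (- y^-1)) x 1 _ _ d1 d2)).
  rewrite /GRing.scale/=; case: n xn0 {d1} => [|n] xn0.
    by rewrite !mul0r !mulr0 addr0 subr0 expr0 invr1 mul1r mulrC.
  by rewrite /= !exprS; field; rewrite x0' expf_neq0.
- have -> : flat n.+2 0 - n%:R * flat n.+1 0 = 0.
    by rewrite /flat ltxx mulr0 subr0.
  have c0 : (fun h : R => `|h|) @ 0^' --> (0 : R).
    apply: cvg_within_filter.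
    by have := @norm_continuous _ R 0; rewrite /continuous_at normr0.
  have cN : (fun h : R => n.+2`!%:R * `|h|) @ 0^' --> (0 : R).
    have := cvgM (@cvg_cst _ (n.+2`!%:R : R) R _ (dnbhs_filter (0 : R))) c0.
    by rewrite mulr0; apply; exact: dnbhs_filter.
  have lim0 : (fun h : R => h^-1 *: (flat n (h *: 1 + 0) - flat n 0)) @ 0^' --> (0 : R).
    apply: (@squeeze_cvgr _ _ _ _ (fun h : R => - (n.+2`!%:R * `|h|)) (fun h : R => n.+2`!%:R * `|h|)).
    + near=> h; rewrite -ler_norml /GRing.scale/= mulr1 addr0 [flat n 0]/flat ltxx subr0.
      have h0 : h != 0 by near: h; exact: nbhs_dnbhs_neq.
      rewrite normrM normfV ler_pdivrMl ?normr_gt0//.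
      by rewrite mulrCA -expr2 real_normK ?num_real// flat_le.
    + by have := cvgN cN; rewrite oppr0; apply; exact: dnbhs_filter.
    + exact: cN.
  apply: DeriveDef; first by apply/cvg_ex; exists 0.
  by apply/cvg_lim.
Unshelve. all: by end_near. Qed.

Lemma diffn_flat k n : diffn k (flat n).
Proof.
elim: k n => [|k IH] n; first exact: is_derive_continuous (flat_is_derive n).
exists (flat n.+2 \+ (cst (- n%:R) \* flat n.+1)).
  by apply: diffnD => //; apply: diffnM => //; exact: diffn_cst.
by move=> x; apply: (is_derive_eq (flat_is_derive n x)); rewrite /= mulNr.
Qed.

Definition step (x : R) : R := flat 0 x / (flat 0 x + flat 0 (-1 * x + 1)).

Let step_den_gt0 x : 0 < flat 0 x + flat 0 (-1 * x + 1).
Proof.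
have [x0|x0] := ltP 0 x; first by rewrite ltr_wpDr ?flat_ge0// flat_gt0.
by rewrite ltr_wpDl ?flat_ge0// flat_gt0//; lra.
Qed.

Lemma smooth_step : smooth step.
Proof.
move=> n; apply: diffnM; first exact: diffn_flat.
apply: diffnV => [x|]; first by rewrite gt_eqF.
by apply: diffnD; [exact: diffn_flat|apply: diffn_affine; exact: diffn_flat].
Qed.

Lemma step_le0 x : x <= 0 -> step x = 0.
Proof. by rewrite /step /flat => x0; rewrite ltNge x0/= mul0r. Qed.

Lemma step_ge1 x : 1 <= x -> step x = 1.
Proof.
move=> x1; have f0 : flat 0 (-1 * x + 1) = 0.
  by rewrite /flat ifF//; apply/negbTE; rewrite -leNgt; lra.
have := step_den_gt0 x; rewrite /step f0 addr0 => /gt_eqF/negbT h.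
exact: divff.
Qed.

Lemma step_ge0 x : 0 <= step x.
Proof. by rewrite divr_ge0 ?flat_ge0// ltW. Qed.

Lemma step_le1 x : step x <= 1.
Proof. by rewrite ler_pdivrMr// mul1r lerDl flat_ge0. Qed.

(** A smooth function equal to 1 on [a + e, b - e], supported in [a, b]. *)
Definition plateau (a b e : R) : R -> R :=
  (fun x => step (e^-1 * x + - (a / e))) \* (fun x => step (- e^-1 * x + b / e)).

Lemma smooth_plateau a b e : smooth (plateau a b e).
Proof. by move=> n; apply: diffnM; apply: diffn_affine; exact: smooth_step. Qed.

Lemma plateau_ge0 a b e x : 0 <= plateau a b e x.
Proof. by rewrite mulr_ge0 ?step_ge0. Qed.

Lemma plateau_le1 a b e x : plateau a b e x <= 1.
Proof. by rewrite mulr_ile1 ?step_ge0 ?step_le1. Qed.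

Lemma plateau_eq0 a b e x : 0 < e -> ~~ (a < x < b) -> plateau a b e x = 0.
Proof.
move=> e0; rewrite negb_and -!leNgt => /orP[xa|bx]; rewrite /plateau/=.
  rewrite step_le0 ?mul0r// [_^-1 * x]mulrC -mulrBl.
  by rewrite pmulr_lle0 ?invr_gt0// subr_le0.
rewrite [X in _ * X]step_le0 ?mulr0// addrC mulNr [_^-1 * x]mulrC -mulrBl.
by rewrite pmulr_lle0 ?invr_gt0// subr_le0.
Qed.

Lemma plateau_eq1 a b e x : 0 < e -> a + e <= x <= b - e -> plateau a b e x = 1.
Proof.
move=> e0 /andP[ax xb]; rewrite /plateau/= !step_ge1 ?mulr1//.
  by rewrite addrC mulNr [_^-1 * x]mulrC -mulrBl ler_pdivlMr// mul1r; lra.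
by rewrite [_^-1 * x]mulrC -mulrBl ler_pdivlMr// mul1r; lra.
Qed.

End smooth.

(** * Continuously differentiable functions on the plane *)

Section plane_calculus.
Context {R : realType}.
Local Notation plane := (R * R)%type.
Implicit Types (u v w : plane -> R) (f g : R -> R) (x : plane).

Let shift_unit0 (h a b : R) : h *: (unit_vec 0 : plane) + (a, b) = (h%:A + a, b).
Proof. by rewrite -[LHS]/(_, _)/= scaler0 add0r. Qed.

Let shift_unit1 (h a b : R) : h *: (unit_vec 1 : plane) + (a, b) = (a, h%:A + b).
Proof. by rewrite -[LHS]/(_, _)/= scaler0 add0r. Qed.

(** Directional derivatives along the axes are derivatives of the slices: the
    difference quotients are the same. *)
Lemma derivable_unit0 u x :
  derivable u x (unit_vec 0) <-> derivable (fun t => u (t, x.2)) x.1 1.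
Proof.
rewrite /derivable (_ : (fun h => _) =
  (fun h : R => h^-1 *: (((fun t => u (t, x.2)) \o shift x.1) h%:A - u (x.1, x.2)))) //.
apply/funext => h; case: x => a b /=; congr (_ *: (u _ - _)).
exact: shift_unit0.
Qed.

Lemma derivable_unit1 u x :
  derivable u x (unit_vec 1) <-> derivable (fun t => u (x.1, t)) x.2 1.
Proof.
rewrite /derivable (_ : (fun h => _) =
  (fun h : R => h^-1 *: (((fun t => u (x.1, t)) \o shift x.2) h%:A - u (x.1, x.2)))) //.
apply/funext => h; case: x => a b /=; congr (_ *: (u _ - _)).
exact: shift_unit1.
Qed.

Lemma partial0E u x : partial 0 u x = derive1 (fun t => u (t, x.2)) x.1.
Proof.
rewrite derive1E /partial /derive; congr (lim _).
rewrite (_ : (fun h => _) =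
  (fun h : R => h^-1 *: (((fun t => u (t, x.2)) \o shift x.1) h%:A - u (x.1, x.2)))) //.
apply/funext => h; case: x => a b /=; congr (_ *: (u _ - _)).
exact: shift_unit0.
Qed.

Lemma partial1E u x : partial 1 u x = derive1 (fun t => u (x.1, t)) x.2.
Proof.
rewrite derive1E /partial /derive; congr (lim _).
rewrite (_ : (fun h => _) =
  (fun h : R => h^-1 *: (((fun t => u (x.1, t)) \o shift x.2) h%:A - u (x.1, x.2)))) //.
apply/funext => h; case: x => a b /=; congr (_ *: (u _ - _)).
exact: shift_unit1.
Qed.

Lemma C1P u : C_ 1 u <-> continuous u /\
  forall i, (forall x, derivable u x (unit_vec i)) /\ continuous (partial i u).
Proof.
split=> [C1u|[cu du] [|i [|j s]]]; split => //=.
- by have [+ _] := C1u [::]; exact.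
- by move=> i; split; [have [_ +] := C1u [::]; exact|have [+ _] := C1u [:: i]; exact].
- by move=> _ i; have [] := du i.
- by move=> _; have [] := du i.
Qed.

(** The explicit test functions below are products of functions of one variable, whose
    partial derivatives are again such products. *)
Definition tensor f g : plane -> R := fun x => f x.1 * g x.2.

Lemma continuous_tensor f g : continuous f -> continuous g -> continuous (tensor f g).
Proof.
move=> cf cg x; apply: cvgM.
  by apply: (@continuous_comp _ _ _ fst f); [exact: cvg_fst|exact: cf].
by apply: (@continuous_comp _ _ _ snd g); [exact: cvg_snd|exact: cg].
Qed.

Lemma is_derive_tensor0 f g x : smooth f ->
  is_derive x.1 1 (fun t => tensor f g (t, x.2)) (derive1 f x.1 * g x.2).
Proof.
move=> sf; have h := is_deriveZ (g x.2) (smooth_is_derive x.1 sf).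
have -> : (fun t => tensor f g (t, x.2)) = g x.2 \*: f.
  by apply/funext => t; rewrite /tensor/= mulrC.
by apply: (is_derive_eq h); rewrite mulrC.
Qed.

Lemma is_derive_tensor1 f g x : smooth g ->
  is_derive x.2 1 (fun t => tensor f g (x.1, t)) (f x.1 * derive1 g x.2).
Proof. by move=> sg; exact: (is_deriveZ (f x.1) (smooth_is_derive x.2 sg)). Qed.

Lemma partial0_tensor f g : smooth f -> partial 0 (tensor f g) = tensor (derive1 f) g.
Proof.
move=> sf; apply/funext => x; rewrite partial0E derive1E.
by have [_ ->] := is_derive_tensor0 g x sf.
Qed.

Lemma partial1_tensor f g : smooth g -> partial 1 (tensor f g) = tensor f (derive1 g).
Proof.
move=> sg; apply/funext => x; rewrite partial1E derive1E.
by have [_ ->] := is_derive_tensor1 f x sg.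
Qed.

Lemma ord2P (i : 'I_2) : i = 0 \/ i = 1.
Proof. by case: i => [[|[|]]]//= h; [left|right]; exact: val_inj. Qed.

Lemma derivable_tensor f g i x : smooth f -> smooth g ->
  derivable (tensor f g) x (unit_vec i).
Proof.
move=> sf sg; case: (ord2P i) => ->; [apply/derivable_unit0|apply/derivable_unit1].
  by have [] := is_derive_tensor0 g x sf.
by have [] := is_derive_tensor1 f x sg.
Qed.

Lemma iter_partial_tensor s f g : smooth f -> smooth g ->
  exists f' g', [/\ smooth f', smooth g' & iter_partial s (tensor f g) = tensor f' g'].
Proof.
move=> sf sg; elim: s => [|i s [f' [g' [sf' sg' /= ->]]]]; first by exists f, g.
case: (ord2P i) => ->.
  by exists (derive1 f'), g'; rewrite partial0_tensor//; split => //; exact: smooth_derive1.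
by exists f', (derive1 g'); rewrite partial1_tensor//; split => //; exact: smooth_derive1.
Qed.

Lemma C_tensor k f g : smooth f -> smooth g -> C_ k (tensor f g).
Proof.
move=> sf sg s; have [f' [g' [sf' sg' ->]]] := iter_partial_tensor s sf sg.
split => [_|_ i x]; last exact: derivable_tensor.
by apply: continuous_tensor; exact: smooth_continuous.
Qed.

Lemma C1M u v : C_ 1 u -> C_ 1 v -> C_ 1 (u \* v).
Proof.
move=> /C1P[cu du] /C1P[cv dv]; apply/C1P; split.
  by move=> x; apply: cvgM; [exact: cu|exact: cv].
move=> i; have [dui cui] := du i; have [dvi cvi] := dv i; split.
  by move=> x; exact: derivableM.
have -> : partial i (u \* v) = (u \* partial i v) \+ (v \* partial i u).
  by apply/funext => x; rewrite /partial deriveM.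
move=> x; apply: cvgD; apply: cvgM; [exact: cu|exact: cvi|exact: cv|exact: cui].
Qed.

Lemma partialM i u v x : C_ 1 u -> C_ 1 v ->
  partial i (u \* v) x = u x * partial i v x + v x * partial i u x.
Proof.
move=> /C1P[_ du] /C1P[_ dv]; have [dui _] := du i; have [dvi _] := dv i.
by rewrite /partial deriveM.
Qed.

Lemma C1B u v : C_ 1 u -> C_ 1 v -> C_ 1 (u \- v).
Proof.
move=> /C1P[cu du] /C1P[cv dv]; apply/C1P; split.
  by move=> x; apply: cvgB; [exact: cu|exact: cv].
move=> i; have [dui cui] := du i; have [dvi cvi] := dv i; split.
  by move=> x; exact: derivableB.
have -> : partial i (u \- v) = partial i u \- partial i v.
  by apply/funext => x; rewrite /partial deriveB.
by move=> x; apply: cvgB; [exact: cui|exact: cvi].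
Qed.

Lemma partialB i u v x : C_ 1 u -> C_ 1 v ->
  partial i (u \- v) x = partial i u x - partial i v x.
Proof.
move=> /C1P[_ du] /C1P[_ dv]; have [dui _] := du i; have [dvi _] := dv i.
by rewrite /partial deriveB.
Qed.

Definition box (a b c d : R) : set plane := `[a, b]%classic `*` `[c, d]%classic.

Lemma compact_box a b c d : compact (box a b c d).
Proof. by apply: compact_setX; exact: segment_compact. Qed.

Lemma closed_box a b c d : closed (box a b c d).
Proof. by apply: compact_closed; [exact: norm_hausdorff|exact: compact_box]. Qed.

Lemma supp_sub u a b c d : (forall x, ~ box a b c d x -> u x = 0) ->
  supp u `<=` box a b c d.
Proof.
move=> h; rewrite [X in _ `<=` X](proj1 (closure_id _)); last exact: closed_box.
by apply: closure_subset => x /= ux; apply: contrapT => /h /eqP; rewrite (negbTE ux).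
Qed.

Lemma compact_supp_box u a b c d : supp u `<=` box a b c d -> compact (supp u).
Proof.
by move=> h; apply: (subclosed_compact _ (@compact_box a b c d)) => //; exact: closed_closure.
Qed.

Lemma Cc_box k u a b c d (O : set plane) : C_ k u ->
  (forall x, ~ box a b c d x -> u x = 0) -> box a b c d `<=` O -> Cc_ k O u.
Proof.
move=> ku /supp_sub hu hO; split => //; first exact: compact_supp_box hu.
exact: subset_trans hO.
Qed.

Lemma supp_eq0 u x : ~ supp u x -> u x = 0.
Proof.
move=> h; apply/eqP; apply: contrapT => /negP ux; apply: h.
exact: subset_closure.
Qed.

End plane_calculus.

(** * Integrals of compactly supported functions *)

Section plane_integration.
Context {R : realType}.
Local Notation plane := (R * R)%type.
Local Notation borel_plane := (measurableTypeR R * measurableTypeR R)%type.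
Local Notation leb2 := (@leb2 R).
Local Notation mu := (@lebesgue_measure R).
Implicit Types (u v w : plane -> R) (f g : R -> R) (x : plane).

Definition obox (a b c d : R) : set plane := `]a, b[%classic `*` `]c, d[%classic.

(** Boxes with rational corners form a countable basis. The empty box
    stands in for the codes of boxes that do not lie in [O]. *)
Lemma open_cover_obox (O : set plane) : open O ->
  exists F : nat -> R * R * (R * R),
    (forall k, box (F k).1.1 (F k).1.2 (F k).2.1 (F k).2.2 `<=` O) /\
    O `<=` \bigcup_k obox (F k).1.1 (F k).1.2 (F k).2.1 (F k).2.2.
Proof.
move=> oO.
pose E : R * R * (R * R) := ((1, 0), (1, 0)).
pose q4 (p : rat * rat * (rat * rat)) : R * R * (R * R) :=
  ((ratr p.1.1, ratr p.1.2), (ratr p.2.1, ratr p.2.2)).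
pose bx (p : R * R * (R * R)) := box p.1.1 p.1.2 p.2.1 p.2.2.
pose F k : R * R * (R * R) :=
  if unpickle k is Some p then (if pselect (bx (q4 p) `<=` O) then q4 p else E) else E.
have hE : bx E `<=` O by move=> x [/=]; rewrite in_itv/= => h _; exfalso; lra.
exists F; split => [k|[a b] Oab].
  by rewrite /F; case: unpickle => [p|//]; case: pselect.
have : nbhs (a, b) O by exact: open_nbhs_nbhs.
case=> -[U V]/= [/nbhs_ballP[e /= e0 aU] /nbhs_ballP[d /= d0 bV]] UVO.
have bt (c r : R) : 0 < r -> exists p q : rat,
    [/\ ratr p < c, c < ratr q & forall y : R, ratr p <= y <= ratr q -> ball c r y].
  move=> r0; have : c - r < c by rewrite ltrBlDr ltrDl.
  move=> /rat_in_itvoo[p]; rewrite in_itv/= => /andP[p1 p2].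
  have : c < c + r by rewrite ltrDl.
  move=> /rat_in_itvoo[q]; rewrite in_itv/= => /andP[q1 q2].
  exists p, q; split => // y /andP[py yq].
  by rewrite -ball_normE /= ltr_norml; apply/andP; split; lra.
have [p1 [q1 [pa aq ball1]]] := bt a e e0.
have [p2 [q2 [pb bq ball2]]] := bt b d d0.
have := @pickleK _ ((p1, q1), (p2, q2)); move: (pickle _) => k kE.
exists k; first exact: I.
rewrite /F kE; case: pselect => [?|]; first by split; rewrite /= in_itv/= ?pa ?pb.
case=> -[y z] [/=]; rewrite !in_itv/= => hy hz.
by apply: UVO; split; [apply: aU; exact: ball1|apply: bV; exact: ball2].
Qed.

Lemma measurable_obox a b c d : measurable (obox a b c d : set borel_plane).
Proof. by apply: measurableX; exact: measurable_itv. Qed.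

Lemma obox_sub_box a b c d : obox a b c d `<=` box a b c d.
Proof. by move=> x [/= h1 h2]; split; exact: subset_itv_oo_cc. Qed.

(** The Borel sets of the plane are generated by rectangles; the countable cover by
    boxes makes the link with the topology. *)
Lemma open_borel_plane (O : set plane) : open O -> measurable (O : set borel_plane).
Proof.
move=> /open_cover_obox[F [FO OF]].
rewrite (_ : O = \bigcup_k obox (F k).1.1 (F k).1.2 (F k).2.1 (F k).2.2); last first.
  by apply/seteqP; split=> // x [k _ /obox_sub_box]; exact: FO.
by apply: bigcupT_measurable => k; exact: measurable_obox.
Qed.

Lemma continuous_borel u : continuous u -> measurable_fun setT (u : borel_plane -> R).
Proof.
move=> cu; apply: (measurability _ (RGenOpens.measurableE R)).
move=> _ [_ [a [b ->] <-]]; rewrite setTI; apply: open_borel_plane.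
by move/continuousP in cu; exact/cu/interval_open.
Qed.

Lemma measurable_box a b c d : measurable (box a b c d : set borel_plane).
Proof. by apply: measurableX; exact: measurable_itv. Qed.

Lemma leb2_rect (A B : set (measurableTypeR R)) : measurable A -> measurable B ->
  leb2 (A `*` B) = (mu A * mu B)%E.
Proof. exact: product_measure1E. Qed.

Lemma leb2_box a b c d : a <= b -> c <= d ->
  leb2 (box a b c d) = ((b - a) * (d - c))%:E.
Proof.
move=> ab cd; rewrite leb2_rect; [|exact: measurable_itv..].
rewrite !lebesgue_measure_itv/= !lte_fin !lt_neqAle ab cd !andbT.
have [->|_] := eqVneq a b; first by rewrite subrr !mul0r mul0e.
by have [->|_] := eqVneq c d; rewrite ?subrr ?mulr0 ?mule0// -!EFinB -EFinM.
Qed.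

Lemma continuous_bounded_box u a b c d : continuous u ->
  exists2 M : R, 0 <= M & forall x, box a b c d x -> `|u x| <= M.
Proof.
move=> cu; have := @continuous_compact _ _ u (box a b c d).
have cu' : {within box a b c d, continuous u} by exact: continuous_subspaceT.
move=> /(_ cu' (@compact_box _ _ _ _ _)) /compact_bounded[M [_ hM]].
exists (`|M| + 1); first by rewrite addr_ge0.
move=> x bx; apply: hM; last by exists x.
by rewrite (le_lt_trans (ler_norm M))// ltrDl.
Qed.

Lemma bounded_supp_integrable u a b c d (M : R) :
  measurable_fun setT (u : borel_plane -> R) ->
  (forall x, `|u x| <= M) -> (forall x, ~ box a b c d x -> u x = 0) ->
  leb2.-integrable setT (fun x => (u x)%:E).
Proof.
move=> mu_ uM u0; apply/integrableP; split; first exact/measurable_EFinP.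
have mb := measurable_box a b c d.
have M0 : 0 <= M by exact: le_trans (uM (0, 0)).
apply: (@le_lt_trans _ _ (\int[leb2]_(x in box a b c d) M%:E)%E).
  apply: le_integral_arbitrary => x; first exact: erestrict_ge0.
  rewrite /patch mem_setT//.
  case: ifPn => [_|/negP xb]; first by rewrite lee_fin.
  by rewrite u0 ?abse0// => bx; apply: xb; exact/mem_set.
rewrite integral_cst//=.
have [ab|/ltW ba] := leP a b; have [cd|/ltW dc] := leP c d.
- by rewrite leb2_box// -EFinM ltry.
all: rewrite lte_mul_pinfty// ?lee_fin//.
all: rewrite leb2_rect; try exact: measurable_itv.
all: rewrite !lebesgue_measure_itv/=; do 2 case: ifP => _; rewrite ?mul0e ?mule0 ?ltry//.
Qed.

Lemma continuous_supp_bounded u a b c d : continuous u ->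
  (forall x, ~ box a b c d x -> u x = 0) -> exists M : R, forall x, `|u x| <= M.
Proof.
move=> cu u0; have [M M0 hM] := @continuous_bounded_box u a b c d cu.
exists M => x; have [/hM//|/u0 ->] := pselect (box a b c d x).
by rewrite normr0.
Qed.

Lemma continuous_supp_integrable u a b c d : continuous u ->
  (forall x, ~ box a b c d x -> u x = 0) ->
  leb2.-integrable setT (fun x => (u x)%:E).
Proof.
move=> cu u0; have [M hM] := continuous_supp_bounded cu u0.
by apply: bounded_supp_integrable u0 => //; exact: continuous_borel.
Qed.

Section halfline.
Variables (f : R -> R) (M : R).
Hypothesis df : forall x : R, derivable f x 1.
Hypothesis cf : continuous (derive1 f).
Hypothesis f0 : forall x : R, ~ (- M <= x <= M) -> f x = 0.

Let df0 (x : R) : ~ (- M <= x <= M) -> derive1 f x = 0.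
Proof.
move=> xM; rewrite derive1E (@near_eq_derive _ _ _ _ (cst 0)) ?derive_cst//.
have oM : open (~` `[- M, M]%classic) by exact/closed_openC/itv_closed.
have : nbhs x (~` `[- M, M]%classic).
  by apply: open_nbhs_nbhs; split => //=; rewrite in_itv.
by apply: filterS => y; rewrite /= in_itv/= => /f0.
Qed.

Lemma integral_derive_itv a b : a < b ->
  (\int[mu]_(x in `[a, b]) (derive1 f x)%:E = (f b)%:E - (f a)%:E)%E.
Proof.
move=> ab; apply: (continuous_FTC2 ab).
- by apply: continuous_subspaceT; exact: cf.
- have cf' : continuous f.
    by move=> x; apply: differentiable_continuous; apply/derivable1_diffP; exact: df.
  split; first by move=> x _; exact: df.
    by apply: cvg_at_right_filter; exact: cf'.
  by apply: cvg_at_left_filter; exact: cf'.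
- by [].
Qed.

(** The integral over the half line is one over [b, L] with [L] beyond the
    support of [f]. *)
Lemma integral_derive_gt b : (\int[mu]_(x in `]b, +oo[) (derive1 f x)%:E = (- f b)%:E)%E.
Proof.
pose L := Num.max b M + 1.
have bL : b < L by rewrite /L ltr_pwDr// le_max lexx.
have ML : M < L by rewrite /L ltr_pwDr// le_max lexx orbT.
transitivity (\int[mu]_(x in `[b, L]) (derive1 f x)%:E)%E.
  apply: (@eq_integral_off_null _ _ _ mu [set b]); [exact: measurable_set1|exact: lebesgue_measure_set1|].
  move=> x /= /eqP xb; rewrite /patch !mem_setE !in_itv/= andbT le_eqVlt eq_sym (negbTE xb)/=.
  have [bx|//] := ltP b x; case: leP => //= Lx.
  by rewrite df0// => /andP[_]; rewrite leNgt (lt_trans ML Lx).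
rewrite integral_derive_itv// f0 ?sub0e//.
by move=> /andP[_]; rewrite leNgt ML.
Qed.

Lemma integral_derive_lt b : (\int[mu]_(x in `]-oo, b[) (derive1 f x)%:E = (f b)%:E)%E.
Proof.
pose L := Num.min b (- M) - 1.
have bL : L < b by rewrite /L ltrBlDr ltr_pwDr// ge_min lexx.
have ML : L < - M by rewrite /L ltrBlDr ltr_pwDr// ge_min lexx orbT.
transitivity (\int[mu]_(x in `[L, b]) (derive1 f x)%:E)%E.
  apply: (@eq_integral_off_null _ _ _ mu [set b]); [exact: measurable_set1|exact: lebesgue_measure_set1|].
  move=> x /= /eqP xb; rewrite /patch !mem_setE !in_itv/= [x <= b]le_eqVlt (negbTE xb)/=.
  have [bx|bx] := ltP x b; rewrite ?andbF//= andbT; case: leP => //= Lx.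
  by rewrite df0// => /andP[+ _]; rewrite leNgt (lt_trans Lx ML).
rewrite integral_derive_itv// [f L]f0 ?sube0//.
by move=> /andP[+ _]; rewrite leNgt ML.
Qed.

Lemma integral_derive_T : (\int[mu]_x (derive1 f x)%:E = 0)%E.
Proof.
transitivity (\int[mu]_(x in `](- M - 1)%R, +oo[) (derive1 f x)%:E)%E.
  apply: (@eq_integral_off_null _ _ _ mu set0); rewrite ?measure0// => x _.
  rewrite /patch mem_setT mem_setE in_itv/= andbT; case: ltP => // xM.
  by rewrite df0// => /andP[h _]; move: xM h; lra.
rewrite integral_derive_gt f0 ?oppr0// => /andP[h _]; move: h; lra.
Qed.

End halfline.

Lemma continuous_pairr (y : R) : continuous (fun t : R => (t, y)).
Proof. by move=> x; apply: (@cvg_pair _ _ _ _ (nbhs x) (nbhs y)); [exact: cvg_id|exact: cvg_cst]. Qed.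

Lemma continuous_pairl (y : R) : continuous (fun t : R => (y, t)).
Proof. by move=> x; apply: (@cvg_pair _ _ _ _ (nbhs y) (nbhs x)); [exact: cvg_cst|exact: cvg_id]. Qed.

Lemma C1_slice0 u (y : R) : C_ 1 u ->
  (forall x : R, derivable (fun t => u (t, y)) x 1) /\
  continuous (derive1 (fun t => u (t, y))).
Proof.
move=> /C1P[cu /(_ 0)[du cdu]]; split.
  by move=> x; exact: ((@derivable_unit0 _ u (x, y)).1 (du (x, y))).
rewrite (_ : derive1 _ = fun t => partial 0 u (t, y)); last first.
  by apply/funext => t; rewrite partial0E.
move=> x; apply: (@continuous_comp _ _ _ (fun t => (t, y))); last exact: cdu.
exact: continuous_pairr.
Qed.

Lemma C1_slice1 u (y : R) : C_ 1 u ->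
  (forall x : R, derivable (fun t => u (y, t)) x 1) /\
  continuous (derive1 (fun t => u (y, t))).
Proof.
move=> /C1P[cu /(_ 1)[du cdu]]; split.
  by move=> x; exact: ((@derivable_unit1 _ u (y, x)).1 (du (y, x))).
rewrite (_ : derive1 _ = fun t => partial 1 u (y, t)); last first.
  by apply/funext => t; rewrite partial1E.
move=> x; apply: (@continuous_comp _ _ _ (fun t => (y, t))); last exact: cdu.
exact: continuous_pairl.
Qed.

Lemma partial_supp i u a b c d : (forall x, ~ box a b c d x -> u x = 0) ->
  forall x, ~ box a b c d x -> partial i u x = 0.
Proof.
move=> u0 x xb; rewrite /partial (@near_eq_derive _ _ _ _ (cst 0)) ?derive_cst//.
have ob : open (~` box a b c d) by exact/closed_openC/closed_box.
have : nbhs x (~` box a b c d) by exact: open_nbhs_nbhs.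
by apply: filterS => y /= /u0.
Qed.

End plane_integration.

(** * The fundamental lemma of the calculus of variations *)

Section zero_integral.
Local Open Scope ereal_scope.
Context d (T : measurableType d) (R : realType).
Variables (mu : {measure set T -> \bar R}) (f : T -> R).
Hypothesis fi : mu.-integrable setT (EFin \o f).

Let fiS A : measurable A -> mu.-integrable A (EFin \o f).
Proof. by move=> mA; apply: integrableS fi. Qed.

(** The sets [Z] over which the integral vanishes form a Dynkin system: the
    integral of [f] is a signed measure, and vanishes over all of [K]. *)
Lemma integral0_dynkin d' (T' : measurableType d') (h : T -> T')
    (G : set (set T')) (K : set T) :
  measurable_fun setT h -> measurable K -> measurable = <<s G>> -> setI_closed G ->
  \int[mu]_(x in K) (f x)%:E = 0 ->
  (forall Z, G Z -> \int[mu]_(x in h @^-1` Z `&` K) (f x)%:E = 0) ->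
  forall Z, measurable Z -> \int[mu]_(x in h @^-1` Z `&` K) (f x)%:E = 0.
Proof.
move=> mh mK GE GI K0 G0 Z mZ.
have mhK Y : measurable Y -> measurable (h @^-1` Y `&` K).
  by move=> mY; apply: measurableI => //; rewrite -[_ @^-1` _]setTI; exact: mh.
apply: (@dynkin_induction _ T' G (fun Z => \int[mu]_(x in h @^-1` Z `&` K) (f x)%:E = 0) GE GI).
- by rewrite preimage_setT setTI.
- exact: G0.
- move=> S mS S0; have KE : h @^-1` (~` S) `&` K `|` h @^-1` S `&` K = K.
    by rewrite -setIUl preimage_setC setUC setUv setTI.
  move: K0; rewrite -{1}KE integral_setU ?S0 ?adde0//.
  + by apply: mhK; exact: measurableC.
  + exact: mhK.
  + by rewrite KE; exact: (measurable_int _ (fiS mK)).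
  + rewrite disj_set2E; apply/eqP/seteqP; split => // x [[/= h1 _] [h2 _]].
    exact: h1.
- move=> F mF tF F0.
  rewrite preimage_bigcup setI_bigcupl integral_bigcup.
  + by rewrite eseries0// => i _ _; exact: F0.
  + apply/trivIsetP => i1 i2 _ _ i12; apply/seteqP; split => // x [[/= h1 _] [h2 _]].
    by move/trivIsetP : tF => /(_ i1 i2 I I i12) /seteqP[+ _]; apply; split; [exact: h1|exact: h2].
  + by move=> k; exact: mhK.
  + by apply: fiS; apply: bigcupT_measurable => k; exact: mhK.
- by rewrite -GE.
Qed.

End zero_integral.

Section fundamental_lemma.
Context {R : realType}.
Local Notation plane := (R * R)%type.
Local Notation borel_plane := (measurableTypeR R * measurableTypeR R)%type.
Local Notation leb2 := (@leb2 R).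
Local Notation mu := (@lebesgue_measure R).

Lemma plateau_cvg (a b x : R) :
  plateau a b k.+1%:R^-1 x @[k --> \oo] --> (\1_(`]a, b[%classic) x : R).
Proof.
have [xab|xab] := boolP (a < x < b).
  rewrite indicE mem_set ?in_itv//=; apply: cvg_near_cst.
  have e0 : 0 < Num.min (x - a) (b - x).
    by move: xab => /andP[? ?]; rewrite lt_min !subr_gt0; apply/andP.
  move: xab => /andP[xa xb].
  near=> k; apply: plateau_eq1; first by rewrite invr_gt0.
  have : k.+1%:R^-1 < Num.min (x - a) (b - x).
    by near: k; exact: (near_infty_natSinv_lt (PosNum e0)).
  by move: (_^-1) => e; rewrite lt_min => /andP[h1 h2]; apply/andP; split; lra.
rewrite indicE memNset /= ?in_itv//=; last exact/negP.
apply: cvg_near_cst; near=> k.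
by apply: plateau_eq0; rewrite ?invr_gt0.
Unshelve. all: by end_near. Qed.

Lemma Ccinfty_plateau (a b c d e : R) (O : set plane) : 0 < e ->
  box a b c d `<=` O -> Ccinfty O (tensor (plateau a b e) (plateau c d e)).
Proof.
move=> e0 bO k; apply: (@Cc_box _ _ _ a b c d) => //.
  by apply: C_tensor; exact: smooth_plateau.
move=> x xb; rewrite /tensor.
have [x1|x1] := boolP (a < x.1 < b); last by rewrite (plateau_eq0 e0 x1) mul0r.
have [x2|x2] := boolP (c < x.2 < d); last by rewrite (plateau_eq0 e0 x2) mulr0.
exfalso; apply: xb; apply: (@obox_sub_box _ a b c d).
by split; rewrite /= in_itv.
Qed.

Variables (O : set plane) (f : plane -> R).
Hypothesis fi : leb2.-integrable setT (EFin \o f).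
Hypothesis f0 : forall psi, Ccinfty O psi -> (\int[leb2]_x (f x * psi x)%:E = 0)%E.

Let mf : measurable_fun setT (f : borel_plane -> R).
Proof. by have /integrableP[/measurable_EFinP] := fi. Qed.

(* Plateaus that fill the box tend to its indicator function. *)
Let obox0 a b c d : box a b c d `<=` O ->
  (\int[leb2]_(x in obox a b c d) (f x)%:E = 0)%E.
Proof.
move=> bO; pose psi k := tensor (plateau a b k.+1%:R^-1) (plateau c d k.+1%:R^-1).
have Cpsi k : Ccinfty O (psi k) by apply: Ccinfty_plateau => //; rewrite invr_gt0.
have cpsi k : continuous (psi k).
  by apply: continuous_tensor; apply: smooth_continuous; exact: smooth_plateau.
pose fk k x := (f x * psi k x)%:E.
have mfk k : measurable_fun setT (fk k : borel_plane -> \bar R).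
  apply/measurable_EFinP; apply: measurable_funM => //; exact: continuous_borel.
have mlim : measurable_fun setT ((fun x => (f x * \1_(obox a b c d) x)%:E) : borel_plane -> \bar R).
  apply/measurable_EFinP; apply: measurable_funM => //.
  by apply: measurable_indic; exact: measurable_obox.
have cvgf : {ae leb2, forall x : borel_plane, setT x ->
    fk ^~ x @ \oo --> (f x * \1_(obox a b c d) x)%:E}.
  apply: aeW => x _; apply: cvg_EFin; first by near=> n.
  apply: cvgM; first exact: cvg_cst.
  have -> : \1_(obox a b c d) x = \1_`]a, b[%classic x.1 * \1_`]c, d[%classic x.2 :> R.
    by rewrite !indicE /obox in_setX -natrM mulnb.
  by apply: cvgM; exact: plateau_cvg.
have ig : leb2.-integrable setT (abse \o (EFin \o f)) by exact: integrable_abse.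
have domf : {ae leb2, forall (x : borel_plane) n, setT x -> (`|fk n x| <= (abse \o (EFin \o f)) x)%E}.
  apply: aeW => x n _; rewrite /fk /= lee_fin normrM ler_piMr//.
  by rewrite /psi /tensor normrM !ger0_norm ?plateau_ge0// mulr_ile1 ?plateau_ge0 ?plateau_le1.
have [_ _] := @dominated_convergence _ _ _ leb2 setT measurableT fk _ _ mfk mlim cvgf ig domf.
have -> : (fun n => (\int[leb2]_x fk n x)%E) = cst 0%E.
  by apply/funext => n; exact: f0.
move=> /(cvg_lim (@ereal_hausdorff R)); rewrite lim_cst// => E0.
transitivity (\int[leb2]_x (f x * \1_(obox a b c d) x)%:E)%E; last by rewrite -E0.
rewrite [LHS]integral_mkcond; apply: eq_integral => x _.
by rewrite /patch /= indicE; case: ifP => _; rewrite ?mulr1 ?mulr0.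
Unshelve. all: by end_near. Qed.

Let itv_gt_setI_closed : setI_closed (@RGenOInfty.G R).
Proof.
move=> _ _ [x ->] [y ->]; exists (Num.max x y).
by apply/seteqP; split => z /=; rewrite !in_itv/= !andbT gt_max; [move=> [-> ->]|move=> /andP].
Qed.

(* From boxes to Borel sets by three monotone class arguments: one for each
   coordinate, on half lines, and one on rectangles. *)
Let zero_in_box a b c d : box a b c d `<=` O -> forall A : set borel_plane, measurable A ->
  (\int[leb2]_(x in A `&` obox a b c d) (f x)%:E = 0)%E.
Proof.
move=> bO.
have bO' a' c' : a <= a' -> c <= c' -> box a' b c' d `<=` O.
  move=> aa cc; apply: subset_trans bO => -[s t]; rewrite /box /= !in_itv/=.
  by move=> [/andP[h1 ->] /andP[h2 ->]]; rewrite (le_trans aa h1) (le_trans cc h2).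
have mo a' c' := @measurable_obox R a' b c' d.
have step1 c' : c <= c' -> forall X : set (measurableTypeR R), measurable X ->
    (\int[leb2]_(x in fst @^-1` X `&` obox a b c' d) (f x)%:E = 0)%E.
  move=> cc; apply: (integral0_dynkin fi measurable_fst _ (RGenOInfty.measurableE R)) => //.
    by apply: obox0; exact: bO'.
  move=> _ [x ->].
  rewrite (_ : fst @^-1` _ `&` _ = obox (Num.max x a) b c' d).
    by apply: obox0; apply: bO' => //; rewrite le_max lexx orbT.
  apply/seteqP; split => -[s t]; rewrite /obox /= !in_itv/= !andbT gt_max.
    by move=> [-> [/andP[-> ->] ->]].
  by move=> [/andP[/andP[-> ->] ->] ->].
have step2 (X Y : set (measurableTypeR R)) : measurable X -> measurable Y ->
    (\int[leb2]_(x in snd @^-1` Y `&` (fst @^-1` X `&` obox a b c d)) (f x)%:E = 0)%E.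
  move=> mX; move: Y.
  apply: (integral0_dynkin fi measurable_snd _ (RGenOInfty.measurableE R)) => //.
  - apply: measurableI => //; rewrite -[_ @^-1` _]setTI; exact: measurable_fst.
  - exact: (step1 c (lexx c) X mX).
  move=> _ [y ->].
  rewrite (_ : snd @^-1` _ `&` _ = fst @^-1` X `&` obox a b (Num.max y c) d).
    by apply: step1 => //; rewrite le_max lexx orbT.
  apply/seteqP; split => -[s t]; rewrite /obox /= !in_itv/= !andbT gt_max.
    by move=> [-> [? [? /andP[-> ->]]]].
  by move=> [? [? /andP[/andP[-> ->] ->]]].
move=> A mA.
apply: (integral0_dynkin fi (@measurable_id _ _ setT) _ (measurable_prod_measurableType _ _)) mA => //.
- move=> _ _ [X mX [Y mY <-]] [X' mX' [Y' mY' <-]]; exists (X `&` X'); first exact: measurableI.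
  by exists (Y `&` Y'); [exact: measurableI|rewrite setXI].
- exact: obox0.
move=> _ [X mX [Y mY <-]].
rewrite (_ : id @^-1` _ `&` _ = snd @^-1` Y `&` (fst @^-1` X `&` obox a b c d)); first exact: step2.
by apply/seteqP; split => -[s t] /=; tauto.
Qed.

(** On each box of a countable cover of [O], the integral of [f] vanishes over all
    Borel subsets, so that [f] is 0 almost everywhere there. *)
Lemma fundamental_lemma : open O ->
  exists N : set borel_plane, [/\ measurable N, leb2 N = 0%E &
    forall x, O x -> ~ N x -> f x = 0].
Proof.
move=> /open_cover_obox[F [FO OF]].
pose ob k := obox (F k).1.1 (F k).1.2 (F k).2.1 (F k).2.2.
have mob k : measurable (ob k : set borel_plane) by exact: measurable_obox.
have /choice[N hN] : forall k, exists N : set borel_plane,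
    [/\ measurable N, leb2 N = 0%E & forall x, ob k x -> ~ N x -> f x = 0].
  move=> k.
  have : ae_eq leb2 (ob k) (EFin \o f) (cst 0%E).
    apply: integral_ae_eq => //.
      by apply: integrableS fi.
    move=> E Eob mE; rewrite integral0.
    by rewrite -(setIidl Eob); exact: zero_in_box.
  move=> [N [mN N0 hN]]; exists N; split => // x obx Nx.
  have : ob k x -> (f x)%:E = 0%E by apply: contrapT => h; apply: Nx; exact: hN.
  by move=> /(_ obx) [].
exists (\bigcup_k N k); split.
- by apply: bigcupT_measurable => k; have [] := hN k.
- by apply: leb2_bigcup0 => k; have [] := hN k.
- move=> x /OF[k _ obx] Nx; have [_ _] := hN k; apply => //.
  by apply: contra_not Nx => Nx; exists k.
Qed.

End fundamental_lemma.

(** * Weak partial derivatives *)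

Section square_integrable.
Context {R : realType}.
Local Notation plane := (R * R)%type.
Local Notation borel_plane := (measurableTypeR R * measurableTypeR R)%type.
Local Notation leb2 := (@leb2 R).
Implicit Types (u v w f g : plane -> R) (N D O : set borel_plane).

Definition null N := measurable N /\ leb2 N = 0%E.

Lemma nullU N N' : null N -> null N' -> null (N `|` N').
Proof.
move=> [mN N0] [mN' N'0]; split; first exact: measurableU.
by rewrite measureU0.
Qed.

(** The Borel form of L2: every function in L2 is of this kind off a null set. *)
Definition square_integrable D f :=
  measurable_fun D (f : borel_plane -> R) /\
  leb2.-integrable D (fun x => (f x ^+ 2)%:E).

Lemma integral_setD_null N D (f : plane -> \bar R) : null N ->
  (\int[leb2]_(x in D `\` N) f x = \int[leb2]_(x in D) f x)%E.
Proof.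
move=> [mN N0]; apply: (eq_integral_off_null mN N0) => x Nx; rewrite /patch.
by congr (if _ then _ else _); rewrite in_setD (memNset Nx) andbT.
Qed.

Lemma square_integrableS D D' f : measurable D -> measurable D' -> D' `<=` D ->
  square_integrable D f -> square_integrable D' f.
Proof.
move=> mD mD' DD [mf fi]; split; first exact: measurable_funS mf.
exact: integrableS fi.
Qed.

Lemma L2_square_integrable O f : measurable O -> L2 O f ->
  exists2 N, null N & square_integrable (O `\` N) f.
Proof.
move=> mO [mf fi]; have [N [mN N0 mfN]] := lmeasurable_fun_borel mO mf.
exists N => //; split => //; apply/integrableP; split.
  by apply/measurable_EFinP; exact: measurable_funX.
rewrite integral_setD_null//; apply: le_lt_trans fi.
by apply: le_integral_arbitrary => x; rewrite /patch; case: ifP => //= _; rewrite ger0_norm ?sqr_ge0.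
Qed.

Section fixed_domain.
Variable D : set borel_plane.
Hypothesis mD : measurable D.

Lemma square_integrableM f g : square_integrable D f -> square_integrable D g ->
  leb2.-integrable D (fun x => (f x * g x)%:E).
Proof.
move=> [mf fi] [mg gi].
apply: (le_integrable mD _ _ (integrableD mD fi gi)).
  by apply/measurable_EFinP; exact: measurable_funM.
move=> x Dx /=; rewrite lee_fin.
have -> : `|f x ^+ 2 + g x ^+ 2| = f x ^+ 2 + g x ^+ 2 by rewrite ger0_norm ?addr_ge0 ?sqr_ge0.
by rewrite ler_norml; apply/andP; split; nra.
Qed.

Lemma square_integrableB f g : square_integrable D f -> square_integrable D g ->
  square_integrable D (f \- g).
Proof.
move=> [mf fi] [mg gi]; split; first exact: measurable_funB.
have fgi : leb2.-integrable D (fun x => (2%:E * (f x ^+ 2)%:E + 2%:E * (g x ^+ 2)%:E))%E.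
  by apply: integrableD => //; exact: integrableZl.
apply: (le_integrable mD _ _ fgi).
  by apply/measurable_EFinP/measurable_funX; exact: measurable_funB.
move=> x Dx /=; rewrite lee_fin ger0_norm ?sqr_ge0//.
have := sqr_ge0 (f x + g x); have := sqr_ge0 (f x); have := sqr_ge0 (g x).
by rewrite !expr2 => *; rewrite ger0_norm; nra.
Qed.

Variables a b c d : R.
Hypothesis Dbox : D `<=` box a b c d.

Lemma bounded_domain_fin : (leb2 D < +oo)%E.
Proof.
apply: (@le_lt_trans _ _ (leb2 (box a b c d))).
  by apply: le_measure; rewrite ?inE//; exact: measurable_box.
rewrite leb2_rect; [|exact: measurable_itv..].
by rewrite !lebesgue_measure_itv/=; do 2 case: ifP => _; rewrite ?mul0e ?mule0 -?EFinM ?ltry.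
Qed.

Lemma square_integrable_continuous f : continuous f -> square_integrable D f.
Proof.
move=> cf; have mf : measurable_fun D (f : borel_plane -> R).
  by apply: measurable_funS (continuous_borel cf).
split => //; have [M M0 hM] := @continuous_bounded_box _ f a b c d cf.
have ci : leb2.-integrable D (cst (M ^+ 2)%:E).
    apply/integrableP; split; first exact: measurable_cst.
    by rewrite integral_cst//= lte_mul_pinfty// bounded_domain_fin.
apply: (le_integrable mD _ _ ci); first by apply/measurable_EFinP; exact: measurable_funX.
move=> x /Dbox/hM xM /=; rewrite lee_fin !ger0_norm ?sqr_ge0//.
by rewrite -real_normK ?num_real// ler_pXn2r// nnegrE.
Qed.

Lemma square_integrable_integrable f : square_integrable D f ->
  leb2.-integrable D (EFin \o f).
Proof.
move=> fs; have c1 : square_integrable D (cst 1).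
  by apply: square_integrable_continuous => x; exact: cvg_cst.
have := square_integrableM fs c1.
by apply: eq_integrable => // x _; rewrite /= mulr1.
Qed.

End fixed_domain.

End square_integrable.

Section weak.
Context {R : realType}.
Local Notation plane := (R * R)%type.
Local Notation borel_plane := (measurableTypeR R * measurableTypeR R)%type.
Local Notation leb2 := (@leb2 R).
Implicit Types (u v w f g : plane -> R) (N D : set borel_plane).

(** Fubini: on each line parallel to the axis, the integral of the derivative of a
    compactly supported function vanishes. *)
Lemma integral_partial_eq0 i u a b c d : C_ 1 u ->
  (forall x, ~ box a b c d x -> u x = 0) ->
  (\int[leb2]_x (partial i u x)%:E = 0)%E.
Proof.
move=> C1u u0; pose M := `|a| + `|b| + `|c| + `|d|.
have u0' x : ~ box (- M) M (- M) M x -> u x = 0.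
  move=> xM; apply: u0 => xb; apply: xM; move: xb; rewrite /box /= !in_itv/= => -[/andP[h1 h2] /andP[h3 h4]].
  have := ler_norm a; have := ler_norm b; have := ler_norm c; have := ler_norm d.
  have := ler_norm (- a); have := ler_norm (- b); have := ler_norm (- c); have := ler_norm (- d).
  have := normr_ge0 a; have := normr_ge0 b; have := normr_ge0 c; have := normr_ge0 d.
  by rewrite /M !normrN => *; split; apply/andP; split; lra.
have iu : leb2.-integrable setT (fun x => (partial i u x)%:E).
  apply: (continuous_supp_integrable _ (partial_supp i u0)).
  by move/C1P : C1u => [_ /(_ i)[]].
case: (ord2P i) iu => -> iu.
- rewrite -(integral21_prod_meas1 iu) /=.
  apply: integral0_eq => y _; rewrite /fubini_G.
  have [d1 d2] := C1_slice0 y C1u.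
  rewrite -[RHS](@integral_derive_T _ (fun t => u (t, y)) M d1 d2); last first.
    by move=> x xM; apply: u0' => -[/=]; rewrite in_itv/=.
  by apply: eq_integral => x _; rewrite partial0E.
- rewrite -(integral12_prod_meas1 iu) /=.
  apply: integral0_eq => y _; rewrite /fubini_F.
  have [d1 d2] := C1_slice1 y C1u.
  rewrite -[RHS](@integral_derive_T _ (fun t => u (y, t)) M d1 d2); last first.
    by move=> x xM; apply: u0' => -[/= _]; rewrite in_itv/=.
  by apply: eq_integral => x _; rewrite partial1E.
Qed.

Lemma Cc_partial_eq0 k i (O : set plane) psi x : Cc_ k O psi -> ~ O x ->
  psi x = 0 /\ partial i psi x = 0.
Proof.
move=> [_ _ sO] Ox; have sx : ~ supp psi x by move=> /sO.
split; first exact: supp_eq0.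
rewrite /partial (@near_eq_derive _ _ _ _ (cst 0)) ?derive_cst//.
have : nbhs x (~` supp psi).
  by apply: open_nbhs_nbhs; split => //; apply: closed_openC; exact: closed_closure.
by apply: filterS => y /= /supp_eq0.
Qed.

Lemma Ccinfty_Cc1 (O : set plane) psi : Ccinfty O psi -> Cc_ 1 O psi.
Proof. exact. Qed.

Lemma Cc1_continuous (O : set plane) psi : Cc_ 1 O psi -> continuous psi.
Proof. by move=> [/C1P[]]. Qed.

Lemma C1_continuous_partial u i : C_ 1 u -> continuous (partial i u).
Proof. by move=> /C1P[_ /(_ i)[]]. Qed.

Variables (O : set plane) (a b c d : R).
Hypotheses (oO : open O) (Ob : O `<=` box a b c d).

Let mO : measurable (O : set borel_plane).
Proof. exact: open_borel_plane. Qed.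

Let mOD N : null N -> measurable (O `\` N : set borel_plane).
Proof. by move=> [mN _]; exact: measurableD. Qed.

Let ODb N : O `\` N `<=` box a b c d.
Proof. by move=> x [/Ob]. Qed.

Lemma integral_domain (f : plane -> \bar R) : (forall x, ~ O x -> f x = 0%E) ->
  (\int[leb2]_(x in O) f x = \int[leb2]_x f x)%E.
Proof.
move=> f0; rewrite integral_mkcond; apply: eq_integral => x _.
by rewrite /patch; case: ifPn => // /negP xO; rewrite f0// => Ox; apply: xO; exact/mem_set.
Qed.

Lemma L2_continuous u : continuous u -> L2 O u.
Proof.
move=> cu; split.
  apply: borel_lmeasurable_fun => //; exact: measurable_funS (continuous_borel cu).
have [_ /integrableP[_]] := square_integrable_continuous mO Ob cu.
by under eq_integral do rewrite gee0_abs ?lee_fin ?sqr_ge0//.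
Qed.

(** The product of [u] and [psi] is compactly supported, so that the integral of
    its derivative vanishes. *)
Lemma integration_by_parts i u psi : C_ 1 u -> Cc_ 1 O psi ->
  (\int[leb2]_(x in O) (u x * partial i psi x)%:E =
   - \int[leb2]_(x in O) (partial i u x * psi x)%:E)%E.
Proof.
move=> C1u Cpsi; have [C1psi _ _] := Cpsi.
have z x : ~ O x -> psi x = 0 /\ partial i psi x = 0 := @Cc_partial_eq0 1 i O psi x Cpsi.
have zb x : ~ box a b c d x -> psi x = 0.
  by move=> xb; have [] // := z x _; apply: contra_not xb => /Ob.
have zb' := partial_supp i zb.
rewrite !integral_domain; last 2 first.
- by move=> x /z[-> _]; rewrite mulr0.
- by move=> x /z[_ ->]; rewrite mulr0.
have cu : continuous u by move/C1P : C1u => [].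
have cpsi := Cc1_continuous Cpsi.
have i1 : leb2.-integrable setT (fun x => (u x * partial i psi x)%:E).
  apply: (@continuous_supp_integrable _ _ a b c d) => [x|x /zb' ->]; last by rewrite mulr0.
  by apply: cvgM; [exact: cu|exact: C1_continuous_partial].
have i2 : leb2.-integrable setT (fun x => (partial i u x * psi x)%:E).
  apply: (@continuous_supp_integrable _ _ a b c d) => [x|x /zb ->]; last by rewrite mulr0.
  by apply: cvgM; [exact: C1_continuous_partial|exact: cpsi].
have : (\int[leb2]_x (partial i (u \* psi) x)%:E = 0)%E.
  apply: (@integral_partial_eq0 i _ a b c d); first exact: C1M.
  by move=> x /zb /= ->; rewrite mulr0.
under eq_integral => x _ do rewrite partialM// [psi x * _]mulrC EFinD.
rewrite integralD//.
have f1 := integrable_fin_num measurableT i1.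
have f2 := integrable_fin_num measurableT i2.
rewrite -(fineK f1) -(fineK f2) -EFinD => -[/eqP]; rewrite addr_eq0 => /eqP ->.
by rewrite EFinN.
Qed.

Lemma is_weak_partial_C1 i u : C_ 1 u -> is_weak_partial O i u (partial i u).
Proof.
move=> C1u; split; first by apply: L2_continuous; exact: C1_continuous_partial.
by move=> psi Cpsi; apply: integration_by_parts => //; exact: Ccinfty_Cc1.
Qed.

Lemma H1_C1 u : C_ 1 u -> H1 O u.
Proof.
move=> C1u; split; first by apply: L2_continuous; move/C1P : C1u => [].
by move=> i; exists (partial i u); exact: is_weak_partial_C1.
Qed.

Lemma weak_partialP i u : H1 O u -> is_weak_partial O i u (weak_partial O i u).
Proof. by move=> [_ /(_ i) h]; exact: xgetPex. Qed.

(** The difference of two weak derivatives is orthogonal to all test functions. *)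
Lemma weak_partial_unique i u g h :
  is_weak_partial O i u g -> is_weak_partial O i u h ->
  exists2 N, null N & forall x, O x -> ~ N x -> g x = h x.
Proof.
move=> [L2g hg] [L2h hh].
have [N1 N1n sg] := L2_square_integrable mO L2g.
have [N2 N2n sh] := L2_square_integrable mO L2h.
have N12 := nullU N1n N2n.
pose D := O `\` (N1 `|` N2).
have mD : measurable (D : set borel_plane) by exact: mOD.
have Db : D `<=` box a b c d by exact: ODb.
have sgD : square_integrable D g.
  by apply: square_integrableS sg; [exact: mOD| |move=> x [Ox Nx]; split=> // ?; apply: Nx; left].
have shD : square_integrable D h.
  by apply: square_integrableS sh; [exact: mOD| |move=> x [Ox Nx]; split=> // ?; apply: Nx; right].
have sD := square_integrableB mD sgD shD.
pose f : plane -> R := (g \- h) \_ D.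
have fi : leb2.-integrable setT (EFin \o f).
  rewrite /f -restrict_EFin; apply: (integrable_mkcond _ mD).1.
  exact: (square_integrable_integrable mD Db sD).
have [psi Cpsi|N3 [mN3 N30 hN3]] := @fundamental_lemma R O f fi _ oO.
  have spsi : square_integrable D psi.
    by apply: square_integrable_continuous Db _ _ => //; apply: (@Cc1_continuous O); exact: Ccinfty_Cc1.
  have gi := square_integrableM mD sgD spsi.
  have hi := square_integrableM mD shD spsi.
  transitivity (\int[leb2]_(x in D) ((g x * psi x)%:E - (h x * psi x)%:E))%E.
    rewrite [RHS]integral_mkcond; apply: eq_integral => x _.
    by rewrite /f /patch; case: ifP => _ /=; rewrite ?mul0r// mulrBl.
  rewrite integralB// !integral_setD_null//.
  have := hg psi Cpsi; rewrite hh// => /eqP; rewrite eqe_opp => /eqP ->.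
  rewrite subee// -(integral_setD_null _ _ N12).
  exact: integrable_fin_num.
exists (N1 `|` N2 `|` N3); first exact: nullU.
move=> x Ox Nx; have := hN3 x Ox; rewrite /f /patch ifT; last first.
  by apply/mem_set; split => // N12x; apply: Nx; left.
by move=> fx; apply/eqP; rewrite -subr_eq0; apply/eqP; apply: fx => N3x; apply: Nx; right.
Qed.

Lemma L2B f g : L2 O f -> L2 O g -> L2 O (f \- g).
Proof.
move=> L2f L2g; split.
  by have [+ _] := L2f; have [+ _] := L2g; move=> mg mf; exact: measurable_funB.
have [N1 N1n sf] := L2_square_integrable mO L2f.
have [N2 N2n sg] := L2_square_integrable mO L2g.
have N12 := nullU N1n N2n; rewrite -(integral_setD_null _ _ N12).
pose D := O `\` (N1 `|` N2).
have mD : measurable (D : set borel_plane) by exact: mOD.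
have sfD : square_integrable D f.
  by apply: square_integrableS sf; [exact: mOD| |move=> x [Ox Nx]; split=> // ?; apply: Nx; left].
have sgD : square_integrable D g.
  by apply: square_integrableS sg; [exact: mOD| |move=> x [Ox Nx]; split=> // ?; apply: Nx; right].
have [_ /integrableP[_]] := square_integrableB mD sfD sgD.
by under eq_integral do rewrite gee0_abs ?lee_fin ?sqr_ge0//.
Qed.

Lemma L2_continuousM_integral f g psi : L2 O f -> L2 O g -> continuous psi ->
  (\int[leb2]_(x in O) ((f \- g) x * psi x)%:E =
   \int[leb2]_(x in O) (f x * psi x)%:E - \int[leb2]_(x in O) (g x * psi x)%:E)%E
  /\ (\int[leb2]_(x in O) (f x * psi x)%:E)%E \is a fin_num.
Proof.
move=> L2f L2g cpsi.
have [N1 N1n sf] := L2_square_integrable mO L2f.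
have [N2 N2n sg] := L2_square_integrable mO L2g.
have N12 := nullU N1n N2n; rewrite -!(integral_setD_null O _ N12).
pose D := O `\` (N1 `|` N2).
have mD : measurable (D : set borel_plane) by exact: mOD.
have Db : D `<=` box a b c d by exact: ODb.
have sfD : square_integrable D f.
  by apply: square_integrableS sf; [exact: mOD| |move=> x [Ox Nx]; split=> // ?; apply: Nx; left].
have sgD : square_integrable D g.
  by apply: square_integrableS sg; [exact: mOD| |move=> x [Ox Nx]; split=> // ?; apply: Nx; right].
have spsi : square_integrable D psi by exact: square_integrable_continuous Db _ _.
have fi := square_integrableM mD sfD spsi.
have gi := square_integrableM mD sgD spsi.
split; last exact: integrable_fin_num.
by rewrite -integralB//; apply: eq_integral => x _ /=; rewrite mulrBl.
Qed.

Lemma is_weak_partialB i u v g h : L2 O u -> L2 O v ->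
  is_weak_partial O i u g -> is_weak_partial O i v h ->
  is_weak_partial O i (u \- v) (g \- h).
Proof.
move=> L2u L2v [L2g hg] [L2h hh]; split; first exact: L2B.
move=> psi Cpsi.
have cpsi := Cc1_continuous (Ccinfty_Cc1 Cpsi).
have cdpsi : continuous (partial i psi).
  by apply: C1_continuous_partial; have [] := Ccinfty_Cc1 Cpsi.
have [-> _] := L2_continuousM_integral L2u L2v cdpsi.
have [-> _] := L2_continuousM_integral L2g L2h cpsi.
have [_ fh] := L2_continuousM_integral L2h L2g cpsi.
by rewrite hg// hh// fin_num_oppeB// oppeK.
Qed.

(** The Dirichlet energy is defined with a weak gradient chosen arbitrarily; by
    uniqueness any other choice gives the same value. *)
Lemma dirichlet_eq u (g : 'I_2 -> plane -> R) :
  (forall i, is_weak_partial O i u (g i)) ->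
  (dirichlet O u = \int[leb2]_(x in O) (\sum_(i < 2) (g i x) ^+ 2)%:E)%E.
Proof.
move=> hg.
have H1u : is_weak_partial O 0 u (weak_partial O 0 u) by apply: xgetPex; exists (g 0); exact: hg.
have H2u : is_weak_partial O 1 u (weak_partial O 1 u) by apply: xgetPex; exists (g 1); exact: hg.
have [N1 N1n h1] := weak_partial_unique H1u (hg 0).
have [N2 N2n h2] := weak_partial_unique H2u (hg 1).
have [mN N0] := nullU N1n N2n.
apply: (eq_integral_off_null mN N0) => x /not_orP[Nx1 Nx2].
rewrite /patch; case: ifPn => // /set_mem Ox.
rewrite !big_ord_recl !big_ord0 /=.
have -> : lift ord0 ord0 = 1 :> 'I_2 by exact: val_inj.
by rewrite h1// h2.
Qed.

Lemma dirichlet_C1 u : C_ 1 u ->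
  (dirichlet O u = \int[leb2]_(x in O) (\sum_(i < 2) (partial i u x) ^+ 2)%:E)%E.
Proof. by move=> C1u; apply: dirichlet_eq => i; exact: is_weak_partial_C1. Qed.

End weak.

(** * Balls and the Dirichlet principle *)

Section ball.
Context {R : realType}.
Local Notation plane := (R * R)%type.
Implicit Types (r : R) (x : plane).

Lemma eball0E r x : 0 < r -> eball 0 r x = (x.1 ^+ 2 + x.2 ^+ 2 < r ^+ 2) :> Prop.
Proof.
move=> r0; rewrite /eball /= subr0 /enorm.
rewrite -{1}(ger0_norm (ltW r0)) -sqrtr_sqr ltr_sqrt// exprn_gt0//.
Qed.

Lemma open_eball0 r : 0 < r -> open (eball (0 : plane) r).
Proof.
move=> r0.
have -> : eball (0 : plane) r = (fun x : plane => x.1 ^+ 2 + x.2 ^+ 2) @^-1` `]-oo, (r ^+ 2)[%classic.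
  by apply/seteqP; split => x; rewrite eball0E//= in_itv.
have c : continuous (fun x : plane => x.1 ^+ 2 + x.2 ^+ 2).
  move=> x; apply: cvgD.
    apply: (@continuous_comp _ _ _ fst (fun t : R => t ^+ 2)); [exact: cvg_fst|exact: exprn_continuous].
  apply: (@continuous_comp _ _ _ snd (fun t : R => t ^+ 2)); [exact: cvg_snd|exact: exprn_continuous].
by move/continuousP : c => c; apply: c; exact: open_lt.
Qed.

Lemma eball0_box r : 0 < r -> eball (0 : plane) r `<=` box (- r) r (- r) r.
Proof.
move=> r0 x; rewrite eball0E// => h; rewrite /box /= !in_itv/=.
by have := sqr_ge0 x.1; have := sqr_ge0 x.2; split; apply/andP; split; nra.
Qed.

Lemma box_eball0 r s t : 0 < r -> 0 <= s -> 0 <= t -> s ^+ 2 + t ^+ 2 < r ^+ 2 ->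
  box (- s) s (- t) t `<=` eball (0 : plane) r.
Proof.
move=> r0 s0 t0 sr x; rewrite /box /= !in_itv/= => -[/andP[h1 h2] /andP[h3 h4]].
rewrite eball0E//; nra.
Qed.

End ball.

Section dirichlet_principle.
Context {R : realType}.
Local Notation plane := (R * R)%type.
Local Notation borel_plane := (measurableTypeR R * measurableTypeR R)%type.
Local Notation leb2 := (@leb2 R).
Implicit Types (u v w f g : plane -> R).

Variables (O : set plane) (a b c d : R).
Hypotheses (oO : open O) (Ob : O `<=` box a b c d).

Let mO : measurable (O : set borel_plane).
Proof. exact: open_borel_plane. Qed.

Lemma sum_ord2 (F : 'I_2 -> R) : \sum_(i < 2) F i = F 0 + F 1.
Proof.
rewrite !big_ord_recl big_ord0 addr0; congr (_ + F _); exact: val_inj.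
Qed.

(** Write D for the gradient. If [phi] approximates [v - u] in H1, then
    |Dv|^2 = |Du|^2 + 2 Du.Dphi + 2 Du.q + |Dv - Du|^2 with q = Dv - Du - Dphi.
    The second term integrates to 0 since [u] is weakly harmonic, and the third is
    absorbed into e |Du|^2 + |q|^2 / e, where q is as small as desired in L2. *)
Lemma dirichlet_principle u v : C_ 1 u ->
  (forall phi, Ccinfty O phi ->
    (\int[leb2]_(x in O) (\sum_(i < 2) partial i u x * partial i phi x)%:E = 0)%E) ->
  H1 O v -> H10 O (v \- u) -> (dirichlet O u <= dirichlet O v)%E.
Proof.
move=> C1u uharm H1v [_ approx].
pose g i := weak_partial O i v.
have wg i : is_weak_partial O i v (g i) by exact: weak_partialP.
have [N0 N0n sg0] := L2_square_integrable mO (wg 0).1.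
have [N1 N1n sg1] := L2_square_integrable mO (wg 1).1.
have Nn := nullU N0n N1n; set N := N0 `|` N1 in Nn.
pose D := O `\` N.
have mD : measurable (D : set borel_plane) by apply: measurableD => //; have [] := Nn.
have Db : D `<=` box a b c d by move=> x [/Ob].
have sg i : square_integrable D (g i).
  case: (ord2P i) => ->.
    apply: (square_integrableS _ mD _ sg0); last by move=> x [Ox Nx]; split=> // ?; apply: Nx; left.
    by apply: measurableD => //; have [] := N0n.
  apply: (square_integrableS _ mD _ sg1); last by move=> x [Ox Nx]; split=> // ?; apply: Nx; right.
  by apply: measurableD => //; have [] := N1n.
have sa i : square_integrable D (partial i u).
  by apply: square_integrable_continuous Db _ _ => //; exact: C1_continuous_partial.
have int_sum (f h : 'I_2 -> plane -> R) :
    (forall i, square_integrable D (f i)) -> (forall i, square_integrable D (h i)) ->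
    leb2.-integrable D (fun x => (\sum_(i < 2) f i x * h i x)%:E).
  move=> sf sh.
  have := integrableD mD (square_integrableM mD (sf 0) (sh 0)) (square_integrableM mD (sf 1) (sh 1)).
  by apply: eq_integrable => // x _; rewrite sum_ord2.
have sqE (f : 'I_2 -> plane -> R) x : \sum_(i < 2) f i x ^+ 2 = \sum_(i < 2) f i x * f i x.
  by apply: eq_bigr => i _; rewrite expr2.
rewrite (dirichlet_C1 oO Ob C1u) (dirichlet_eq oO Ob wg).
rewrite -!(integral_setD_null O _ Nn) -/D.
under eq_integral do rewrite (sqE (fun i => partial i u)).
under [leRHS]eq_integral do rewrite (sqE g).
have iA := int_sum _ _ sa sa; have iG := int_sum _ _ sg sg.
have fA := integrable_fin_num mD iA; have fG := integrable_fin_num mD iG.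
rewrite -(fineK fA) -(fineK fG) lee_fin.
set A := fine _; set G := fine _.
have A0 : 0 <= A.
  by rewrite fine_ge0// integral_ge0// => x _; rewrite lee_fin sumr_ge0// => i _; rewrite -expr2 sqr_ge0.
have key e : 0 < e -> (1 - e) * A <= G + e.
  move=> e0; have [phi Cphi hphi] := approx (e ^+ 2) (exprn_gt0 2 e0).
  have C1phi : C_ 1 phi by have [] := Ccinfty_Cc1 Cphi.
  pose p i := partial i phi.
  pose q i := (g i \- partial i u) \- p i.
  have L2u : L2 O u by apply: L2_continuous Ob _ _ => //; move/C1P : C1u => [].
  have L2v : L2 O v by have [] := H1v.
  have L2phi : L2 O phi by apply: L2_continuous Ob _ _ => //; move/C1P : C1phi => [].
  have wq i : is_weak_partial O i ((v \- u) \- phi) (q i).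
    apply: (is_weak_partialB oO Ob) => //; first exact: L2B.
      by apply: (is_weak_partialB oO Ob) => //; exact: (is_weak_partial_C1 oO Ob).
    exact: (is_weak_partial_C1 oO Ob).
  have sp i : square_integrable D (p i).
    by apply: square_integrable_continuous Db _ _ => //; exact: C1_continuous_partial.
  have sq i : square_integrable D (q i).
    exact: (square_integrableB mD (square_integrableB mD (sg i) (sa i)) (sp i)).
  have : (dirichlet O ((v \- u) \- phi)%R < (e ^+ 2)%:E)%E.
    apply: le_lt_trans hphi; apply: leeDr; apply: integral_ge0 => x _.
    by rewrite lee_fin sqr_ge0.
  rewrite (dirichlet_eq oO Ob wq) -(integral_setD_null _ _ Nn) -/D.
  under eq_integral do rewrite (sqE q).
  have iQ := int_sum _ _ sq sq; have fQ := integrable_fin_num mD iQ.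
  rewrite -(fineK fQ) lte_fin; set Q := fine _ => Qe.
  have := uharm phi Cphi; rewrite -(integral_setD_null _ _ Nn) -/D => P0.
  have iP := int_sum _ _ sa sp.
  have l1 : (\int[leb2]_(x in D) ((1 - e)%:E * (\sum_(i < 2) partial i u x * partial i u x)%:E +
      2%:E * (\sum_(i < 2) partial i u x * p i x)%:E) = ((1 - e) * A)%:E)%E.
    rewrite integralD//; try exact: integrableZl.
    by rewrite !integralZl// P0 mule0 adde0 EFinM fineK.
  have l2 : (\int[leb2]_(x in D) ((\sum_(i < 2) g i x * g i x)%:E +
      (e^-1)%:E * (\sum_(i < 2) q i x * q i x)%:E) = (G + e^-1 * Q)%:E)%E.
    rewrite integralD//; try exact: integrableZl.
    by rewrite !integralZl// EFinD EFinM !fineK.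
  have : (((1 - e) * A)%:E <= (G + e^-1 * Q)%:E)%E.
    rewrite -l1 -l2; apply: le_integral => //.
    - by apply: integrableD => //; exact: integrableZl.
    - by apply: integrableD => //; exact: integrableZl.
    move=> x _; rewrite -!EFinM -!EFinD lee_fin !sum_ord2 /q /p.
    rewrite /=; move: (partial 0 u x) (partial 1 u x) (partial 0 phi x) (partial 1 phi x) (g 0 x) (g 1 x).
    move=> a0 a1 p0 p1 g0 g1; rewrite -subr_ge0.
    rewrite [leRHS](_ : _ = (g0 - a0) ^+ 2 + (g1 - a1) ^+ 2 +
        e^-1 * ((e * a0 + (g0 - a0 - p0)) ^+ 2 + (e * a1 + (g1 - a1 - p1)) ^+ 2)); last first.
      by field; rewrite gt_eqF.
    apply: addr_ge0; first by apply: addr_ge0; exact: sqr_ge0.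
    by apply: mulr_ge0; [rewrite invr_ge0 ltW|apply: addr_ge0; exact: sqr_ge0].
  rewrite lee_fin => /le_trans; apply; rewrite lerD2l.
  by rewrite ler_pdivrMl// -expr2 ltW.
rewrite leNgt; apply/negP => GA.
have e0 : 0 < (A - G) / (2 * (A + 1)) by rewrite divr_gt0; lra.
have := key _ e0; set e := _ / _ => h.
have : e * (2 * (A + 1)) = A - G by rewrite mulfVK// gt_eqF; lra.
nra.
Qed.

End dirichlet_principle.

(** * The saddle function and its flattening at the origin *)

Section saddle.
Context {R : realType}.
Local Notation plane := (R * R)%type.
Local Notation borel_plane := (measurableTypeR R * measurableTypeR R)%type.
Local Notation leb2 := (@leb2 R).
Local Notation u := (@u_saddle R).
Local Notation E := (@E_saddle R).

Lemma smooth_id : smooth (@id R).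
Proof. by move=> n; exact: diffn_id. Qed.

Lemma smooth_cst (a : R) : smooth (cst a).
Proof. by move=> n; exact: diffn_cst. Qed.

Lemma derive1_idE : derive1 (@id R) = cst 1.
Proof. by apply: is_derive_derive1 => x; exact: is_derive_id. Qed.

Lemma derive1_cstE (a : R) : derive1 (cst a : R -> R) = cst 0.
Proof. by apply: is_derive_derive1 => x; exact: is_derive_cst. Qed.

Lemma C1_saddle : C_ 1 u.
Proof. exact: (C_tensor 1 smooth_id smooth_id). Qed.

Lemma partial0_saddle : partial 0 u = tensor (cst 1) id.
Proof. by rewrite (partial0_tensor id smooth_id) derive1_idE. Qed.

Lemma partial1_saddle : partial 1 u = tensor id (cst 1).
Proof. by rewrite (partial1_tensor id smooth_id) derive1_idE. Qed.

(* Each partial derivative of the saddle depends on the other variable only, so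
   that its own partial derivative in the same direction vanishes: the saddle is
   harmonic, term by term. *)
Section dirichlet_saddle.
Variables (O : set plane) (a b c d : R).
Hypotheses (oO : open O) (Ob : O `<=` box a b c d).

Let mO : measurable (O : set borel_plane).
Proof. exact: open_borel_plane. Qed.

Let saddle_ibp i phi : Ccinfty O phi ->
  (\int[leb2]_(x in O) (partial i u x * partial i phi x)%:E = 0)%E.
Proof.
move=> Cphi; have C1d : C_ 1 (partial i u) /\ partial i (partial i u) = cst 0.
  case: (ord2P i) => ->.
    rewrite partial0_saddle; split; first by apply: C_tensor; [exact: smooth_cst|exact: smooth_id].
    rewrite partial0_tensor; last exact: smooth_cst.
    by rewrite derive1_cstE; apply/funext => x; rewrite /tensor /= mul0r.
  rewrite partial1_saddle; split; first by apply: C_tensor; [exact: smooth_id|exact: smooth_cst].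
  rewrite partial1_tensor; last exact: smooth_cst.
  by rewrite derive1_cstE; apply/funext => x; rewrite /tensor /= mulr0.
have [C1i d0] := C1d.
rewrite (integration_by_parts Ob i C1i (Ccinfty_Cc1 Cphi)) d0.
by rewrite integral0_eq ?oppe0// => x _; rewrite mul0r.
Qed.

Lemma dirichlet_saddle_le v : H1 O v -> H10 O (v \- u) -> (dirichlet O u <= dirichlet O v)%E.
Proof.
apply: (dirichlet_principle oO Ob C1_saddle) => phi Cphi.
have C1phi : C_ 1 phi by have [] := Ccinfty_Cc1 Cphi.
have ii i : leb2.-integrable O (fun x => (partial i u x * partial i phi x)%:E).
  by apply: square_integrableM => //; apply: square_integrable_continuous Ob _ _ => //;
    apply: C1_continuous_partial => //; exact: C1_saddle.
transitivity (\int[leb2]_(x in O) ((partial 0 u x * partial 0 phi x)%:E +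
    (partial 1 u x * partial 1 phi x)%:E))%E.
  by apply: eq_integral => x _; rewrite sum_ord2.
by rewrite integralD// !saddle_ibp// adde0.
Qed.

End dirichlet_saddle.

(* The identity cut off to a neighborhood of 0; [ks s] is its rescaling
   s kappa (t / s), with the same Lipschitz constant for all s. *)
Let kappa : R -> R := id \* plateau (-2) 2 1.

Let smooth_kappa : smooth kappa.
Proof. by move=> n; apply: diffnM; [exact: smooth_id|exact: smooth_plateau]. Qed.

Let ks (s : R) : R -> R := cst s \* (fun t => kappa (s^-1 * t + 0)).

Let smooth_ks s : smooth (ks s).
Proof. by move=> n; apply: diffnM; [exact: smooth_cst|apply: diffn_affine; exact: smooth_kappa]. Qed.

Let ksE s t : s != 0 -> ks s t = t * plateau (-2) 2 1 (s^-1 * t).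
Proof. by move=> s0; rewrite /ks /kappa /= addr0 !mulrA divff// mul1r. Qed.

Let derive1_ks s t : s != 0 -> derive1 (ks s) t = derive1 kappa (s^-1 * t).
Proof.
move=> s0; have k' := smooth_is_derive (s^-1 * t + 0) smooth_kappa.
have da : is_derive t 1 (fun x : R => s^-1 * x + 0) s^-1.
  have h := is_deriveD (is_deriveZ s^-1 (is_derive_id t 1)) (is_derive_cst (0 : R) t 1).
  by apply: (is_derive_eq h); rewrite addr0 /GRing.scale/= mulr1.
have h := is_deriveZ s (@is_derive1_comp _ kappa (fun x => s^-1 * x + 0) t _ _ k' da).
have h' : is_derive t 1 (ks s) (derive1 kappa (s^-1 * t)).
  by apply: (is_derive_eq h); rewrite addr0 /GRing.scale/= mulrC -mulrA mulVf// mulr1.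
by rewrite derive1E; exact: derive_val.
Qed.

(** The saddle made to vanish on the square of half side [s], and left unchanged
    outside the square of half side [2 s]. *)
Definition flattened (s : R) : plane -> R := u \- tensor (ks s) (ks s).

Lemma C1_flattened s : C_ 1 (flattened s).
Proof. by apply: C1B; [exact: C1_saddle|apply: C_tensor; exact: smooth_ks]. Qed.

(** The sign of the saddle is kept: the factor is 1 minus a product of plateaus. *)
Lemma flattened_factor s x : 0 < s ->
  exists2 t : R, 0 <= t & flattened s x = t * u x.
Proof.
move=> s0; have sn0 : s != 0 by rewrite gt_eqF.
exists (1 - plateau (-2) 2 1 (s^-1 * x.1) * plateau (-2) 2 1 (s^-1 * x.2)).
  by rewrite subr_ge0 mulr_ile1 ?plateau_ge0 ?plateau_le1.
by rewrite /flattened /= /tensor !ksE// /u_saddle; ring.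
Qed.

Lemma flattened_eq0 s x : 0 < s -> box (- s) s (- s) s x -> flattened s x = 0.
Proof.
move=> s0; rewrite /box /= !in_itv/= => -[hx hy].
have sn0 : s != 0 by rewrite gt_eqF.
have p1 t : - s <= t <= s -> plateau (-2) 2 1 (s^-1 * t) = 1.
  move=> /andP[t1 t2]; apply: plateau_eq1 => //.
  by rewrite ler_pdivlMl// ler_pdivrMl//; apply/andP; split; lra.
by rewrite /flattened /= /tensor !ksE// !p1// /u_saddle; ring.
Qed.

Lemma Ccinfty_flattened s (O : set plane) : 0 < s ->
  box (- (2 * s)) (2 * s) (- (2 * s)) (2 * s) `<=` O -> Ccinfty O (flattened s \- u).
Proof.
move=> s0 bO k; have sn0 : s != 0 by rewrite gt_eqF.
have -> : flattened s \- u = tensor (cst (-1) \* ks s) (ks s).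
  by apply/funext => x; rewrite /flattened /tensor /=; ring.
have k0 t : ~ (- (2 * s) <= t <= 2 * s) -> ks s t = 0.
  move=> h; rewrite ksE// plateau_eq0 ?mulr0//; apply/negP => /andP[h1 h2]; apply: h.
  by move: h1 h2; rewrite ltr_pdivlMl// ltr_pdivrMl// => h1 h2; apply/andP; split; lra.
apply: (Cc_box _ _ bO).
  apply: C_tensor; last exact: smooth_ks.
  by move=> n; apply: diffnM; [exact: smooth_cst|exact: smooth_ks].
move=> x xb; rewrite /tensor /=.
have [h1|h1] := pselect (- (2 * s) <= x.1 <= 2 * s); last by rewrite k0 // mulr0 mul0r.
have [h2|h2] := pselect (- (2 * s) <= x.2 <= 2 * s); last by rewrite (k0 x.2)// mulr0.
by exfalso; apply: xb; split; rewrite /= in_itv.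
Qed.

Lemma partial_flattened_bounded : exists2 M : R, 0 <= M &
  forall s x i, 0 < s -> box (- (4 * s)) (4 * s) (- (4 * s)) (4 * s) x ->
    `|partial i (flattened s) x| <= M * s.
Proof.
have ck : continuous (derive1 kappa).
  by apply: smooth_continuous; exact: smooth_derive1.
have [K K0 hK] : exists2 K, 0 <= K & forall t, - 4 <= t <= 4 -> `|derive1 kappa t| <= K.
  have := @continuous_compact _ _ (derive1 kappa) `[(-4 : R), 4]%classic.
  have ck' : {within `[(-4 : R), 4]%classic, continuous (derive1 kappa)} by exact: continuous_subspaceT.
  move=> /(_ ck' (@segment_compact _ _ _))/compact_bounded[K [_ hK]].
  exists (`|K| + 1); first by rewrite addr_ge0.
  move=> t ht; apply: hK; last by exists t => //=; rewrite in_itv.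
  by rewrite (le_lt_trans (ler_norm K))// ltrDl.
exists (4 * (1 + K)); first by rewrite mulr_ge0// addr_ge0.
move=> s x i s0; rewrite /box /= !in_itv/= => -[h1 h2].
have sn0 : s != 0 by rewrite gt_eqF.
have kb t : - (4 * s) <= t <= 4 * s -> `|ks s t| <= 4 * s /\ `|derive1 (ks s) t| <= K.
  move=> ht; split.
    rewrite ksE// normrM; apply: (@le_trans _ _ (`|t| * 1)); last by rewrite mulr1 ler_norml.
    by rewrite ler_wpM2l// ger0_norm ?plateau_ge0 ?plateau_le1.
  rewrite derive1_ks//; apply: hK.
  by move: ht => /andP[t1 t2]; rewrite ler_pdivlMl// ler_pdivrMl//; apply/andP; split; lra.
have [a1 b1] := kb _ h1; have [a2 b2] := kb _ h2.
have C1t : C_ 1 (tensor (ks s) (ks s)) by apply: C_tensor; exact: smooth_ks.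
have n1 : `|x.1| <= 4 * s by rewrite ler_norml.
have n2 : `|x.2| <= 4 * s by rewrite ler_norml.
rewrite (partialB i x C1_saddle C1t).
have mulb (p q : R) : `|p| <= K -> `|q| <= 4 * s -> `|p * q| <= K * (4 * s).
  by move=> hp hq; rewrite normrM ler_pM.
have -> : 4 * (1 + K) * s = 4 * s + K * (4 * s) by ring.
apply: (le_trans (ler_normB _ _)).
case: (ord2P i) => ->.
  rewrite partial0_saddle partial0_tensor ?/tensor /= ?mul1r; last exact: smooth_ks.
  by apply: (lerD n2); exact: mulb b1 a2.
rewrite partial1_saddle partial1_tensor ?/tensor /= ?mulr1; last exact: smooth_ks.
by apply: (lerD n1); rewrite mulrC; exact: mulb b2 a1.
Qed.

(** The flattened saddle scales like the saddle, flattened s x = s^2 flattened 1 (x / s),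
    so that its gradient is of order [r] on a ball of area of order [r ^+ 2]. *)
Lemma dirichlet_flattened_le : exists2 C : R, 0 <= C &
  forall r, 0 < r -> (dirichlet (eball 0%R r) (flattened (r / 4)) <= (C * r ^+ 4)%:E)%E.
Proof.
have [M M0 hM] := partial_flattened_bounded.
exists (M ^+ 2); first exact: sqr_ge0.
move=> r r0; have bB := eball0_box r0.
have r40 : 0 < r / 4 by rewrite divr_gt0.
rewrite (dirichlet_C1 (open_eball0 r0) bB (C1_flattened _)).
apply: (@le_trans _ _ (\int[leb2]_(x in box (- r) r (- r) r) (2 * (M * (r / 4)) ^+ 2)%:E)%E).
  apply: le_integral_arbitrary => x; rewrite /patch.
    by case: ifP => // _; rewrite lee_fin sumr_ge0// => i _; rewrite sqr_ge0.
  case: ifPn => [/set_mem/bB xb|_].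
    rewrite mem_set// lee_fin sum_ord2.
    have xb' : box (- (4 * (r / 4))) (4 * (r / 4)) (- (4 * (r / 4))) (4 * (r / 4)) x.
      by have -> : 4 * (r / 4) = r by field.
    have sq i : partial i (flattened (r / 4)) x ^+ 2 <= (M * (r / 4)) ^+ 2.
      rewrite -(real_normK (num_real (partial i _ x))).
      have h := hM _ _ i r40 xb'.
      by apply: lerXn2r h; rewrite nnegrE ?mulr_ge0// ltW.
    by rewrite mulr_natl mulr2n lerD.
  by case: ifP => // _; rewrite lee_fin mulr_ge0 ?sqr_ge0.
rewrite integral_cst; last exact: measurable_box.
rewrite /= leb2_box; [|by lra..].
rewrite -EFinM lee_fin; have -> : 2 * (M * (r / 4)) ^+ 2 * ((r - - r) * (r - - r)) = M ^+ 2 * r ^+ 4 / 2 by field.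
have MR0 : 0 <= M ^+ 2 * r ^+ 4 by rewrite mulr_ge0 ?sqr_ge0// exprn_ge0// ltW.
by move: (_ * _) MR0 => K; lra.
Qed.

End saddle.

(** * Isometries preserving the Lebesgue measure *)

Section preserving.
Context {R : realType}.
Local Notation plane := (R * R)%type.
Local Notation line := (measurableTypeR R).
Local Notation borel_plane := (measurableTypeR R * measurableTypeR R)%type.
Local Notation leb2 := (@leb2 R).
Local Notation leb4 := (@leb4 R).
Local Notation mu := (@lebesgue_measure R).

Lemma lebesgue_measure_reflect (p : R) (A : set line) : measurable A ->
  mu ((fun t : line => p - t) @^-1` A) = mu A.
Proof.
move=> mA; have mf : measurable_fun setT (fun t : line => p - t : line).
  by apply: measurable_funB => //; exact: measurable_cst.
apply/esym.
pose m := measure_function_pushforward__canonical__measure_function_Measure mu mf.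
have h := @lebesgue_measure_unique R m.
apply: (h _ A mA) => {h}.
move=> _ [[a b] /= _ <-]; rewrite /pushforward/=.
rewrite (_ : _ @^-1` _ = `[p - b, p - a[%classic).
  rewrite !lebesgue_measure_itv/= !lte_fin ltrD2l ltrN2.
  by case: ifP => // _; rewrite -!EFinB; congr EFin; ring.
by apply/seteqP; split => t; rewrite /= !in_itv/= => /andP[h1 h2]; apply/andP; split; lra.
Qed.

Definition preserving (psi : plane -> plane) :=
  measurable_fun setT (psi : borel_plane -> borel_plane) /\
  forall A : set borel_plane, measurable A -> leb2 (psi @^-1` A) = leb2 A.

Lemma preserving_rect (psi : plane -> plane) :
  measurable_fun setT (psi : borel_plane -> borel_plane) ->
  (forall A B : set line, measurable A -> measurable B ->
    leb2 (psi @^-1` (A `*` B)) = (mu A * mu B)%E) -> preserving psi.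
Proof.
move=> mpsi h; split => // A mA.
pose m := measure_function_pushforward__canonical__measure_function_Measure leb2 mpsi.
have e := @product_measure_unique _ _ _ _ R mu mu m.
by apply/esym; apply: (e h A mA).
Qed.

Lemma preserving_reflect1 (p : R) : preserving (fun x => (p - x.1, x.2)).
Proof.
have mf : measurable_fun setT (fun t : line => p - t : line).
  by apply: measurable_funB => //; exact: measurable_cst.
apply: preserving_rect => [|A B mA mB].
  by apply: measurable_fun_pair; [exact: (measurableT_comp mf measurable_fst)|exact: measurable_snd].
rewrite (_ : _ @^-1` _ = ((fun t : line => p - t) @^-1` A) `*` B)//.
rewrite leb2_rect//; first by rewrite lebesgue_measure_reflect.
by rewrite -[_ @^-1` _]setTI; exact: mf.
Qed.

Lemma preserving_swap : preserving (fun x => (x.2, x.1)).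
Proof.
apply: preserving_rect => [|A B mA mB].
  by apply: measurable_fun_pair; [exact: measurable_snd|exact: measurable_fst].
rewrite (_ : _ @^-1` _ = B `*` A); first by rewrite leb2_rect// muleC.
by apply/seteqP; split => x [].
Qed.

Lemma preserving_comp f g : preserving f -> preserving g -> preserving (f \o g).
Proof.
move=> [mf hf] [mg hg]; split; first exact: measurableT_comp.
move=> A mA; rewrite comp_preimage hg ?hf//.
by rewrite -[_ @^-1` _]setTI; exact: mf.
Qed.

Lemma preserving_reflect2 (p : R) : preserving (fun x => (x.1, p - x.2)).
Proof.
have -> : (fun x : plane => (x.1, p - x.2)) =
    (fun x => (x.2, x.1)) \o ((fun x => (p - x.1, x.2)) \o (fun x => (x.2, x.1))) by [].
apply: preserving_comp preserving_swap _.
exact: preserving_comp (preserving_reflect1 p) preserving_swap.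
Qed.

(** A change of variables acting on both points at once: the image of the
    product measure agrees with it on rectangles. *)
Lemma leb4_preserving psi : preserving psi ->
  forall G : borel_plane * borel_plane -> \bar R, measurable_fun setT G ->
    (forall z, 0 <= G z)%E ->
    (\int[leb4]_z G (psi z.1, psi z.2) = \int[leb4]_z G z)%E.
Proof.
move=> [mpsi hpsi] G mG G0.
pose phi (z : borel_plane * borel_plane) : borel_plane * borel_plane := (psi z.1, psi z.2).
have mphi : measurable_fun setT phi.
  by apply: measurable_fun_pair; apply: measurableT_comp mpsi _; [exact: measurable_fst|exact: measurable_snd].
have preimT d d' (T : measurableType d) (T' : measurableType d') (h : T -> T') A :
  measurable_fun setT h -> measurable A -> measurable (h @^-1` A).
  by move=> mh mA; rewrite -[_ @^-1` _]setTI; exact: mh.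
have := @ge0_integral_pushforward _ _ _ _ R phi mphi leb4 setT G measurableT mG (fun z _ => G0 z).
rewrite preimage_setT => E1.
have E2 : (\int[pushforward leb4 phi]_z G z = \int[leb4]_z G z)%E.
  pose m := measure_function_pushforward__canonical__measure_function_Measure leb4 mphi.
  apply: (@eq_measure_integral _ _ R setT leb4 m) => A mA _.
  have h := @product_measure_unique _ _ _ _ R leb2 leb2 m.
  apply/esym; apply: (h _ A mA) => {h} A' B' mA' mB'.
  rewrite /m /pushforward.
  transitivity (leb4 ((psi @^-1` A') `*` (psi @^-1` B'))); first by [].
  rewrite /leb4 product_measure1E; [|exact: preimT..].
  by congr (_ * _)%E; exact: hpsi.
exact: (etrans (esym E1) E2).
Qed.

End preserving.

(** * Interactions, and the gain from adding two squares to the saddle set *)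

Section interaction.
Context {R : realType}.
Local Notation plane := (R * R)%type.
Local Notation line := (measurableTypeR R).
Local Notation borel_plane := (measurableTypeR R * measurableTypeR R)%type.
Local Notation leb2 := (@leb2 R).
Local Notation leb4 := (@leb4 R).
Variable sigma : R.
Local Notation I := (interaction sigma).
Local Notation E := (@E_saddle R).

Definition riesz (z : plane * plane) : R := (enorm (z.1 - z.2) `^ (2 + sigma))^-1.

Lemma riesz_ge0 z : 0 <= riesz z.
Proof. by rewrite invr_ge0 powR_ge0. Qed.

Lemma measurable_enormB :
  measurable_fun setT ((fun z => enorm (z.1 - z.2)) : borel_plane * borel_plane -> R).
Proof.
have c : continuous (@enorm R).
  move=> x; apply: (@continuous_comp _ _ _ (fun x : plane => x.1 ^+ 2 + x.2 ^+ 2)); last exact: sqrt_continuous.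
  apply: cvgD.
    apply: (@continuous_comp _ _ _ fst (fun t : R => t ^+ 2)); [exact: cvg_fst|exact: exprn_continuous].
  apply: (@continuous_comp _ _ _ snd (fun t : R => t ^+ 2)); [exact: cvg_snd|exact: exprn_continuous].
apply: (@measurableT_comp _ _ _ _ _ _ _ _ (fun z : borel_plane * borel_plane => (z.1.1 - z.2.1, z.1.2 - z.2.2) : borel_plane) (continuous_borel c)).
have m1 := @measurable_fst _ _ borel_plane borel_plane.
have m2 := @measurable_snd _ _ borel_plane borel_plane.
have n1 := @measurable_fst _ _ line line.
have n2 := @measurable_snd _ _ line line.
by apply: measurable_fun_pair; apply: measurable_funB;
  [exact: measurableT_comp n1 m1|exact: measurableT_comp n1 m2|exact: measurableT_comp n2 m1|exact: measurableT_comp n2 m2].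
Qed.

Lemma measurable_riesz :
  measurable_fun setT ((fun z => (riesz z)%:E) : borel_plane * borel_plane -> \bar R).
Proof.
apply/measurable_EFinP.
have -> : riesz = (fun t => t `^ (- (2 + sigma))) \o (fun z => enorm (z.1 - z.2)).
  by apply/funext => z; rewrite /riesz /= powRN.
by apply: measurableT_comp measurable_enormB; exact: measurable_powR.
Qed.

Lemma le_interaction (A A' B B' : set plane) : A `<=` A' -> B `<=` B' -> (I A B <= I A' B')%E.
Proof.
move=> AA BB; apply: le_integral_arbitrary => z; rewrite /patch.
  by case: ifP => // _; rewrite lee_fin riesz_ge0.
case: ifPn => [/set_mem[/AA za /BB zb]|_]; first by rewrite mem_set.
by case: ifP => // _; rewrite lee_fin riesz_ge0.
Qed.

Lemma interaction_ge0 A B : (0 <= I A B)%E.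
Proof. by apply: integral_ge0 => z _; rewrite lee_fin riesz_ge0. Qed.

Lemma leb4_rect (A B : set borel_plane) : measurable A -> measurable B ->
  leb4 (A `*` B) = (leb2 A * leb2 B)%E.
Proof. exact: product_measure1E. Qed.

(** Interactions do not see null sets, such as the axes, or the exceptional set of a
    set that is only Lebesgue measurable. *)
Lemma eq_interaction_off_null N (A A' B B' : set plane) : null N ->
  (forall x, ~ N x -> A x <-> A' x) -> (forall x, ~ N x -> B x <-> B' x) ->
  I A B = I A' B'.
Proof.
move=> [mN N0] hA hB.
pose M : set (borel_plane * borel_plane) := (N `*` setT) `|` (setT `*` N).
have mM : measurable M by apply: measurableU; apply: measurableX.
have M0 : leb4 M = 0%E.
  have N1 : leb4 (N `*` setT) = 0%E by rewrite leb4_rect// N0 mul0e.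
  have N2 : leb4 (setT `*` N) = 0%E by rewrite leb4_rect// N0 mule0.
  have m1 : measurable (N `*` setT : set (borel_plane * borel_plane)) by exact: measurableX.
  have m2 : measurable (setT `*` N : set (borel_plane * borel_plane)) by exact: measurableX.
  exact: (etrans (measureU0 m1 m2 N2) N1).
apply: (eq_integral_off_null mM M0) => z Mz; rewrite /patch.
congr (if _ then _ else _); apply/idP/idP => /set_mem[za zb]; apply/mem_set; split => /=.
- by apply/hA => // Nz; apply: Mz; left.
- by apply/hB => // Nz; apply: Mz; right.
- by apply/hA => // Nz; apply: Mz; left.
- by apply/hB => // Nz; apply: Mz; right.
Qed.

Lemma interactionE (A B : set plane) :
  I A B = (\int[leb4]_z ((EFin \o riesz) \_ (A `*` B)) z)%E.
Proof. exact: integral_mkcond. Qed.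

Lemma measurable_riesz_in (A B : set borel_plane) : measurable A -> measurable B ->
  measurable_fun setT ((EFin \o riesz) \_ (A `*` B) : borel_plane * borel_plane -> \bar R).
Proof.
move=> mA mB; apply/(measurable_restrictT _ (measurableX mA mB)).
exact: measurable_funS measurable_riesz.
Qed.

Lemma restrict_riesz_ge0 (A B : set plane) z : (0 <= ((EFin \o riesz) \_ (A `*` B)) z)%E.
Proof. by apply: erestrict_ge0 => x _; rewrite lee_fin riesz_ge0. Qed.

Lemma interaction_preserving psi (A B : set borel_plane) : preserving psi ->
  (forall x y, enorm (psi x - psi y) = enorm (x - y)) ->
  measurable A -> measurable B -> I (psi @^-1` A) (psi @^-1` B) = I A B.
Proof.
move=> ppsi ipsi mA mB; rewrite !interactionE.
rewrite -(leb4_preserving ppsi (measurable_riesz_in mA mB)); last first.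
  by move=> z; rewrite erestrict_ge0// => x _; rewrite lee_fin riesz_ge0.
apply: eq_integral => z _; rewrite /patch /riesz /= ipsi.
by congr (if _ then _ else _); apply/idP/idP => /set_mem h; apply/mem_set.
Qed.

Lemma interactionU (A B B' : set borel_plane) : measurable A -> measurable B ->
  measurable B' -> B `&` B' = set0 -> I A (B `|` B') = (I A B + I A B')%E.
Proof.
move=> mA mB mB' BB'.
have m1 : measurable (A `*` B : set (borel_plane * borel_plane)) by exact: measurableX.
have m2 : measurable (A `*` B' : set (borel_plane * borel_plane)) by exact: measurableX.
rewrite /interaction (_ : A `*` (B `|` B') = (A `*` B) `|` (A `*` B')); last first.
  apply/seteqP; split => z /=; first by move=> [? [?|?]]; [left|right].
  by move=> [|] [? ?]; split => //; [left|right].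
apply: (ge0_integral_setU leb4 m1 m2 (f := EFin \o riesz)).
- by apply: measurable_funS measurable_riesz.
- by move=> z _; rewrite lee_fin riesz_ge0.
- rewrite disj_set2E; apply/eqP/seteqP; split => // z [[_ h1] [_ h2]].
  by have : set0 z.2 by rewrite -BB'.
Qed.

Lemma enormB_gt0 (x y : plane) : x != y -> 0 < enorm (x - y).
Proof.
case: x y => [a b] [c d] xy; rewrite /enorm sqrtr_gt0 /=.
rewrite lt_neqAle addr_ge0 ?sqr_ge0// andbT eq_sym paddr_eq0 ?sqr_ge0// !sqrf_eq0 !subr_eq0.
by apply: contra xy => /andP[/eqP -> /eqP ->].
Qed.

Lemma enormBC (x y : plane) : enorm (x - y) = enorm (y - x).
Proof. by rewrite /enorm /=; congr Num.sqrt; ring. Qed.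

Lemma interactionC (A B : set borel_plane) : measurable A -> measurable B -> I A B = I B A.
Proof.
move=> mA mB.
rewrite !interactionE /leb4.
rewrite (fubini_tonelli1 _ (measurable_riesz_in mA mB) (restrict_riesz_ge0 A B)).
rewrite (fubini_tonelli2 _ (measurable_riesz_in mB mA) (restrict_riesz_ge0 B A)).
apply: eq_integral => x _; apply: eq_integral => y _.
rewrite /patch /riesz /= [enorm (y - x)]enormBC.
by congr (if _ then _ else _); apply/idP/idP => /set_mem[h h']; apply/mem_set; split.
Qed.

(** The kernel is at least its value at distance [rho]. *)
Lemma interaction_ge (A B : set plane) (A' B' : set borel_plane) rho :
  0 <= 2 + sigma -> 0 < rho -> measurable A' -> measurable B' -> A' `<=` A -> B' `<=` B ->
  (forall x y, A' x -> B' y -> x != y /\ enorm (x - y) <= rho) ->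
  (((rho `^ (2 + sigma))^-1)%:E * (leb2 A' * leb2 B') <= I A B)%E.
Proof.
move=> s2 rho0 mA mB AA BB h.
rewrite -leb4_rect//.
rewrite -integral_cst; last exact: measurableX.
apply: le_integral_arbitrary => z; rewrite /patch.
  by case: ifP => // _; rewrite lee_fin invr_ge0 powR_ge0.
case: ifPn => [/set_mem[za zb]|_]; last by case: ifP => // _; rewrite lee_fin riesz_ge0.
rewrite mem_set; last by split; [exact: AA|exact: BB].
have [xy zr] := h _ _ za zb.
rewrite lee_fin lef_pV2 ?posrE ?powR_gt0//; last exact: enormB_gt0.
by rewrite ge0_ler_powR// nnegrE ?sqrtr_ge0// ltW.
Qed.

Lemma measurable_saddle : measurable (E : set borel_plane).
Proof.
have -> : E = (`]0, +oo[%classic `*` `]0, +oo[%classic) `|` (`]-oo, 0[%classic `*` `]-oo, 0[%classic).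
  apply/seteqP; split => -[x y]; rewrite /E_saddle /= !in_itv/= !andbT; last first.
    by move=> [[x0 y0]|[x0 y0]]; [exact: mulr_gt0|rewrite nmulr_rgt0].
  have [x0|x0|->] := ltgtP x 0; last by rewrite mul0r ltxx.
    by rewrite nmulr_rgt0// => y0; right.
  by rewrite pmulr_rgt0// => y0; left.
by apply: measurableU; apply: measurableX; exact: measurable_itv.
Qed.

Section square_gap.
Variables (s : R) (O : set borel_plane).
Hypotheses (s0 : 0 < s) (mO : measurable O).

Let mE := measurable_saddle.

Definition square2 : set plane := obox (- s) 0 0 s.
Definition square4 : set plane := obox 0 s (- s) 0.

Let mD2 : measurable (square2 : set borel_plane).
Proof. exact: measurable_obox. Qed.

Let mD4 : measurable (square4 : set borel_plane).
Proof. exact: measurable_obox. Qed.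

Let mEc : measurable (~` E : set borel_plane).
Proof. exact: measurableC. Qed.

Lemma null_vline (a : R) : null ([set a] `*` setT : set borel_plane).
Proof.
have ms : measurable ([set a] : set line) by exact: measurable_set1.
split; first exact: measurableX.
by rewrite leb2_rect// lebesgue_measure_set1 mul0e.
Qed.

Lemma null_hline (a : R) : null (setT `*` [set a] : set borel_plane).
Proof.
have ms : measurable ([set a] : set line) by exact: measurable_set1.
split; first exact: measurableX.
by rewrite leb2_rect// lebesgue_measure_set1 mule0.
Qed.

(* The square in the second quadrant is invariant under the reflections in the
   vertical line x = - s / 2 and in the horizontal line y = s / 2. Up to null sets,
   the complement of the saddle set outside the square consists of the part of the
   second quadrant to the left of the square together with the fourth quadrant (Y1),
   which the first reflection maps into the saddle set, and of the part above the
   square (Y2), which the second reflection maps into the remaining part of the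
   saddle set. *)
Let balance2 : (I square2 (~` E `\` square2) <= I square2 E)%E.
Proof.
pose Y1 : set borel_plane := (`]-oo, - s[%classic `*` `]0, +oo[%classic) `|`
  (`]0, +oo[%classic `*` `]-oo, 0[%classic).
pose Y2 : set borel_plane := `]- s, 0[%classic `*` `]s, +oo[%classic.
pose X1 : set borel_plane := (`]0, +oo[%classic `*` `]0, +oo[%classic) `|`
  (`]-oo, - s[%classic `*` `]-oo, 0[%classic).
pose X2 : set borel_plane := `]- s, 0[%classic `*` `]-oo, 0[%classic.
have mY1 : measurable Y1 by apply: measurableU; apply: measurableX; exact: measurable_itv.
have mX1 : measurable X1 by apply: measurableU; apply: measurableX; exact: measurable_itv.
have mY2 : measurable Y2 by apply: measurableX; exact: measurable_itv.
have mX2 : measurable X2 by apply: measurableX; exact: measurable_itv.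
have e1 : I square2 Y1 = I square2 X1.
  rewrite -(interaction_preserving (preserving_reflect1 (- s)) _ mD2 mY1); last first.
    by move=> x y; rewrite /enorm /=; congr Num.sqrt; ring.
  congr interaction; apply/seteqP; split => -[x y];
    rewrite /square2 /Y1 /X1 /obox /= !in_itv/= ?andbT.
  - by move=> [h ->]; split=> //; move/andP: h => [h1 h2]; apply/andP; split; lra.
  - by move=> [h ->]; split=> //; move/andP: h => [h1 h2]; apply/andP; split; lra.
  - by move=> [[h ->]|[h ->]]; [left|right]; split => //; lra.
  - by move=> [[h ->]|[h ->]]; [left|right]; split => //; lra.
have e2 : I square2 Y2 = I square2 X2.
  rewrite -(interaction_preserving (preserving_reflect2 s) _ mD2 mY2); last first.
    by move=> x y; rewrite /enorm /=; congr Num.sqrt; ring.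
  congr interaction; apply/seteqP; split => -[x y];
    rewrite /square2 /Y2 /X2 /obox /= !in_itv/= ?andbT.
  - by move=> [-> h]; split=> //; move/andP: h => [h1 h2]; apply/andP; split; lra.
  - by move=> [-> h]; split=> //; move/andP: h => [h1 h2]; apply/andP; split; lra.
  - by move=> [-> h]; split => //; lra.
  - by move=> [-> h]; split => //; lra.
apply: (@le_trans _ _ (I square2 (Y1 `|` Y2))).
  pose N : set borel_plane := ([set - s] `*` setT) `|` ([set 0] `*` setT) `|`
    ((setT `*` [set 0]) `|` (setT `*` [set s])).
  have Nn : null N.
    by apply: nullU; apply: nullU; try exact: null_vline; exact: null_hline.
  rewrite (@eq_interaction_off_null N square2 square2 _ ((~` E `\` square2) `&` ~` N) Nn)//.
    apply: le_interaction => // -[x y] [[Exy Dxy] Nxy].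
    have x1 : x <> - s by move=> h; apply: Nxy; left; left.
    have x2 : x <> 0 by move=> h; apply: Nxy; left; right.
    have y1 : y <> 0 by move=> h; apply: Nxy; right; left.
    have y2 : y <> s by move=> h; apply: Nxy; right; right.
    move: Exy Dxy; rewrite /E_saddle /square2 /obox /Y1 /Y2 /= !in_itv/= ?andbT.
    move/eqP : x1; move/eqP : x2; move/eqP : y1; move/eqP : y2.
    rewrite !neq_lt => hy2 /orP[] hy1 /orP[] hx2 hx1 xy Dxy.
    + by exfalso; apply: xy; rewrite nmulr_rgt0.
    + by left; right.
    + case/orP : hx1 => hx1; first by left; left.
      case/orP : hy2 => hy2; last by right; rewrite hx1.
      by exfalso; apply: Dxy; rewrite hx1 hx2 hy1.
    + by exfalso; apply: xy; exact: mulr_gt0.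
  move=> x Nx; split => [h|[]//]; split => //.
rewrite interactionU// ?e1 ?e2; last first.
  apply/seteqP; split => // -[x y]; rewrite /Y1 /Y2 /= !in_itv/= ?andbT.
  by move=> [[[h1 h2]|[h1 h2]] [/andP[h3 h4] h5]]; exfalso; clear e1 e2; lra.
rewrite -interactionU//; last first.
  apply/seteqP; split => // -[x y]; rewrite /X1 /X2 /= !in_itv/= ?andbT.
  by move=> [[[h1 h2]|[h1 h2]] [/andP[h3 h4] h5]]; exfalso; clear e1 e2; lra.
apply: le_interaction => // -[x y]; rewrite /X1 /X2 /E_saddle /= !in_itv/= ?andbT.
move=> [[[h1 h2]|[h1 h2]]|[/andP[_ h1] h2]]; first exact: mulr_gt0.
  by rewrite nmulr_rgt0// (lt_trans h1)// oppr_lt0.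
by rewrite nmulr_rgt0.
Qed.

(* The central symmetry exchanges the two squares and preserves the saddle set. *)
Let kappa (x : plane) : plane := (0 - x.1, 0 - x.2).

Let preserving_kappa : preserving kappa.
Proof. exact: preserving_comp (preserving_reflect1 0) (preserving_reflect2 0). Qed.

Let kappa_isometry x y : enorm (kappa x - kappa y) = enorm (x - y).
Proof. by rewrite /enorm /=; congr Num.sqrt; ring. Qed.

Let balance4 : (I square4 (~` E `\` square4) <= I square4 E)%E.
Proof.
have kE : kappa @^-1` E = E.
  by apply/seteqP; split => x; rewrite /kappa /E_saddle /= !sub0r mulrNN.
have kD : kappa @^-1` square2 = square4.
  apply/seteqP; split => x; rewrite /square2 /square4 /obox /kappa /= !in_itv/= !sub0r;
  move=> [/andP[h1 h2] /andP[h3 h4]]; split; apply/andP; split; lra.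
have kZ : kappa @^-1` (~` E `\` square2) = ~` E `\` square4.
  by rewrite !setDE preimage_setI -!preimage_setC kE kD.
have mZ : measurable (~` E `\` square2 : set borel_plane) by exact: measurableD.
rewrite -kZ -kD (interaction_preserving preserving_kappa kappa_isometry mD2 mZ).
by rewrite -[X in (_ <= I _ X)%E]kE (interaction_preserving preserving_kappa kappa_isometry mD2 mE).
Qed.

Let D := square2 `|` square4.
Let F := E `|` D.

Lemma square_disjoint : square2 `&` square4 = set0.
Proof.
apply/seteqP; split => // -[x y]; rewrite /square2 /square4 /obox /= !in_itv/=.
by move=> [[/andP[h1 h2] _] [/andP[h3 h4] _]]; exfalso; lra.
Qed.

Lemma square_Ec : D `<=` ~` E.
Proof.
move=> [x y]; rewrite /D /square2 /square4 /obox /E_saddle /= !in_itv/= => -[] [/andP[h1 h2] /andP[h3 h4]]; apply/negP; rewrite -leNgt.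
  by rewrite nmulr_rle0// ltW.
by rewrite pmulr_rle0// ltW.
Qed.

(** By the balance above, adding one of the squares does not increase the
    perimeter. In adding both, the interaction of one with the other, which each of
    the two balances counts as a cost, is saved. *)
Lemma frac_per_square_gap : D `<=` O ->
  (frac_per sigma F O + I square2 square4 <= frac_per sigma E O)%E.
Proof.
move=> DO; have mD : measurable (D : set borel_plane) by exact: measurableU.
have DEc := square_Ec.
have mOc : measurable (~` O) by exact: measurableC.
have e1 : ~` E = (~` E `\` D) `|` D.
  by rewrite setUC setDUK.
have e2 : ~` E `&` O = ((~` E `&` O) `\` D) `|` D.
  by rewrite setUC setDUK// subsetI.
have e3 : F `&` O = (E `&` O) `|` D by rewrite /F setIUl (setIidl DO).
have e4 : ~` F = ~` E `\` D by rewrite /F setCU setDE.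
have e5 : ~` F `&` O = (~` E `&` O) `\` D by rewrite e4 !setDE -!setIA [~` D `&` _]setIC.
have e6 : F `&` ~` O = E `&` ~` O.
  rewrite /F setIUl (_ : D `&` ~` O = set0) ?setU0//.
  by apply/seteqP; split => // x [/DO].
have mEO : measurable (E `&` O : set borel_plane) by exact: measurableI.
have mEOc : measurable (E `&` ~` O : set borel_plane) by exact: measurableI.
have mED : measurable (~` E `\` D : set borel_plane) by exact: measurableD.
have mEOD : measurable ((~` E `&` O) `\` D : set borel_plane) by apply: measurableD => //; exact: measurableI.
have DD (X : set plane) : (X `\` D) `&` D = set0 by rewrite setDE -setIA setICl setI0.
have intUl (A A' B : set borel_plane) : measurable A -> measurable A' -> measurable B ->
    A `&` A' = set0 -> (I (A `|` A') B = I A B + I A' B)%E.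
  move=> mA mA' mB AA; rewrite interactionC//; last exact: measurableU.
  by rewrite interactionU// (interactionC mB mA) (interactionC mB mA').
rewrite /frac_per e5 e6 e3 e4 [in leRHS]e2 [X in (_ <= I _ X + _)%E]e1.
rewrite (interactionU mEO mED mD)// (intUl _ _ _ mEOD mD mEOc)//.
rewrite (intUl _ _ _ mEO mD mED); last first.
  by apply/seteqP; split => // x [[Ex _] /DEc].
set a := I (E `&` O) (~` E `\` D); set b := I (E `&` O) D.
set c := I (_ `\` D) _; set d := I D (E `&` ~` O); set e := I D (~` E `\` D).
have bd : (b + d = I D E)%E.
  rewrite /b interactionC// /d -interactionU//.
    by rewrite -setIUr setUv setIT.
  by apply/seteqP; split => // x [[_ h] [_ h']].
have key : (e + I square2 square4 <= b + d)%E.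
  rewrite bd /e (intUl _ _ _ mD2 mD4 mED) ?square_disjoint//.
  rewrite (intUl _ _ _ mD2 mD4 mE) ?square_disjoint//.
  rewrite addeAC; apply: leeD.
    apply: le_trans balance2; rewrite -interactionU//.
      apply: le_interaction => // x [[Ex Dx]|D4x]; split => //.
      - by move=> D2x; apply: Dx; left.
      - by apply: DEc; right.
      - by move=> D2x; have : set0 x by rewrite -square_disjoint.
    by apply/seteqP; split => // x [[_ Dx] D4x]; apply: Dx; right.
  apply: le_trans balance4; apply: le_interaction => // x [Ex Dx]; split => // D4x.
  by apply: Dx; right.
have -> : (a + e + c + I square2 square4 = a + c + (e + I square2 square4))%E.
  clearbody a c e; move: (I square2 square4) => g.
  by rewrite (addeAC a e c) addeA.
have -> : (a + b + (c + d) = a + c + (b + d))%E by rewrite addeACA.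
exact: leeD.
Qed.

End square_gap.

End interaction.

(** * Integrals on the line *)

Section line_integrals.
Context {R : realType}.
Local Notation mu := (@lebesgue_measure R).
Local Notation line := (measurableTypeR R).

Lemma integral_reflect (p : R) (f : R -> \bar R) : measurable_fun setT (f : line -> \bar R) ->
  (forall t, 0 <= f t)%E -> (\int[mu]_t f (p - t)%R = \int[mu]_t f t)%E.
Proof.
move=> mf f0.
have mr : measurable_fun setT (fun t : line => p - t : line).
  by apply: measurable_funB => //; exact: measurable_cst.
have E1 := @ge0_integral_pushforward _ _ _ _ R (fun t : line => p - t : line) mr mu setT f measurableT mf (fun z _ => f0 z).
rewrite preimage_setT in E1.
pose m := measure_function_pushforward__canonical__measure_function_Measure mu mr.
have E2 : (\int[m]_t f t = \int[mu]_t f t)%E.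
  apply: (@eq_measure_integral _ _ R setT mu m) => A mA _.
  exact: lebesgue_measure_reflect.
exact: (etrans (esym E1) E2).
Qed.

(** The line is covered by the two half lines issued from [c]. *)
Lemma integral_dist (c : R) (f : R -> \bar R) : measurable_fun setT (f : line -> \bar R) ->
  (forall t, 0 <= f t)%E -> (forall t : R, t <= 0 -> f t = 0%E) ->
  (\int[mu]_t f (`|c - t|)%R = 2%:E * \int[mu]_(t in `]0%R, +oo[) f t)%E.
Proof.
move=> mf f0 fN.
have mfa : measurable_fun setT ((fun t => f (`|t|)%R) : line -> \bar R).
  by apply: (measurableT_comp mf); exact: normr_measurable.
rewrite (integral_reflect c mfa); last by move=> t; exact: f0.
have mfo : measurable_fun setT ((fun t => f (0 - t)%R) : line -> \bar R).
  apply: (measurableT_comp mf); apply: measurable_funB => //; exact: measurable_cst.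
transitivity (\int[mu]_t (f t + f (0 - t)%R))%E.
  apply: eq_integral => t _; rewrite sub0r; have [t0|t0] := leP 0 t.
    by rewrite ger0_norm// (fN (- t)) ?adde0// oppr_le0.
  by rewrite ltr0_norm// (fN t) ?add0e// ltW.
rewrite ge0_integralD// (integral_reflect 0 mf f0) mule_natl mule2n.
rewrite [in RHS]integral_mkcond; congr (_ + _)%E;
  by apply: eq_integral => t _; rewrite /patch; case: ifPn => // /negP tn;
  apply: fN; rewrite leNgt; apply/negP => t0; apply: tn; apply/mem_set; rewrite /= in_itv/= t0.
Qed.

(** An improper form of the fundamental theorem of calculus, for a nonnegative
    derivative: exhaustion of [A] by the compact intervals [al n, be n]. *)
Lemma integral_derive_le (h F : R -> R) (A : set R) (V : R) (al be : nat -> R) :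
  (forall n, al n < be n) -> {homo al : m n / (m <= n)%N >-> n <= m} ->
  {homo be : m n / (m <= n)%N >-> m <= n} ->
  A `<=` \bigcup_n `[al n, be n]%classic ->
  (forall n x, al n <= x <= be n -> [/\ is_derive x 1 F (h x), {for x, continuous h} & 0 <= h x]) ->
  (forall n, F (be n) - F (al n) <= V) ->
  (\int[mu]_(x in A) (h x)%:E <= V%:E)%E.
Proof.
move=> albe nal nbe AU hF FV.
pose K n : set line := `[al n, be n]%classic.
have mK n : measurable (K n) by exact: measurable_itv.
have h0 n x : K n x -> 0 <= h x by rewrite /K/= in_itv/= => /hF[].
apply: (@le_trans _ _ (\int[mu]_(x in \bigcup_n K n) (h x)%:E)%E).
  apply: le_integral_arbitrary => x; rewrite /patch.
    by case: ifPn => // /set_mem/AU[n _ Kx]; rewrite lee_fin (h0 n).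
  case: ifPn => [/set_mem/AU Ux|_]; first by rewrite mem_set.
  by case: ifPn => // /set_mem[n _ Kx]; rewrite lee_fin (h0 n).
have ch n : {within K n, continuous h}.
  by apply: continuous_in_subspaceT => x /set_mem; rewrite /K /= in_itv/= => /hF[].
have cv := @ge0_nondecreasing_set_cvg_integral _ line R K (EFin \o h) mu _ mK _ _.
have {}cv : (\int[mu]_(x in K i) (h x)%:E)%E @[i --> \oo] --> (\int[mu]_(x in \bigcup_n K n) (h x)%:E)%E.
  apply: cv.
  - move=> m n mn; apply/subsetPset => x; rewrite /K /= !in_itv/= => /andP[h1 h2].
    by rewrite (le_trans (nal _ _ mn) h1) (le_trans h2 (nbe _ _ mn)).
  - by move=> n; apply/measurable_EFinP; apply: subspace_continuous_measurable_fun (ch n); exact: mK.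
  - by move=> n x /h0; rewrite lee_fin.
rewrite -(cvg_lim (@ereal_hausdorff R) cv).
apply: lime_le; first by apply/cvg_ex; eexists; exact: cv.
apply: nearW => n; rewrite (@continuous_FTC2 _ h F) ?albe//.
- by rewrite -EFinB lee_fin.
- exact: ch.
- have dF x : al n <= x <= be n -> derivable F x 1 by move=> /hF[[? ?] _ _].
  have cF x : al n <= x <= be n -> {for x, continuous F}.
    by move=> hx; apply: differentiable_continuous; apply/derivable1_diffP; exact: dF.
  split.
  + by move=> x; rewrite in_itv/= => /andP[/ltW h1 /ltW h2]; apply: dF; rewrite h1.
  + by apply: cvg_at_right_filter; apply: cF; rewrite lexx ltW.
  + by apply: cvg_at_left_filter; apply: cF; rewrite lexx ltW.
- move=> x; rewrite in_itv/= => /andP[/ltW h1 /ltW h2].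
  by rewrite derive1E; have [[_ ->]] := hF n x (introT andP (conj h1 h2)).
Qed.

(** The primitive is the arc tangent, whose range has length pi. *)
Lemma integral_cauchy_kernel_le (t c : R) : 0 < t ->
  (\int[mu]_z ((t ^+ 2 + (c - z) ^+ 2)^-1)%:E <= (pi / t)%:E)%E.
Proof.
move=> t0; have tn0 : t != 0 by rewrite gt_eqF.
have dn0 z : t ^+ 2 + (c - z) ^+ 2 != 0 by rewrite gt_eqF// ltr_pwDl ?sqr_ge0// exprn_gt0.
pose F z := t^-1 * atan (t^-1 * z + (- (c / t))).
apply: (@integral_derive_le _ F _ _ (fun n => - n.+1%:R) (fun n => n.+1%:R)).
- by move=> n; rewrite (@lt_trans _ _ 0)// ?oppr_lt0.
- by move=> m n mn; rewrite lerN2 ler_nat.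
- by move=> m n mn; rewrite ler_nat.
- move=> z _; exists (Num.truncn `|z|) => //; rewrite /= in_itv/= -ler_norml.
  by rewrite ltW// truncnS_gt.
- move=> _ z _; split; last by rewrite invr_ge0 addr_ge0 ?sqr_ge0.
  + have da : is_derive z 1 (fun x : R => t^-1 * x + (- (c / t))) t^-1.
      have h := is_deriveD (is_deriveZ t^-1 (is_derive_id z 1)) (is_derive_cst (- (c / t)) z 1).
      by apply: (is_derive_eq h); rewrite addr0 /GRing.scale/= mulr1.
    have h := is_deriveZ t^-1 (@is_derive1_comp _ atan (fun x => t^-1 * x + - (c / t)) z _ _ (is_derive1_atan _) da).
    apply: (is_derive_eq h); rewrite /GRing.scale/=.
    have -> : 1 + (t^-1 * z + - (c / t)) ^+ 2 = (t ^+ 2 + (c - z) ^+ 2) / t ^+ 2 by field.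
    by have := dn0 z; move: (t ^+ 2 + (c - z) ^+ 2) => d d0; field; rewrite ?tn0 ?d0.
  + apply: cvgV => //; apply: cvgD; first exact: cvg_cst.
    apply: (@continuous_comp _ _ _ (fun z => c - z) (fun z => z ^+ 2)); last exact: exprn_continuous.
    by apply: cvgB; [exact: cvg_cst|exact: cvg_id].
- move=> n; rewrite /F -mulrBr mulrC ler_pM2r ?invr_gt0//.
  set a := t^-1 * _ + _; set b := t^-1 * _ + _.
  have := atan_ltpi2 a; have := atan_gtNpi2 b; move: (atan a) (atan b) => x y; lra.
Qed.

Section powers.
Variable sigma : R.
Hypothesis s01 : 0 < sigma < 1.

Let s0 : 0 < sigma. Proof. by case/andP : s01. Qed.
Let s1 : sigma < 1. Proof. by case/andP : s01. Qed.

Lemma integral_tail_le (tau : R) : 0 < tau ->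
  (\int[mu]_(y in `[tau, +oo[) (y `^ (- sigma - 1))%:E <= (tau `^ (- sigma) / sigma)%:E)%E.
Proof.
move=> t0; pose F y : R := - sigma^-1 * y `^ (- sigma).
have dF (y : R) : 0 < y -> is_derive y 1 F (y `^ (- sigma - 1)).
  move=> y0; have h := is_deriveZ (- sigma^-1) (is_derive1_powR (- sigma) y0).
  by apply: (is_derive_eq h); rewrite /GRing.scale/=; field; rewrite gt_eqF.
apply: (@integral_derive_le _ F _ _ (fun n => tau) (fun n => tau + n.+1%:R)) => //.
- by move=> n; rewrite ltrDl.
- by move=> m n mn; rewrite lerD2l ler_nat.
- move=> z; rewrite /= in_itv/= andbT => tz; exists (Num.truncn z) => //.
  by rewrite /= in_itv/= tz/= ltW// ltr_wpDl ?ltW ?truncnS_gt.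
- move=> n y /andP[ty _]; have y0 := lt_le_trans t0 ty; split.
  + exact: dF.
  + apply: differentiable_continuous; apply/derivable1_diffP; apply: ex_derive.
    exact: is_derive1_powR.
  + exact: powR_ge0.
- move=> n; rewrite /F mulNr mulNr opprK addrC [leRHS]mulrC gerDl oppr_le0.
  by rewrite mulr_ge0 ?powR_ge0// invr_ge0 ltW.
Qed.

Lemma integral_head_le (r : R) : 0 < r ->
  (\int[mu]_(x in `]0%R, r]) (x `^ (- sigma))%:E <= (r `^ (1 - sigma) / (1 - sigma))%:E)%E.
Proof.
move=> r0; pose F y : R := (1 - sigma)^-1 * y `^ (1 - sigma).
have s10 : 0 < 1 - sigma by rewrite subr_gt0.
have dF (y : R) : 0 < y -> is_derive y 1 F (y `^ (- sigma)).
  move=> y0; have h := is_deriveZ ((1 - sigma)^-1) (is_derive1_powR (1 - sigma) y0).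
  apply: (is_derive_eq h); rewrite /GRing.scale/= mulrA mulVf ?gt_eqF// mul1r.
  by congr (_ `^ _); ring.
apply: (@integral_derive_le _ F _ _ (fun n => r / n.+2%:R) (fun n => r)) => //.
- by move=> n; rewrite ltr_pdivrMr// ltr_pMr// ltr1n.
- by move=> m n mn; rewrite ler_pM2l// lef_pV2 ?posrE// ler_nat.
- move=> z; rewrite /= in_itv/= => /andP[z0 zr]; exists (Num.truncn (r / z)) => //.
  rewrite /= in_itv/= zr andbT ler_pdivrMr// mulrC -ler_pdivrMr//.
  by rewrite ltW// (lt_le_trans (truncnS_gt _))// ler_nat.
- move=> n y /andP[ty _]; have y0 : 0 < y by apply: lt_le_trans ty; rewrite divr_gt0.
  split.
  + exact: dF.
  + apply: differentiable_continuous; apply/derivable1_diffP; apply: ex_derive.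
    exact: is_derive1_powR.
  + exact: powR_ge0.
- move=> n; rewrite /F [leRHS]mulrC gerDl oppr_le0.
  by rewrite mulr_ge0 ?powR_ge0// invr_ge0 ltW.
Qed.

End powers.
End line_integrals.

(** * Scaling of the fractional perimeter of the saddle set *)

Section upper_bound.
Context {R : realType}.
Local Notation plane := (R * R)%type.
Local Notation line := (measurableTypeR R).
Local Notation borel_plane := (measurableTypeR R * measurableTypeR R)%type.
Local Notation leb2 := (@leb2 R).
Local Notation leb4 := (@leb4 R).
Local Notation mu := (@lebesgue_measure R).
Variable sigma : R.
Hypothesis s01 : 0 < sigma < 1.
Local Notation I := (interaction sigma).
Local Notation E := (@E_saddle R).

Let s0 : 0 < sigma. Proof. by case/andP : s01. Qed.
Let s1 : sigma < 1. Proof. by case/andP : s01. Qed.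

Let mpow (D : set line) (p : R) : measurable_fun D (fun t : line => t `^ p : R).
Proof. by apply: (@measurable_funS _ _ _ _ setT) => //; exact: measurable_powR. Qed.

(** One part of the exponent is spent on the first coordinate alone, which leaves a
    Cauchy kernel in the second one: the Riesz kernel itself has no elementary
    primitive. *)
Lemma riesz_le (x y : plane) : x.1 != y.1 ->
  riesz sigma (x, y) <= `|x.1 - y.1| `^ (- sigma) * ((`|x.1 - y.1|) ^+ 2 + (x.2 - y.2) ^+ 2)^-1.
Proof.
move=> xy; set t := `|x.1 - y.1|.
have t0 : 0 < t by rewrite normr_gt0 subr_eq0.
set q := t ^+ 2 + _.
have q0 : 0 < q by rewrite ltr_pwDl ?sqr_ge0// exprn_gt0.
have eq : enorm (x - y) = Num.sqrt q.
  by rewrite /enorm /q /t real_normK ?num_real.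
have te : t <= enorm (x - y).
  have : Num.sqrt (t ^+ 2) <= Num.sqrt q by apply: ler_wsqrtr; rewrite lerDl sqr_ge0.
  by rewrite sqrtr_sqr (ger0_norm (ltW t0)) eq.
rewrite /riesz /= powRD; last by apply/implyP => _; rewrite eq gt_eqF// sqrtr_gt0.
rewrite powR_mulrn ?sqrtr_ge0// {1}eq sqr_sqrtr ?(ltW q0)// invfM mulrC powRN.
apply: ler_wpM2r; first by rewrite invr_ge0 ltW.
rewrite lef_pV2 ?posrE ?powR_gt0// ?(lt_le_trans t0)//.
by rewrite ge0_ler_powR// ?nnegrE ?(ltW s0) ?(ltW t0)// ltW// (lt_le_trans t0).
Qed.

Variable r : R.
Hypothesis r0 : 0 < r.

(* The set of pairs where the first coordinates are at least as far from each other
   as the first point is from the vertical axis. *)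
Let W : set (borel_plane * borel_plane) := [set z | [/\ box (- r) r (- r) r z.1,
  z.1.1 != 0 & `|z.1.1| <= `|z.1.1 - z.2.1|]].

Let mfst1 : measurable_fun setT ((fun z => z.1.1) : borel_plane * borel_plane -> R).
Proof. exact: (measurableT_comp measurable_fst measurable_fst). Qed.

Let mfst2 : measurable_fun setT ((fun z => z.2.1) : borel_plane * borel_plane -> R).
Proof. exact: (measurableT_comp measurable_fst measurable_snd). Qed.

Let mW : measurable W.
Proof.
pose b := box (- r) r (- r) r : set borel_plane.
pose g (z : borel_plane * borel_plane) : R := `|z.1.1 - z.2.1| - `|z.1.1|.
have mg : measurable_fun setT g.
  apply: measurable_funB; apply: measurableT_comp => //; exact: measurable_funB.
have -> : W = (b `*` setT) `&` ((fun z => z.1.1) @^-1` (~` [set 0])) `&` (g @^-1` `[0, +oo[%classic).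
  apply/seteqP; split => z; rewrite /W /b /g /= in_itv/= andbT subr_ge0.
    by move=> [h1 /eqP h2 h3].
  by move=> [[[h1 _] /eqP h2] h3].
apply: measurableI; first apply: measurableI.
- by apply: measurableX => //; exact: measurable_box.
- rewrite -[_ @^-1` _]setTI; apply: mfst1 => //; apply: measurableC; exact: measurable_set1.
- by rewrite -[_ @^-1` _]setTI; apply: mg => //; exact: measurable_itv.
Qed.

Let G : borel_plane * borel_plane -> \bar R := (EFin \o riesz sigma) \_ W.

Let mG : measurable_fun setT G.
Proof. by apply/(measurable_restrictT _ mW); exact: measurable_funS (measurable_riesz sigma). Qed.

Let G0 z : (0 <= G z)%E.
Proof. by apply: erestrict_ge0 => x _; rewrite lee_fin riesz_ge0. Qed.

(* The iterated integral of the kernel over [W]: first over the second coordinate of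
   the second point, then over its first coordinate, then over the first point. Each
   step loses one power of the distance, and the last integrand, of order - sigma, is
   integrable at the axis. *)
Let inner2 (x : plane) (y1 : R) : x.1 != 0 -> `|x.1| <= `|x.1 - y1| ->
  (\int[mu]_y2 G (x, (y1, y2)) <= (pi * `|x.1 - y1| `^ (- sigma - 1))%:E)%E.
Proof.
move=> x10 hx; set t := `|x.1 - y1|.
have t0 : 0 < t by apply: lt_le_trans hx; rewrite normr_gt0.
have xy : x.1 != y1 by rewrite -subr_eq0 -normr_gt0.
have dn0 (z : R) : t ^+ 2 + (x.2 - z) ^+ 2 != 0 by rewrite gt_eqF// ltr_pwDl ?sqr_ge0// exprn_gt0.
have mk : measurable_fun setT ((fun z => ((t ^+ 2 + (x.2 - z) ^+ 2)^-1)%:E) : line -> \bar R).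
  apply/measurable_EFinP; apply: continuous_measurable_fun => z.
  apply: cvgV => //; apply: cvgD; first exact: cvg_cst.
  apply: (@continuous_comp _ _ _ (fun z => x.2 - z) (fun z => z ^+ 2)); last exact: exprn_continuous.
  by apply: cvgB; [exact: cvg_cst|exact: cvg_id].
apply: (@le_trans _ _ (\int[mu]_y2 ((t `^ (- sigma))%:E * ((t ^+ 2 + (x.2 - y2) ^+ 2)^-1)%:E))%E).
  apply: le_integral_arbitrary => y2; rewrite /patch !mem_setT //.
  rewrite /G /patch; case: ifPn => [_|_].
    by rewrite -EFinM lee_fin; exact: (@riesz_le x (y1, y2)).
  by rewrite -EFinM lee_fin mulr_ge0 ?powR_ge0// invr_ge0 addr_ge0 ?sqr_ge0.
rewrite ge0_integralZl_EFin//; [|by move=> z _; rewrite lee_fin invr_ge0 addr_ge0 ?sqr_ge0|exact: powR_ge0].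
apply: (@le_trans _ _ ((t `^ (- sigma))%:E * (pi / t)%:E)%E).
  by rewrite lee_wpmul2l ?lee_fin ?powR_ge0// integral_cauchy_kernel_le.
rewrite -EFinM lee_fin powRD; last by apply/implyP => _; rewrite gt_eqF.
by rewrite (powRN t 1) (powRr1 (ltW t0)) mulrCA.
Qed.

Let inner1 (x : plane) : x.1 != 0 ->
  (\int[leb2]_y G (x, y) <= (2 * pi / sigma * `|x.1| `^ (- sigma))%:E)%E.
Proof.
move=> x10; have a0 : 0 < `|x.1| by rewrite normr_gt0.
have mGx : measurable_fun setT ((fun y => G (x, y)) : borel_plane -> \bar R).
  by apply: (measurableT_comp mG); exact: measurable_pair1.
rewrite /leb2 (fubini_tonelli1 _ mGx) //.
pose f := (fun t : line => (pi * t `^ (- sigma - 1))%:E) \_ `[`|x.1|, +oo[%classic.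
have f0 t : (0 <= f t)%E.
  by apply: erestrict_ge0 => z _; rewrite lee_fin mulr_ge0 ?pi_ge0 ?powR_ge0.
have mf : measurable_fun setT f.
  apply/(measurable_restrictT _ (measurable_itv _)).
  apply/measurable_EFinP; apply: measurable_funM; first exact: measurable_cst.
  exact: mpow.
apply: (@le_trans _ _ (\int[mu]_y1 f (`|x.1 - y1|)%R)%E).
  apply: le_integral_arbitrary => y1; rewrite /patch !mem_setT ?/fubini_F.
    by apply: integral_ge0 => y2 _.
  rewrite /f /patch; case: ifPn => [|/negP h].
    by move=> /set_mem; rewrite /= in_itv/= andbT => h; exact: inner2.
  rewrite integral0_eq// => y2 _; rewrite /G /patch ifF//; apply/negbTE/negP => /set_mem[_ _ /=] h'.
  by apply: h; apply/mem_set; rewrite /= in_itv/= h'.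
rewrite integral_dist//; last first.
  move=> t t0; rewrite /f /patch ifF//; apply/negbTE/negP => /set_mem; rewrite /= in_itv/= andbT.
  by rewrite leNgt (le_lt_trans t0).
apply: (@le_trans _ _ (2%:E * (pi%:E * (\int[mu]_(t in `[(`|x.1|)%R, +oo[) (t `^ (- sigma - 1))%:E)))%E).
  rewrite lee_wpmul2l// -ge0_integralZl_EFin ?pi_ge0//; last 2 first.
  - by move=> t _; rewrite lee_fin powR_ge0.
  - by apply/measurable_EFinP; apply: measurable_funS (@measurable_powR R _).
  apply: le_integral_arbitrary => t; first exact: erestrict_ge0.
  rewrite {1}/patch; case: ifPn => // _; rewrite /f /patch; case: ifPn => //.
apply: (@le_trans _ _ (2%:E * (pi%:E * (`|x.1| `^ (- sigma) / sigma)%:E))%E).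
  by rewrite lee_wpmul2l// lee_wpmul2l ?lee_fin ?pi_ge0// integral_tail_le.
by rewrite -!EFinM lee_fin le_eqVlt; apply/orP; left; apply/eqP; ring.
Qed.

Let C := 8 * pi / (sigma * (1 - sigma)).

Let outer : (\int[leb4]_z G z <= (C * r `^ (2 - sigma))%:E)%E.
Proof.
rewrite /leb4 (fubini_tonelli1 _ mG G0).
pose f1 := (fun t : line => (2 * pi / sigma * t `^ (- sigma))%:E) \_ `]0, r]%classic.
pose b := (fun x : borel_plane => f1 (`|0 - x.1|)%R) \_ (setT `*` `[- r, r]%classic).
have f10 t : (0 <= f1 t)%E.
  by apply: erestrict_ge0 => z _; rewrite lee_fin !mulr_ge0 ?pi_ge0 ?powR_ge0// invr_ge0 ltW.
have mf1 : measurable_fun setT f1.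
  apply/(measurable_restrictT _ (measurable_itv _)).
  apply/measurable_EFinP; apply: measurable_funM; first exact: measurable_cst.
  exact: mpow.
have b0 x : (0 <= b x)%E by apply: erestrict_ge0.
have mb : measurable_fun setT b.
  have mI : measurable (setT `*` `[- r, r]%classic : set borel_plane) by apply: measurableX => //; exact: measurable_itv.
  apply/(measurable_restrictT _ mI).
  apply: (@measurable_funS _ _ _ _ setT) => //.
  apply: (measurableT_comp mf1); apply: measurableT_comp => //.
  apply: measurable_funB; [exact: measurable_cst|exact: measurable_fst].
apply: (@le_trans _ _ (\int[leb2]_x b x)%E).
  apply: le_integral_arbitrary => x; rewrite /patch !mem_setT ?/fubini_F.
    by apply: integral_ge0 => y _; exact: G0.
  have [[xb x10]|h] := pselect (box (- r) r (- r) r x /\ x.1 != 0).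
    rewrite /b /patch mem_set; last by split => //=; case: xb.
    rewrite /f1 /patch mem_set; first by rewrite sub0r normrN; exact: inner1.
    rewrite /= in_itv/= sub0r normrN normr_gt0 x10/=; case: xb => /=.
    by rewrite in_itv/= -ler_norml.
  rewrite integral0_eq ?b0// => y _; rewrite /G /patch ifF//; apply/negbTE/negP => /set_mem[h1 h2 _].
  exact: h.
have -> : (\int[leb2]_x b x = \int[mu]_x fubini_F mu b x)%E by exact: (@fubini_tonelli1 _ _ line line R mu mu b mb b0).
pose f2 := (fun t : line => (2 * r)%:E * f1 t)%E.
have f20 t : (0 <= f2 t)%E by rewrite mule_ge0// lee_fin mulr_ge0// ltW.
have mf2 : measurable_fun setT f2 by exact: measurable_funeM.
apply: (@le_trans _ _ (\int[mu]_x1 f2 (`|0 - x1|)%R)%E).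
  apply: le_integral_arbitrary => x1; rewrite /patch !mem_setT ?/fubini_F.
    by apply: integral_ge0 => y _; exact: b0.
  rewrite (_ : (fun y => _) = (fun=> f1 (`|0 - x1|)%R) \_ `[- r, r]%classic); last first.
    apply/funext => y; rewrite /b /patch; congr (if _ then _ else _).
    by apply/idP/idP => /set_mem h; apply/mem_set; [case: h|split].
  rewrite -integral_mkcond integral_cst; last exact: measurable_itv.
  have lr : mu `[- r, r]%classic = (2 * r)%:E.
    rewrite lebesgue_measure_itv/= lte_fin ifT; last by rewrite ltrNl (@lt_trans _ _ 0)// oppr_lt0.
    by rewrite -EFinB opprK mulr2n mulrDl !mul1r.
  apply: (@le_trans _ _ (f1 (`|0 - x1|)%R * (2 * r)%:E)%E); last by rewrite /f2 muleC.
  by rewrite le_eqVlt; apply/orP; left; apply/eqP; congr (_ * _)%E; exact: lr.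
rewrite integral_dist//; last first.
  move=> t t0; rewrite /f2 /f1 /patch ifF ?mule0//; apply/negbTE/negP => /set_mem; rewrite /= in_itv/= => /andP[+ _].
  by rewrite ltNge t0.
apply: (@le_trans _ _ (2%:E * ((2 * r * (2 * pi / sigma))%:E * (\int[mu]_(t in `]0%R, r]) (t `^ (- sigma))%:E)))%E).
  have c0 : 0 <= 2 * r * (2 * pi / sigma).
    by rewrite !mulr_ge0 ?pi_ge0 ?invr_ge0 ?(ltW s0) ?(ltW r0).
  rewrite lee_wpmul2l// -ge0_integralZl_EFin//; last 2 first.
  - by move=> t _; rewrite lee_fin powR_ge0.
  - by apply/measurable_EFinP; apply: measurable_funS (@measurable_powR R _).
  apply: le_integral_arbitrary => t; first exact: erestrict_ge0.
  rewrite {1}/patch; case: ifPn => _.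
    by rewrite /f2 /f1 /patch; case: ifPn => _; [rewrite -!EFinM !mulrA|rewrite mule0].
  by rewrite /patch; case: ifPn => // _; rewrite -EFinM lee_fin mulr_ge0 ?powR_ge0.
apply: (@le_trans _ _ (2%:E * ((2 * r * (2 * pi / sigma))%:E * (r `^ (1 - sigma) / (1 - sigma))%:E))%E).
  rewrite lee_wpmul2l// lee_wpmul2l ?integral_head_le// lee_fin.
  by rewrite !mulr_ge0 ?pi_ge0 ?invr_ge0 ?(ltW s0) ?(ltW r0).
rewrite -!EFinM lee_fin le_eqVlt; apply/orP; left; apply/eqP.
have -> : r `^ (2 - sigma) = r * r `^ (1 - sigma).
  rewrite -{2}(powRr1 (ltW r0)) -powRD; last by apply/implyP => _; rewrite gt_eqF.
  by congr (_ `^ _); ring.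
by rewrite /C; field; rewrite !gt_eqF ?subr_gt0.
Qed.

Let swap (x : plane) : plane := (x.2, x.1).

(** Each pair is in [W] or is mapped there by the exchange of the coordinates. *)
Lemma interaction_le_axes (A B : set plane) :
  (forall x y, A x -> B y -> [/\ box (- r) r (- r) r x, x.1 != 0, x.2 != 0 &
    `|x.1| <= `|x.1 - y.1| \/ `|x.2| <= `|x.2 - y.2| ]) ->
  (I A B <= (2 * C * r `^ (2 - sigma))%:E)%E.
Proof.
move=> AB.
have mGs : measurable_fun setT ((fun z => G (swap z.1, swap z.2)) : borel_plane * borel_plane -> \bar R).
  apply: (measurableT_comp mG); have [ms _] := preserving_swap (R := R).
  by apply: measurable_fun_pair; apply: measurableT_comp ms _; [exact: measurable_fst|exact: measurable_snd].
apply: (@le_trans _ _ (\int[leb4]_z (G z + G (swap z.1, swap z.2)))%E).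
  apply: le_integral_arbitrary => z; rewrite /patch.
    by case: ifP => // _; rewrite lee_fin riesz_ge0.
  rewrite mem_setT; case: ifPn => [/set_mem[/= Az Bz]|_]; last by rewrite adde_ge0.
  have [zb z1 z2 [h|h]] := AB _ _ Az Bz.
    by rewrite /G {1}/patch mem_set ?leeDl// erestrict_ge0// => w _; rewrite lee_fin riesz_ge0.
  rewrite /G {2}/patch mem_set; last by split => //; case: zb.
  have rs : riesz sigma z = riesz sigma (swap z.1, swap z.2) by rewrite /riesz /enorm /= addrC.
  apply: (@le_trans _ _ (riesz sigma (swap z.1, swap z.2))%:E); first by rewrite -rs.
  by apply: leeDr; apply: erestrict_ge0 => w _; rewrite lee_fin riesz_ge0.
rewrite (ge0_integralD _ measurableT (fun z _ => G0 z) mG (fun z _ => G0 _) mGs).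
rewrite (leb4_preserving (preserving_swap (R := R)) mG G0).
apply: (@le_trans _ _ ((C * r `^ (2 - sigma))%:E + (C * r `^ (2 - sigma))%:E)%E).
  by apply: leeD.
by rewrite -EFinD lee_fin -mulrA mulrDl mul1r.
Qed.

(** Two points on different sides of the boundary differ in the sign of a
    coordinate, so that in this coordinate their distance is at least that of the
    first point to an axis. *)
Lemma frac_per_saddle_le :
  (frac_per sigma E (eball 0%R r) <= (4 * C * r `^ (2 - sigma))%:E)%E.
Proof.
have same_sign (a b : R) : ~~ (`|a| <= `|a - b|) -> 0 < a * b.
  rewrite -ltNge => h; have : `|a - b| ^+ 2 < `|a| ^+ 2 by rewrite ltrXn2r.
  by rewrite !real_normK ?num_real// => h'; have := sqr_ge0 b; nra.
have farP (x y : plane) : ~ (`|x.1| <= `|x.1 - y.1| \/ `|x.2| <= `|x.2 - y.2|) ->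
    0 < (x.1 * x.2) * (y.1 * y.2).
  move=> /not_orP[/negP/same_sign h1 /negP/same_sign h2].
  by rewrite mulrACA mulr_gt0.
have far (x y : plane) : E x -> ~ E y -> `|x.1| <= `|x.1 - y.1| \/ `|x.2| <= `|x.2 - y.2|.
  move=> Ex Ey; apply: contrapT => /farP; rewrite pmulr_rgt0//.
have far' (x y : plane) : x.1 != 0 -> x.2 != 0 -> ~ E x -> E y -> `|x.1| <= `|x.1 - y.1| \/ `|x.2| <= `|x.2 - y.2|.
  by move=> _ _ Ex Ey; apply: contrapT => /farP; rewrite pmulr_lgt0.
have bB := eball0_box r0.
rewrite /frac_per (_ : (4 * C * r `^ (2 - sigma))%:E =
  (2 * C * r `^ (2 - sigma))%:E + (2 * C * r `^ (2 - sigma))%:E)%E; last first.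
  by rewrite -EFinD; congr EFin; ring.
apply: leeD.
  apply: interaction_le_axes => x y [Ex /bB bx] Ey; split => //; last exact: far.
    by apply: contraTneq Ex => x0; rewrite /E_saddle /= x0 mul0r ltxx.
  by apply: contraTneq Ex => x0; rewrite /E_saddle /= x0 mulr0 ltxx.
pose N : set borel_plane := ([set 0] `*` setT) `|` (setT `*` [set 0]).
have Nn : null N by apply: nullU; [exact: null_vline|exact: null_hline].
rewrite (@eq_interaction_off_null _ _ N _ ((~` E `&` eball 0 r) `&` ~` N) _ (E `&` ~` eball 0 r) Nn)//.
  apply: interaction_le_axes => x y [[Ex /bB bx] Nx] [Ey _].
  have x1 : x.1 != 0 by apply/eqP => h; apply: Nx; left.
  have x2 : x.2 != 0 by apply/eqP => h; apply: Nx; right.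
  by split => //; exact: far'.
by move=> x Nx; split => [h|[]//]; split.
Qed.

End upper_bound.

(** * Lower bounds for interactions and fractional perimeters *)

Section lower_bound.
Context {R : realType}.
Local Notation plane := (R * R)%type.
Local Notation borel_plane := (measurableTypeR R * measurableTypeR R)%type.
Local Notation leb2 := (@leb2 R).
Local Notation E := (@E_saddle R).

Lemma enorm_le (x : plane) (p q c : R) : 0 <= c -> `|x.1| <= p -> `|x.2| <= q ->
  p ^+ 2 + q ^+ 2 <= c ^+ 2 -> enorm x <= c.
Proof.
move=> c0 xp xq pq; rewrite /enorm -(ger0_norm c0) -sqrtr_sqr; apply: ler_wsqrtr.
apply: le_trans pq; apply: lerD; rewrite -real_normK ?num_real//; apply: lerXn2r => //.
- by rewrite nnegrE (le_trans _ xp).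
- by rewrite nnegrE (le_trans _ xq).
Qed.

Lemma le_two_terms (k q : R) (a b : \bar R) : 0 <= k -> 0 <= q ->
  (0 <= a -> 0 <= b -> q%:E <= a + b -> (k * q * q)%:E <= k%:E * (a * q%:E) + k%:E * (b * q%:E))%E.
Proof.
move=> k0 q0 a0 b0 qab; rewrite -ge0_muleDr; [|by rewrite mule_ge0..].
rewrite -ge0_muleDl// -mulrA !EFinM lee_wpmul2l ?lee_fin//.
by rewrite lee_wpmul2r ?lee_fin.
Qed.

(** One Borel null set absorbs both the failure of [F] to be Borel and its difference
    from the saddle set outside [O]. *)
Lemma competitor_repr (F : set plane) (O : set borel_plane) : lmeasurable F ->
  leb2.-negligible ((F `\` O) `+` (E `\` O)) ->
  exists N : set borel_plane, [/\ null N, measurable (F `&` ~` N : set borel_plane) &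
    forall x, ~ N x -> ~ O x -> F x <-> E x].
Proof.
move=> mF [N2 [mN2 N20 hN2]]; have [N1 [mN1 N10 mFN]] := lmeasurable_borel mF.
have Nn : null (N1 `|` N2) by exact: nullU.
exists (N1 `|` N2); split => //.
  rewrite setCU setIA; apply: measurableI => //; exact: measurableC.
move=> x Nx Ox; split => h; apply: contrapT => h'; apply: Nx; right; apply: hN2.
  by left; split => // -[].
by right; split => // -[].
Qed.

Lemma leb2_setD_null (A N : set borel_plane) : measurable A -> null N ->
  leb2 (A `\` N) = leb2 A.
Proof.
move=> mA [mN N0]; have AN0 : leb2 (A `&` N) = 0%E.
  by apply: (subset_measure0 (measurableI _ _ mA mN) mN _ N0) => x [].
by rewrite [RHS](measureDI leb2 mA mN) [X in (_ = _ + X)%E](_ : _ = 0%E) ?adde0.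
Qed.

Variable sigma : R.
Hypothesis s01 : 0 < sigma < 1.
Local Notation I := (interaction sigma).

Let s0 : 0 < sigma. Proof. by case/andP : s01. Qed.
Let s2 : 0 <= 2 + sigma. Proof. by rewrite addr_ge0// ltW. Qed.

(** Two sets of area [s ^+ 2] within distance [4 * s] of each other. *)
Lemma interaction_squares_ge (s : R) : 0 < s ->
  ((((4 * s) `^ (2 + sigma))^-1 * s ^+ 4)%:E <= I (square2 s) (square4 s))%E.
Proof.
move=> sp; have m2 : measurable (square2 s : set borel_plane) by exact: measurable_obox.
have m4 : measurable (square4 s : set borel_plane) by exact: measurable_obox.
have s40 : 0 < 4 * s by rewrite mulr_gt0.
apply: le_trans (interaction_ge s2 s40 m2 m4 _ _ _) => //; last first.
  move=> [x1 x2] [y1 y2]; rewrite /square2 /square4 /obox /= !in_itv/=.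
  move=> [/andP[a1 a2] /andP[a3 a4]] [/andP[b1 b2] /andP[b3 b4]]; split.
    by apply/eqP => -[h _]; lra.
  apply: (@enorm_le _ (2 * s) (2 * s) _ (ltW s40)) => /=.
  - by rewrite ler_norml; apply/andP; split; lra.
  - by rewrite ler_norml; apply/andP; split; lra.
  - by nra.
have l2 : leb2 (square2 s) = (s ^+ 2)%:E.
  rewrite leb2_rect; [|exact: measurable_itv..].
  rewrite !lebesgue_measure_itv/= !lte_fin oppr_lt0 sp -!EFinB -EFinM.
  by congr EFin; ring.
have l4 : leb2 (square4 s) = (s ^+ 2)%:E.
  rewrite leb2_rect; [|exact: measurable_itv..].
  rewrite !lebesgue_measure_itv/= !lte_fin oppr_lt0 sp -!EFinB -EFinM.
  by congr EFin; ring.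
rewrite l2 l4 -!EFinM lee_fin le_eqVlt; apply/orP; left; apply/eqP; ring.
Qed.

(** Inside the ball lies a square [S] of area [r ^+ 2], and outside lie a square
    [Qp] in the saddle set and a square [Qm] in its complement. Each point of [S]
    that is in [F] interacts with [Qm], and each other point with [Qp], so that no
    choice of [F] inside the ball avoids this cost. *)
Lemma frac_per_competitor_ge (F : set plane) (r : R) : 0 < r -> lmeasurable F ->
  leb2.-negligible ((F `\` eball 0 r) `+` (E `\` eball 0 r)) ->
  ((((4 * r) `^ (2 + sigma))^-1 * r ^+ 4)%:E <= frac_per sigma F (eball 0%R r))%E.
Proof.
move=> r0; set O := eball _ _ => mF nF.
have [N [[mN N0] mFN FE]] := competitor_repr mF nF.
pose S := box (- (r / 2)) (r / 2) (- (r / 2)) (r / 2) : set borel_plane.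
pose Qp := box r (2 * r) (r / 4) (5 / 4 * r) : set borel_plane.
pose Qm := box (- (2 * r)) (- r) (r / 4) (5 / 4 * r) : set borel_plane.
have mS : measurable S by exact: measurable_box.
have mQp : measurable Qp by exact: measurable_box.
have mQm : measurable Qm by exact: measurable_box.
have r20 : 0 <= r / 2 by rewrite divr_ge0 ?ltW.
have SO : S `<=` O by apply: box_eball0 => //; nra.
have QpO x : Qp x -> ~ O x.
  rewrite /Qp /box /= !in_itv/= /O eball0E// => -[/andP[h1 _] _]; apply/negP; rewrite -leNgt.
  by have := sqr_ge0 x.2; nra.
have QmO x : Qm x -> ~ O x.
  rewrite /Qm /box /= !in_itv/= /O eball0E// => -[/andP[_ h1] _]; apply/negP; rewrite -leNgt.
  by have := sqr_ge0 x.2; nra.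
have QpE x : Qp x -> E x.
  rewrite /Qp /box /E_saddle /= !in_itv/= => -[/andP[h1 _] /andP[h2 _]]; rewrite mulr_gt0//; lra.
have QmE x : Qm x -> ~ E x.
  rewrite /Qm /box /E_saddle /= !in_itv/= => -[/andP[_ h1] /andP[h2 _]]; apply/negP; rewrite -leNgt.
  by rewrite nmulr_rle0; lra.
pose A1 := S `&` (F `&` ~` N) : set borel_plane.
pose A2 := (S `\` N) `\` (F `&` ~` N) : set borel_plane.
have mA1 : measurable A1 by exact: measurableI.
have mA2 : measurable A2 by apply: measurableD => //; exact: measurableD.
have mQpN : measurable (Qp `\` N) by exact: measurableD.
have mQmN : measurable (Qm `\` N) by exact: measurableD.
have r40 : 0 < 4 * r by rewrite mulr_gt0.
have dist x y : S x -> Qp y \/ Qm y -> x != y /\ enorm (x - y) <= 4 * r.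
  move=> Sx Qy; split.
    by apply/eqP => xy; case: Qy => [/QpO|/QmO]; apply; rewrite -xy; exact: SO.
  case: x y Sx Qy => [x1 x2] [y1 y2]; rewrite /S /Qp /Qm /box /= !in_itv/=.
  move=> [/andP[a1 a2] /andP[a3 a4]] h.
  apply: (@enorm_le _ (5 / 2 * r) (7 / 4 * r) _ (ltW r40)) => /=.
  - by rewrite ler_norml; case: h => -[/andP[b1 b2] /andP[b3 b4]]; apply/andP; split; lra.
  - by rewrite ler_norml; case: h => -[/andP[b1 b2] /andP[b3 b4]]; apply/andP; split; lra.
  - by nra.
have i1 := @interaction_ge R sigma (F `&` O) (~` F) A1 (Qm `\` N) (4 * r) s2 r40 mA1 mQmN.
have i2 := @interaction_ge R sigma (~` F `&` O) (F `&` ~` O) A2 (Qp `\` N) (4 * r) s2 r40 mA2 mQpN.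
have {}i1 : (((4 * r) `^ (2 + sigma))^-1%:E * (leb2 A1 * leb2 (Qm `\` N)) <= I (F `&` O) (~` F))%E.
  apply: i1.
  - by move=> x [/SO Ox [Fx _]].
  - by move=> x [Qx Nx] /(FE x Nx (QmO x Qx)); exact: QmE.
  - by move=> x y [Sx _] [Qy _]; apply: dist => //; right.
have {}i2 : (((4 * r) `^ (2 + sigma))^-1%:E * (leb2 A2 * leb2 (Qp `\` N)) <= I (~` F `&` O) (F `&` ~` O))%E.
  apply: i2.
  - by move=> x [[/SO Ox Nx] Fx]; split => // Fx'; apply: Fx.
  - move=> x [Qx Nx]; have Ox := QpO x Qx; split => //; apply/(FE x Nx Ox); exact: QpE.
  - by move=> x y [[Sx _] _] [Qy _]; apply: dist => //; left.
have l1 : leb2 (Qm `\` N) = (r ^+ 2)%:E.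
  by rewrite leb2_setD_null// leb2_box; [congr EFin; field|lra..].
have l2 : leb2 (Qp `\` N) = (r ^+ 2)%:E.
  by rewrite leb2_setD_null// leb2_box; [congr EFin; field|lra..].
have lS : leb2 (S `\` N) = (r ^+ 2)%:E.
  by rewrite leb2_setD_null// leb2_box; [congr EFin; field|lra..].
rewrite l1 in i1; rewrite l2 in i2.
have A12 : ((r ^+ 2)%:E <= leb2 A1 + leb2 A2)%E.
  apply: (@le_trans _ _ (leb2 (A1 `|` A2))); last exact: measureU2.
  rewrite -lS.
  apply: le_measure; rewrite ?inE; [exact: measurableD|exact: measurableU|].
  move=> x [Sx Nx]; have [Fx|Fx] := pselect (F x); first by left.
  by right; split => // -[].
rewrite /frac_per; apply: le_trans (leeD i1 i2).
have -> : ((4 * r) `^ (2 + sigma))^-1 * r ^+ 4 =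
    ((4 * r) `^ (2 + sigma))^-1 * (r ^+ 2) * (r ^+ 2) by ring.
apply: le_two_terms => //; first by rewrite invr_ge0 powR_ge0.
exact: sqr_ge0.
Qed.

End lower_bound.

(** * The divergence theorem on chamfered saddle sets *)

Section gauss_green.
Context {R : realType}.
Local Notation plane := (R * R)%type.
Local Notation line := (measurableTypeR R).
Local Notation borel_plane := (measurableTypeR R * measurableTypeR R)%type.
Local Notation leb2 := (@leb2 R).
Local Notation mu := (@lebesgue_measure R).
Local Notation E := (@E_saddle R).

Let ge0_integral_translate (p : R) (f : R -> \bar R) :
  measurable_fun setT (f : line -> \bar R) -> (forall t, 0 <= f t)%E ->
  (\int[mu]_t f (t + p)%R = \int[mu]_t f t)%E.
Proof.
move=> mf f0.
have mf' : measurable_fun setT ((fun t => f (0 - t)%R) : line -> \bar R).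
  by apply: (measurableT_comp mf); apply: measurable_funB => //; exact: measurable_cst.
rewrite -[RHS](integral_reflect 0 mf f0) -[RHS](integral_reflect (- p) mf'); last by move=> t; exact: f0.
by apply: eq_integral => t _; congr f; ring.
Qed.

Lemma integral_translate (p : R) (f : R -> R) : measurable_fun setT (f : line -> R) ->
  (\int[mu]_t (f (t + p))%:E = \int[mu]_t (f t)%:E)%E.
Proof.
move=> mf; have mf' : measurable_fun setT (EFin \o f : line -> \bar R) by exact/measurable_EFinP.
rewrite integralE [RHS]integralE; congr (_ - _)%E.
  rewrite -(ge0_integral_translate p (measurable_funepos mf')); last by move=> t; exact: funepos_ge0.
  by apply: eq_integral => t _; rewrite !funeposE.
rewrite -(ge0_integral_translate p (measurable_funeneg mf')); last by move=> t; exact: funeneg_ge0.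
by apply: eq_integral => t _; rewrite !funenegE.
Qed.

(** The saddle set with the two corners at the origin of its complement cut off
    along segments of slope 1; [chamfer s] is the abscissa of its boundary on a
    horizontal line, and by symmetry the ordinate on a vertical one. *)
Definition chamfered (s : R) : set plane :=
  [set x | 0 < x.2 /\ (0 < x.1 \/ x.2 - s < x.1)] `|`
  [set x | x.2 < 0 /\ (x.1 < 0 \/ x.1 < x.2 + s)].

Definition chamfer (s t : R) : R := if 0 < t then Num.min 0 (t - s) else Num.max 0 (t + s).

Lemma chamfered0 : chamfered 0 = E.
Proof.
apply/seteqP; split => -[x y]; rewrite /chamfered /E_saddle /= subr0 addr0.
  move=> [[y0 h]|[y0 h]]; first by rewrite mulr_gt0//; case: h => // /(lt_trans y0).
  by rewrite nmulr_rgt0//; case: h => // h; exact: lt_trans h y0.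
have [y0|y0|->] := ltgtP y 0; last by rewrite mulr0 ltxx.
  by rewrite nmulr_lgt0// => x0; right; split => //; left.
by rewrite pmulr_lgt0// => x0; left; split => //; left.
Qed.

(** On almost every horizontal line and on almost every vertical line the chamfered
    set is a half line with end point [chamfer s]. *)
Lemma chamfered_row s (x y : R) : chamfered s (x, y) <->
  (0 < y /\ chamfer s y < x) \/ (y < 0 /\ x < chamfer s y).
Proof.
rewrite /chamfered /chamfer /=; split.
  move=> [[y0 h]|[y0 h]]; [left|right]; split => //; rewrite ?y0 ?ltNge ?(ltW y0)/= -?ltNge.
    by rewrite gt_min; apply/orP.
  by rewrite lt_max; apply/orP.
move=> [[y0]|[y0]]; rewrite ?y0 ?ltNge ?(ltW y0)/= -?ltNge.
  by rewrite gt_min => /orP h; left.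
by rewrite lt_max => /orP h; right.
Qed.

Lemma chamfered_col s (x y : R) : 0 <= s -> y != 0 -> chamfered s (x, y) <->
  (0 < x /\ chamfer s x < y) \/ (x < 0 /\ y < chamfer s x) \/
  (x = 0 /\ chamfered s (0, y)).
Proof.
move=> s0 y0; have [x0|x0|->] := ltgtP x 0; last first.
- split; first by move=> h; right; right.
  by move=> [[]|[[]|[]]]; rewrite ?ltxx.
- rewrite /chamfered /chamfer /= x0; split.
    move=> [[yp h]|[yn h]]; left; split => //; rewrite gt_min; apply/orP; [by left|right].
    by case: h => h; lra.
  move=> [[_]|[[]|[]]]; [|lra|lra].
  rewrite gt_min => /orP[yp|h]; first by left; split => //; left.
  by move: y0; rewrite neq_lt => /orP[yn|yp]; [right|left]; split => //; [right; lra|left].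
- rewrite /chamfered /chamfer /= (ltNge 0 x) (ltW x0)/=; split.
    move=> [[yp h]|[yn h]]; right; left; split => //; rewrite lt_max; apply/orP; [right|by left].
    by case: h => h; lra.
  move=> [[]|[[_]|[]]]; [lra| |lra].
  rewrite lt_max => /orP[yn|h]; first by right; split => //; left.
  by move: y0; rewrite neq_lt => /orP[yn|yp]; [right|left]; split => //; [left|right; lra].
Qed.

Lemma measurable_chamfered s : measurable (chamfered s : set borel_plane).
Proof.
have mlt (f : borel_plane -> R) : measurable_fun setT f ->
    measurable [set x | 0 < f x].
  move=> mf; rewrite (_ : [set x | _] = setT `&` f @^-1` `]0, +oo[%classic).
    by apply: mf => //; exact: measurable_itv.
  by rewrite setTI; apply/seteqP; split => x; rewrite /= in_itv/= andbT.
have m1 := @measurable_fst _ _ line line.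
have m2 := @measurable_snd _ _ line line.
have -> : chamfered s =
  ([set x | 0 < x.2] `&` ([set x | 0 < x.1] `|` [set x | 0 < x.1 - x.2 + s])) `|`
  ([set x | 0 < - x.2] `&` ([set x | 0 < - x.1] `|` [set x | 0 < x.2 - x.1 + s])).
  rewrite /chamfered; apply/seteqP; split => x /=; rewrite !oppr_gt0.
    by move=> [[h [h'|h']]|[h [h'|h']]]; [left|left|right|right]; split => //;
      [left|right; lra|left|right; lra].
  by move=> [[h [h'|h']]|[h [h'|h']]]; [left|left|right|right]; split => //;
      [left|right; lra|left|right; lra].
apply: measurableU; apply: measurableI; try apply: measurableU; apply: mlt => //.
- by apply: measurable_funD; [exact: measurable_funB|exact: measurable_cst].
- exact: measurable_funN.
- exact: measurable_funN.
- by apply: measurable_funD; [exact: measurable_funB|exact: measurable_cst].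
Qed.

(** The boundary value of a component of the field where the set is crossed by the
    line at signed distance [t] from the axis, with the sign of the exterior normal. *)
Definition flux (s : R) (h : plane -> R) (t : R) : R :=
  if 0 < t then - h (t, chamfer s t) else if t < 0 then h (t, chamfer s t) else 0.

Lemma measurable_chamfer s : measurable_fun setT (chamfer s : line -> line).
Proof.
rewrite /chamfer; apply: measurable_fun_ifT.
- apply: measurable_fun_ltr; [exact: measurable_cst|exact: measurable_id].
- by apply: measurable_minr; [exact: measurable_cst|apply: measurable_funB => //; exact: measurable_cst].
- by apply: measurable_maxr; [exact: measurable_cst|apply: measurable_funD => //; exact: measurable_cst].
Qed.

Lemma measurable_flux s h : continuous h -> measurable_fun setT (flux s h : line -> R).
Proof.
move=> ch; have mh : measurable_fun setT ((fun t => h (t, chamfer s t)) : line -> R).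
  apply: (measurableT_comp (continuous_borel ch)).
  by apply: measurable_fun_pair; [exact: measurable_id|exact: measurable_chamfer].
rewrite /flux; apply: measurable_fun_ifT.
- apply: measurable_fun_ltr; [exact: measurable_cst|exact: measurable_id].
- exact: measurable_funN.
apply: measurable_fun_ifT; [|exact: mh|exact: measurable_cst].
apply: measurable_fun_ltr; [exact: measurable_id|exact: measurable_cst].
Qed.

Section green.
Variables (s : R) (T : plane -> R) (M : R).
Hypotheses (s0 : 0 <= s) (C1T : C_ 1 T).
Hypothesis T0 : forall x, ~ box (- M) M (- M) M x -> T x = 0.

Let cT : continuous T. Proof. by move/C1P : C1T => []. Qed.

Let f i : borel_plane -> \bar R := (fun x => (partial i T x)%:E) \_ (chamfered s).

Let fi i : leb2.-integrable setT (f i).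
Proof.
apply: (integrable_mkcond _ (measurable_chamfered s)).1.
apply: (@integrableS _ _ _ _ setT) => //; first exact: measurable_chamfered.
apply: (continuous_supp_integrable _ (partial_supp i T0)).
exact: C1_continuous_partial.
Qed.

Let null0 : measurable ([set 0] : set line) /\ mu ([set 0] : set line) = 0%E.
Proof. by split; [exact: measurable_set1|exact: lebesgue_measure_set1]. Qed.

Lemma integral_partial0_chamfered :
  (\int[leb2]_(x in chamfered s) (partial 0 T x)%:E =
   \int[mu]_t (flux s (fun x => T (x.2, x.1)) t)%:E)%E.
Proof.
have [m0 mu0] := null0.
rewrite integral_mkcond -(integral21_prod_meas1 (fi 0)).
apply: (eq_integral_off_null m0 mu0) => y /= y0; rewrite /patch !mem_setT // /fubini_G /flux.
have [d1 d2] := C1_slice0 y C1T.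
have T0' (x : R) : ~ (- M <= x <= M) -> T (x, y) = 0.
  by move=> h; apply: T0 => -[/=]; rewrite in_itv.
have [yn|yp|//] := ltgtP y 0.
  rewrite -(integral_derive_lt d1 d2 T0') [RHS]integral_mkcond; apply: eq_integral => x _.
  rewrite /f /patch partial0E; congr (if _ then _ else _); apply/idP/idP => /set_mem h; apply/mem_set.
    move/chamfered_row : h => [[]|[_]]; first by rewrite ltNge (ltW yn).
    by rewrite /= in_itv.
  by apply/chamfered_row; right; split => //; move: h; rewrite /= in_itv.
rewrite -(integral_derive_gt d1 d2 T0') [RHS]integral_mkcond; apply: eq_integral => x _.
rewrite /f /patch partial0E; congr (if _ then _ else _); apply/idP/idP => /set_mem h; apply/mem_set.
  move/chamfered_row : h => [[_]|[]]; last by rewrite ltNge (ltW yp).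
  by rewrite /= in_itv/= andbT.
by apply/chamfered_row; left; split => //; move: h; rewrite /= in_itv/= andbT.
Qed.

Lemma integral_partial1_chamfered :
  (\int[leb2]_(x in chamfered s) (partial 1 T x)%:E = \int[mu]_t (flux s T t)%:E)%E.
Proof.
have [m0 mu0] := null0.
rewrite integral_mkcond -(integral12_prod_meas1 (fi 1)).
apply: (eq_integral_off_null m0 mu0) => x /= x0; rewrite /patch !mem_setT // /fubini_F /flux.
have [d1 d2] := C1_slice1 x C1T.
have T0' (y : R) : ~ (- M <= y <= M) -> T (x, y) = 0.
  by move=> h; apply: T0 => -[_ /=]; rewrite in_itv.
have [xn|xp|//] := ltgtP x 0.
  rewrite -(integral_derive_lt d1 d2 T0') [RHS]integral_mkcond.
  apply: (eq_integral_off_null m0 mu0) => y /= /eqP y0; rewrite /patch !mem_setT.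
  rewrite /f /patch partial1E; congr (if _ then _ else _); apply/idP/idP => /set_mem h; apply/mem_set.
    move/(chamfered_col x s0 y0) : h => [[]|[[_]|[]//]]; first by rewrite ltNge (ltW xn).
    by rewrite /= in_itv.
  by apply/(chamfered_col x s0 y0); right; left; split => //; move: h; rewrite /= in_itv.
rewrite -(integral_derive_gt d1 d2 T0') [RHS]integral_mkcond.
apply: (eq_integral_off_null m0 mu0) => y /= /eqP y0; rewrite /patch !mem_setT.
rewrite /f /patch partial1E; congr (if _ then _ else _); apply/idP/idP => /set_mem h; apply/mem_set.
  move/(chamfered_col x s0 y0) : h => [[_]|[[]|[]//]]; last by rewrite ltNge (ltW xp).
  by rewrite /= in_itv/= andbT.
by apply/(chamfered_col x s0 y0); left; split => //; move: h; rewrite /= in_itv/= andbT.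
Qed.

End green.

Lemma bounded_supp_integrable1 (h : R -> R) (K M : R) : measurable_fun setT (h : line -> R) ->
  (forall t, `|h t| <= K) -> (forall t, M <= `|t| -> h t = 0) ->
  mu.-integrable setT (EFin \o h).
Proof.
move=> mh hK hM; apply/integrableP; split; first exact/measurable_EFinP.
have K0 : 0 <= K by exact: le_trans (hK 0).
apply: (@le_lt_trans _ _ (\int[mu]_(x in `[(- `|M|)%R, `|M|%R]) K%:E)%E).
  apply: le_integral_arbitrary => t; first exact: erestrict_ge0.
  rewrite /patch mem_setT; case: ifPn => [_|/negP th]; first by rewrite lee_fin.
  rewrite /= hM ?normr0// leNgt; apply/negP => tM; apply: th; apply/mem_set.
  by rewrite /= in_itv/= -ler_norml (le_trans (ltW tM))// ler_norm.
rewrite integral_cst; last exact: measurable_itv.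
have : (mu `[(- `|M|)%R, `|M|%R]%classic < +oo)%E.
  by rewrite lebesgue_measure_itv/=; case: ifP => _; rewrite ?ltry// -EFinB ltry.
by move=> h'; rewrite lte_mul_pinfty// lee_fin.
Qed.

(** Fubini and the fundamental theorem of calculus on the half lines that the set
    cuts out of the lines parallel to the axes. *)
Lemma divergence_chamfered s (T : 'I_2 -> plane -> R) (M : R) : 0 <= s ->
  (forall i, C_ 1 (T i)) -> (forall i x, ~ box (- M) M (- M) M x -> T i x = 0) ->
  (\int[leb2]_(x in chamfered s) (\sum_(i < 2) partial i (T i) x)%:E =
   \int[mu]_t (flux s (fun x => T 0 (x.2, x.1)) t)%:E + \int[mu]_t (flux s (T 1) t)%:E)%E.
Proof.
move=> s0 C1T T0.
rewrite -(integral_partial0_chamfered s (C1T 0) (T0 0)).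
rewrite -(integral_partial1_chamfered s0 (C1T 1) (T0 1)) -integralD.
- by apply: eq_integral => x _; rewrite sum_ord2.
- exact: measurable_chamfered.
- apply: (@integrableS _ _ _ _ setT) => //; first exact: measurable_chamfered.
  apply: (continuous_supp_integrable _ (partial_supp 0 (T0 0))).
  exact: C1_continuous_partial.
- apply: (@integrableS _ _ _ _ setT) => //; first exact: measurable_chamfered.
  apply: (continuous_supp_integrable _ (partial_supp 1 (T0 1))).
  exact: C1_continuous_partial.
Qed.

End gauss_green.

(** * The classical perimeter of chamfered saddle sets, from above *)

Section classical_perimeter.
Context {R : realType}.
Local Notation plane := (R * R)%type.
Local Notation line := (measurableTypeR R).
Local Notation mu := (@lebesgue_measure R).
Local Notation E := (@E_saddle R).

(** A point of the larger ball is at distance less than [U] from its homothetic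
    image in the smaller one. *)
Lemma thicken_eball (U r : R) : 0 < U -> 0 < r ->
  thicken U (eball (0 : plane) r) = eball 0 (r + U).
Proof.
move=> U0 r0; have rU : 0 < r + U by rewrite addr_gt0.
apply/seteqP; split => x.
  move=> [p pr xp]; rewrite eball0E//; rewrite eball0E// in pr; rewrite /eball /= in xp.
  have {}xp : (x.1 - p.1) ^+ 2 + (x.2 - p.2) ^+ 2 < U ^+ 2.
    move: xp; rewrite /enorm /= -{1}(ger0_norm (ltW U0)) -sqrtr_sqr ltr_sqrt// exprn_gt0//.
  move: (x.1) (x.2) (p.1) (p.2) pr xp => a b c d pr xp.
  have cs : (c * (a - c) + d * (b - d)) ^+ 2 <= (c ^+ 2 + d ^+ 2) * ((a - c) ^+ 2 + (b - d) ^+ 2).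
    by rewrite -subr_ge0 (_ : _ - _ = (c * (b - d) - d * (a - c)) ^+ 2) ?sqr_ge0//; ring.
  have h2 : (c * (a - c) + d * (b - d)) ^+ 2 <= (r * U) ^+ 2.
    rewrite (le_trans cs)// exprMn ler_pM ?addr_ge0 ?sqr_ge0// ltW//.
  have : c * (a - c) + d * (b - d) <= r * U.
    have rU0 : 0 < r * U by rewrite mulr_gt0.
    move: h2; move: (_ + _) (r * U) rU0 => X Y Y0 XY; rewrite leNgt; apply/negP => h; nra.
  by move=> h; nra.
rewrite eball0E// => xr; exists (r / (r + U) * x.1, r / (r + U) * x.2).
  rewrite eball0E//= !exprMn -mulrDr exprVn mulrAC ltr_pdivrMr ?exprn_gt0//.
  by rewrite ltr_pM2l ?exprn_gt0.
rewrite /eball /= /enorm /= [X in _ < X](_ : U = Num.sqrt (U ^+ 2)); last first.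
  by rewrite sqrtr_sqr gtr0_norm.
rewrite ltr_sqrt ?exprn_gt0//.
have e (t : R) : t - r / (r + U) * t = U / (r + U) * t by field; rewrite gt_eqF.
rewrite !e !exprMn -mulrDr exprVn mulrAC ltr_pdivrMr ?exprn_gt0//.
by rewrite ltr_pM2l ?exprn_gt0.
Qed.

Section upper.
Variables (s rho : R) (T : 'I_2 -> plane -> R).
Hypotheses (s0 : 0 <= s) (srho : s <= rho) (rho0 : 0 < rho).
Hypotheses (CT : forall i, Cc_ 1 (eball 0 rho) (T i)).
Hypothesis T1 : forall x, \sum_(i < 2) (T i x) ^+ 2 <= 1.

Let cT i : continuous (T i).
Proof. by have [/C1P[]] := CT i. Qed.

Let T_out i x : ~ eball 0 rho x -> T i x = 0.
Proof. by move=> h; have [] := @Cc_partial_eq0 R 1 0 _ _ x (CT i) h. Qed.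

Let T_out1 i (x y : R) : rho <= `|x| -> T i (x, y) = 0.
Proof.
move=> h; apply: T_out; rewrite eball0E//=; apply/negP; rewrite -leNgt.
have : rho ^+ 2 <= `|x| ^+ 2 by apply: lerXn2r; rewrite ?nnegrE ?(ltW rho0).
by rewrite real_normK ?num_real// => h'; rewrite (le_trans h')// lerDl sqr_ge0.
Qed.

Let T_out2 i (x y : R) : rho <= `|y| -> T i (x, y) = 0.
Proof.
move=> h; apply: T_out; rewrite eball0E//=; apply/negP; rewrite -leNgt.
have : rho ^+ 2 <= `|y| ^+ 2 by apply: lerXn2r; rewrite ?nnegrE ?(ltW rho0).
by rewrite real_normK ?num_real// => h'; rewrite (le_trans h')// lerDr sqr_ge0.
Qed.

Let T_le1 i x : `|T i x| <= 1.
Proof.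
have : T i x ^+ 2 <= 1.
  by have := T1 x; rewrite sum_ord2; have := sqr_ge0 (T 0 x); have := sqr_ge0 (T 1 x); case: (ord2P i) => ->; lra.
by rewrite -real_normK ?num_real// expr_le1.
Qed.

(* sqrt 2 would be optimal; any bound less than 2 yields a gain. *)
Let T_diag x : T 0 x - T 1 x <= 3 / 2 /\ T 1 x - T 0 x <= 3 / 2.
Proof.
have := T1 x; rewrite sum_ord2; move: (T 0 x) (T 1 x) => a b ab.
by split; have := sqr_ge0 (a + b); nra.
Qed.

Let g0 := flux s (fun x => T 0 (x.2, x.1)).
Let g1 := flux s (T 1).

Let mg0 : measurable_fun setT (g0 : line -> R).
Proof.
apply: measurable_flux => x; apply: (@continuous_comp _ _ _ (fun x : plane => (x.2, x.1))); last exact: cT.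
by apply: (@cvg_pair _ _ _ _ (nbhs x.2) (nbhs x.1)); [exact: cvg_snd|exact: cvg_fst].
Qed.

Let mg1 : measurable_fun setT (g1 : line -> R).
Proof. exact: measurable_flux. Qed.

Let flux_le1 (h : plane -> R) t : (forall x, `|h x| <= 1) -> `|flux s h t| <= 1.
Proof. by move=> h1; rewrite /flux; case: ifP => _; [rewrite normrN|case: ifP => _; rewrite ?normr0]. Qed.

Let g0_le1 t : `|g0 t| <= 1. Proof. exact: flux_le1. Qed.
Let g1_le1 t : `|g1 t| <= 1. Proof. exact: flux_le1. Qed.

Let g0_out t : rho <= `|t| -> g0 t = 0.
Proof.
by move=> h; rewrite /g0 /flux /= T_out2 ?oppr0//; case: ifP => // _; case: ifP.
Qed.

Let g1_out t : rho <= `|t| -> g1 t = 0.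
Proof.
by move=> h; rewrite /g1 /flux /= T_out1 ?oppr0//; case: ifP => // _; case: ifP.
Qed.

(* The part of the flux carried by the chamfers is shifted by s, to be added to
   that of the other component at the same point of the boundary. *)
Let gA t := if s <= `|t| then g1 t else 0.
Let gB t := if 0 < t < s then g1 t else 0.
Let gC t := if - s < t < 0 then g1 t else 0.

Let g1E t : g1 t = gA t + gB t + gC t.
Proof.
rewrite /gA /gB /gC; have [st|ts] := leP s `|t|.
  rewrite !ifF ?addr0//; apply/negbTE/negP => /andP[h1 h2]; move: st.
    by rewrite ltr0_norm//; lra.
  by rewrite gtr0_norm//; lra.
move: ts; rewrite ltr_norml => /andP[h1 h2]; rewrite h1 h2 andbT/= add0r.
by have [t0|t0|->] := ltgtP t 0; rewrite ?add0r ?addr0// /g1 /flux ltxx.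
Qed.

Let bnd t : R := 2 * \1_(`]- rho, rho[%classic) t - 2^-1 * \1_(`]- s, s[%classic) t.

Let sum_le t : g0 t + (gA t + gB (t + s) + gC (t - s)) <= bnd t.
Proof.
have [g0a g0b] : - 1 <= g0 t /\ g0 t <= 1 by have := g0_le1 t; rewrite ler_norml => /andP[].
have [g1a g1b] : - 1 <= g1 t /\ g1 t <= 1 by have := g1_le1 t; rewrite ler_norml => /andP[].
rewrite /bnd !indicE.
have mem a : (t \in `]- a, a[%classic) = (`|t| < a).
  by rewrite mem_setE in_itv/= -ltr_norml.
rewrite !mem; have [st|ts] := leP s `|t|.
  have -> : gB (t + s) = 0.
    rewrite /gB ifF//; apply/negbTE/negP => /andP[h1 h2]; move: st.
    by rewrite ltr0_norm; lra.
  have -> : gC (t - s) = 0.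
    rewrite /gC ifF//; apply/negbTE/negP => /andP[h1 h2]; move: st.
    by rewrite gtr0_norm; lra.
  rewrite /gA st; have [rt|tr] := leP rho `|t|; first by rewrite g0_out// g1_out//=; lra.
  by rewrite /=; lra.
rewrite (lt_le_trans ts srho) /gA (leNgt s) ts/=.
have hts := ts; move: ts; rewrite ltr_norml => /andP[h1 h2].
have [t0|t0|->] := ltgtP t 0.
- have -> : gC (t - s) = 0 by rewrite /gC ifF//; apply/negbTE/negP => /andP[? ?]; lra.
  rewrite /gB ifT; last by apply/andP; split; lra.
  have ts0 : 0 < t + s by lra.
  rewrite /g0 /g1 /flux /= ts0 (ltNge 0 t) (ltW t0)/= t0 /chamfer ts0 (ltNge 0 t) (ltW t0)/=.
  rewrite max_r ?(ltW ts0)// min_r ?addrK ?(ltW t0)//.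
  by have [+ _] := T_diag (t + s, t); lra.
- have -> : gB (t + s) = 0 by rewrite /gB ifF//; apply/negbTE/negP => /andP[? ?]; lra.
  rewrite /gC ifT; last by apply/andP; split; lra.
  have ts0 : t - s < 0 by lra.
  rewrite /g0 /g1 /flux /= t0 (ltNge 0 (t - s)) (ltW ts0)/= ts0 /chamfer t0 (ltNge 0 (t - s)) (ltW ts0)/=.
  rewrite min_r ?(ltW ts0)// max_r ?subrK ?(ltW t0)//.
  by have [_ +] := T_diag (t - s, t); lra.
- rewrite /g0 /flux ltxx /gB /gC !add0r ltxx andbF ltxx ?andbF/=; lra.
Qed.

Let mif (P : line -> bool) : measurable_fun setT P ->
  measurable_fun setT ((fun t => if P t then g1 t else 0) : line -> R).
Proof. by move=> mP; apply: measurable_fun_ifT => //; exact: measurable_cst. Qed.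

Let mgA : measurable_fun setT (gA : line -> R).
Proof.
apply: mif; apply: measurable_fun_ler; [exact: measurable_cst|exact: normr_measurable].
Qed.

Let mgB : measurable_fun setT (gB : line -> R).
Proof.
apply: mif; apply: measurable_and; apply: measurable_fun_ltr;
  [exact: measurable_cst|exact: measurable_id|exact: measurable_id|exact: measurable_cst].
Qed.

Let mgC : measurable_fun setT (gC : line -> R).
Proof.
apply: mif; apply: measurable_and; apply: measurable_fun_ltr;
  [exact: measurable_cst|exact: measurable_id|exact: measurable_id|exact: measurable_cst].
Qed.

Let integ (h : R -> R) (p : R) : measurable_fun setT (h : line -> R) ->
  (forall t, h t = 0 \/ h t = g1 t) -> mu.-integrable setT (fun t => (h (t + p))%:E).
Proof.
move=> mh hg; apply: (@bounded_supp_integrable1 _ (fun t => h (t + p)) 1 (rho + `|p|)).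
- by apply: (measurableT_comp mh); apply: measurable_funD => //; exact: measurable_cst.
- by move=> t; case: (hg (t + p)) => ->; rewrite ?normr0.
- move=> t ht; case: (hg (t + p)) => -> //; apply: g1_out.
  by have := ler_normB (t + p) p; rewrite addrK; lra.
Qed.

(** Away from the chamfers, each of the two components carries at most 1 at each
    point of its axis; on the chamfers, the two fluxes at a common boundary point add
    up to at most 3/2 instead of 2. *)
Lemma flux_chamfered_le :
  (\int[mu]_t (g0 t)%:E + \int[mu]_t (g1 t)%:E <= (4 * rho - s)%:E)%E.
Proof.
have hA t : gA t = 0 \/ gA t = g1 t by rewrite /gA; case: ifP; [right|left].
have hB t : gB t = 0 \/ gB t = g1 t by rewrite /gB; case: ifP; [right|left].
have hC t : gC t = 0 \/ gC t = g1 t by rewrite /gC; case: ifP; [right|left].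
have z (h : R -> R) : (fun t => (h (t + 0))%:E) = (EFin \o h) by apply/funext => t; rewrite addr0.
have iA : mu.-integrable setT (EFin \o gA) by rewrite -z; exact: integ.
have iB0 : mu.-integrable setT (EFin \o gB) by rewrite -z; exact: integ.
have iC0 : mu.-integrable setT (EFin \o gC) by rewrite -z; exact: integ.
have iB := integ s mgB hB; have iC := integ (- s) mgC hC.
have ig0 : mu.-integrable setT (EFin \o g0) by exact: (@bounded_supp_integrable1 _ g0 1 rho).
have e1 : (\int[mu]_t (g1 t)%:E = \int[mu]_t (gA t + gB (t + s) + gC (t - s))%:E)%E.
  transitivity (\int[mu]_t ((gA t)%:E + (gB t)%:E + (gC t)%:E))%E.
    by apply: eq_integral => t _; rewrite g1E.
  rewrite (integralD measurableT (integrableD measurableT iA iB0) iC0).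
  rewrite (integralD measurableT iA iB0) -(integral_translate s mgB) -(integral_translate (- s) mgC).
  by rewrite -(integralD measurableT iA iB) -(integralD measurableT (integrableD measurableT iA iB) iC).
have iABC : mu.-integrable setT (fun t => (gA t + gB (t + s) + gC (t - s))%:E).
  exact: (integrableD measurableT (integrableD measurableT iA iB) iC).
rewrite e1 -(integralD measurableT ig0 iABC).
have ii (a : R) : mu.-integrable setT (fun t => (\1_(`]- a, a[%classic) t : R)%:E).
  apply: (@bounded_supp_integrable1 _ _ 1 a).
  - by apply: (@measurable_indic _ line R setT); exact: measurable_itv.
  - by move=> t; rewrite indicE; case: (_ \in _); rewrite ?normr0 ?normr1.
  - move=> t ta; rewrite indicE memNset//= in_itv/= => /andP[h1 h2].
    by move: ta; rewrite leNgt ltr_norml h1 h2.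
have ib (a : R) : 0 <= a -> (\int[mu]_t (\1_(`]- a, a[%classic) t : R)%:E = (2 * a)%:E)%E.
  move=> a0; rewrite integral_indic; [|exact: measurableT|exact: (measurable_itv `]- a, a[)].
  rewrite setIT; transitivity (lebesgue_measure `]- a, a[%classic) => //.
  rewrite lebesgue_measure_itv/= lte_fin.
  case: ltP => h; first by rewrite -EFinB; congr EFin; ring.
  by congr EFin; lra.
apply: (@le_trans _ _ (\int[mu]_t (2%:E * (\1_(`]- rho, rho[%classic) t : R)%:E -
    (2^-1)%:E * (\1_(`]- s, s[%classic) t : R)%:E))%E).
  apply: le_integral => //.
  - exact: (integrableD measurableT ig0 iABC).
  - apply: (integrableB measurableT (integrableZl measurableT _ (ii rho)) (integrableZl measurableT _ (ii s))).
  - by move=> t _; rewrite -EFinD -!EFinM -EFinB lee_fin; exact: sum_le.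
rewrite (integralB measurableT (integrableZl measurableT _ (ii rho)) (integrableZl measurableT _ (ii s))).
rewrite !integralZl// !ib ?(ltW rho0)// -!EFinM -EFinB lee_fin; lra.
Qed.

End upper.

Lemma classical_per_chamfered_le (s rho : R) : 0 <= s -> s <= rho -> 0 < rho ->
  (classical_per (chamfered s) (eball 0%R rho) <= (4 * rho - s)%:E)%E.
Proof.
move=> s0 srho rho0; apply: ge_ereal_sup => _ [T [CT T1] <-].
have Tb i x : ~ box (- rho) rho (- rho) rho x -> T i x = 0.
  move=> xb; have [] // := @Cc_partial_eq0 R 1 0 _ _ x (CT i).
  by move=> /(eball0_box rho0).
rewrite (divergence_chamfered s0 _ Tb); last by move=> i; have [] := CT i.
exact: flux_chamfered_le.
Qed.

End classical_perimeter.

(** * The classical perimeter from below *)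

Section classical_perimeter_lower.
Context {R : realType}.
Local Notation plane := (R * R)%type.
Local Notation line := (measurableTypeR R).
Local Notation leb2 := (@leb2 R).
Local Notation mu := (@lebesgue_measure R).
Local Notation E := (@E_saddle R).

(** The exterior normal of the saddle set on an axis changes its sign at the origin,
    and so does a field that follows it. *)
Definition odd_plateau (a b e t : R) : R := plateau a b e t - plateau a b e (- t).

Lemma smooth_odd_plateau a b e : smooth (odd_plateau a b e).
Proof.
have -> : odd_plateau a b e =
    plateau a b e \+ (cst (-1) \* (fun t => plateau a b e (-1 * t + 0))).
  by apply/funext => t; rewrite /odd_plateau /= addr0 !mulN1r.
move=> n; apply: diffnD; first exact: smooth_plateau.
by apply: diffnM; [exact: diffn_cst|apply: diffn_affine; exact: smooth_plateau].
Qed.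

Lemma odd_plateauE a b e t : 0 <= a -> 0 < e ->
  odd_plateau a b e t = if 0 < t then plateau a b e `|t| else - plateau a b e `|t|.
Proof.
move=> a0 e0; rewrite /odd_plateau; case: ltP => t0.
  rewrite gtr0_norm// [plateau a b e (- t)]plateau_eq0 ?subr0//.
  by apply/negP => /andP[]; lra.
rewrite ler0_norm// [plateau a b e t]plateau_eq0 ?sub0r//.
by apply/negP => /andP[]; lra.
Qed.

Lemma integral_ge_annulus (h : R -> R) (u v : R) : 0 < u -> u < v ->
  (forall t, 0 <= h t) -> (forall t, u <= `|t| <= v -> 1 <= h t) ->
  ((2 * (v - u))%:E <= \int[mu]_t (h t)%:E)%E.
Proof.
move=> u0 uv h0 h1.
pose A : set line := `[u, v]%classic; pose B : set line := `[- v, - u]%classic.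
have mA : measurable A by exact: measurable_itv.
have mB : measurable B by exact: measurable_itv.
have -> : ((2 * (v - u))%:E = mu (A `|` B))%E.
  have AB : A `&` B = set0.
    by apply/seteqP; split => // t []; rewrite /A /B /= !in_itv/= => /andP[? ?] /andP[? ?]; lra.
  rewrite measureU//; transitivity (lebesgue_measure A + lebesgue_measure B)%E => //.
  rewrite /A /B !lebesgue_measure_itv/= !lte_fin uv ltrN2 uv -!EFinB -EFinD; congr EFin; ring.
rewrite -[mu _]mul1e -integral_cst; last exact: measurableU.
apply: le_integral_arbitrary => t; first exact: erestrict_ge0.
rewrite /patch mem_setT; case: ifPn => [/set_mem|_]; last by rewrite lee_fin.
rewrite lee_fin => tAB; apply: h1; case: tAB; rewrite /A /B /= in_itv/= => /andP[t1 t2].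
  by rewrite gtr0_norm ?t1//; exact: lt_le_trans t1.
by rewrite ltr0_norm; [apply/andP; split; lra|lra].
Qed.

Lemma flux0E (h : plane -> R) t : flux 0 h t =
  if 0 < t then - h (t, 0) else if t < 0 then h (t, 0) else 0.
Proof.
by rewrite /flux /chamfer subr0 addr0; have [t0|t0|//] := ltgtP t 0;
  rewrite ?max_l ?min_l ?(ltW t0).
Qed.

Lemma integral_flux_ge (h : plane -> R) (a b e : R) : 0 <= a -> 0 < e -> a + e < b - e ->
  (forall t, h (t, 0) = - odd_plateau a b e t) ->
  ((2 * (b - a - 2 * e))%:E <= \int[mu]_t (flux 0 h t)%:E)%E.
Proof.
move=> a0 e0 ab hE.
have fE t : flux 0 h t = plateau a b e `|t|.
  rewrite flux0E !hE !odd_plateauE// !opprK; have [t0|t0|->] := ltgtP t 0 => //; rewrite ?opprK//.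
  by rewrite normr0 plateau_eq0//; apply/negP => /andP[]; lra.
have -> : b - a - 2 * e = (b - e) - (a + e) by ring.
apply: integral_ge_annulus => //; first by lra.
  by move=> t; rewrite fE plateau_ge0.
by move=> t h1; rewrite fE plateau_eq1.
Qed.

(** A field carried by a thin cross around the axes, which follows the exterior
    normal except near the origin and near the boundary of the ball. The arms of the
    cross are cut off before they meet, so that the field is bounded by 1. *)
Lemma classical_per_saddle_ge (rho : R) : 0 < rho ->
  ((4 * rho)%:E <= classical_per E (eball 0%R rho))%E.
Proof.
move=> rho0; apply/lee_addgt0Pr => eps eps0.
(* The cross has width 2 e, and cutting it off costs at most 16 e in total. *)
pose e : R := Num.min (rho / 8) (eps / 16).
have e0 : 0 < e by rewrite /e lt_min !divr_gt0.
have e1 : 8 * e <= rho by rewrite /e -ler_pdivlMl// ge_min mulrC lexx.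
have e2 : 16 * e <= eps by rewrite /e -ler_pdivlMl// ge_min [_^-1 * _]mulrC lexx orbT.
apply: (@le_trans _ _ ((4 * rho - 16 * e)%:E + eps%:E)%E).
  by rewrite -EFinD lee_fin; lra.
rewrite leeD2r//.
pose p := cst (-1) \* odd_plateau e (rho - e) e; pose b := plateau (- e) e e.
have sp : smooth p by move=> n; apply: diffnM; [exact: diffn_cst|exact: smooth_odd_plateau].
have sb : smooth b by exact: smooth_plateau.
have b0 : b 0 = 1 by rewrite /b plateau_eq1//; apply/andP; split; lra.
have p_le1 t : `|p t| <= 1.
  rewrite /p /= mulN1r normrN odd_plateauE//; last exact: ltW.
  by case: ifP => _; rewrite ?normrN ger0_norm ?plateau_ge0 ?plateau_le1.
have p_out t : ~~ (e < `|t| < rho - e) -> p t = 0.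
  by move=> h; rewrite /p /= odd_plateauE ?(ltW e0)//; case: ifP => _; rewrite plateau_eq0// ?oppr0 mulr0.
have b_le1 t : `|b t| <= 1 by rewrite ger0_norm ?plateau_ge0 ?plateau_le1.
have b_out t : e <= `|t| -> b t = 0.
  move=> h; apply: plateau_eq0 => //; apply/negP => /andP[h1 h2]; move: h.
  by rewrite leNgt ltr_norml h1 h2.
pose T (i : 'I_2) := if i == 0 then tensor b p else tensor p b.
have T_out i x : ~ box (- rho) rho (- rho) rho x -> T i x = 0.
  move=> xb; have : rho < `|x.1| \/ rho < `|x.2|.
    apply: contrapT => /not_orP[/negP + /negP]; rewrite -!leNgt !ler_norml => h1 h2.
    by apply: xb; split; rewrite /= in_itv.
  rewrite /T; case: ifP => _ [] h; rewrite /tensor.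
  - by rewrite b_out ?mul0r//; lra.
  - by rewrite p_out ?mulr0//; apply/negP => /andP[]; lra.
  - by rewrite p_out ?mul0r//; apply/negP => /andP[]; lra.
  - by rewrite b_out ?mulr0//; lra.
have C1T i : C_ 1 (T i) by rewrite /T; case: ifP => _; exact: C_tensor.
apply: (@le_trans _ _ (\int[leb2]_(x in E) (\sum_(i < 2) partial i (T i) x)%:E)%E); last first.
  apply: ereal_sup_ubound; exists T => //; split => [i|x].
    have pos : (rho - e) ^+ 2 + e ^+ 2 < rho ^+ 2.
      rewrite -subr_gt0 (_ : _ - _ = 2 * e * (rho - e)); last by ring.
      by rewrite !mulr_gt0//; lra.
    have re : 0 <= rho - e by lra.
    rewrite /T; case: ifP => _.
      apply: (@Cc_box _ 1 _ (- e) e (- (rho - e)) (rho - e)); first exact: C_tensor.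
        move=> x xb; have [h|h] := leP e `|x.1|; first by rewrite /tensor b_out ?mul0r.
        rewrite /tensor p_out ?mulr0//; apply/negP => /andP[h1 h2]; apply: xb.
        by split; rewrite /= in_itv/= -ler_norml ltW.
      by apply: box_eball0 => //; rewrite ?(ltW e0)// addrC.
    apply: (@Cc_box _ 1 _ (- (rho - e)) (rho - e) (- e) e); first exact: C_tensor.
      move=> x xb; have [h|h] := leP e `|x.2|; first by rewrite /tensor b_out ?mulr0.
      rewrite /tensor p_out ?mul0r//; apply/negP => /andP[h1 h2]; apply: xb.
      by split; rewrite /= in_itv/= -ler_norml ltW.
    by apply: box_eball0 => //; exact: ltW.
  have pb s t : (p s * b t) ^+ 2 <= 1.
    by rewrite -real_normK ?num_real// normrM exprn_ile1// mulr_ile1.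
  rewrite sum_ord2 /T /= /tensor; have [h|h] := leP e `|x.1|.
    by rewrite b_out// mul0r expr0n add0r.
  rewrite [p x.1]p_out ?mul0r ?expr0n ?addr0 1?mulrC//.
  by apply/negP => /andP[]; lra.
rewrite -chamfered0 (divergence_chamfered (lexx 0) C1T T_out).
have -> : (4 * rho - 16 * e)%:E = ((2 * (rho - e - e - 2 * e))%:E + (2 * (rho - e - e - 2 * e))%:E)%E.
  by rewrite -EFinD; congr EFin; ring.
apply: leeD; apply: integral_flux_ge => //; rewrite ?(ltW e0)//; try by lra.
  by move=> t; rewrite /T /= /tensor /= b0 mul1r /p /= mulN1r.
by move=> t; rewrite /T /= /tensor /= b0 mulr1 /p /= mulN1r.
Qed.

(** A field along the first axis which does not depend on the first coordinate
    inside the smaller ball: it has no divergence there, so that it does not see the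
    difference between [F] and the saddle set. The annulus in which it is cut off must
    contain a strip of fixed height, which is the reason for [16 <= r * U]. *)
Lemma classical_per_competitor_ge (F : set plane) (r U : R) : 0 < U -> 16 <= r * U ->
  lmeasurable F -> 0 < r ->
  leb2.-negligible ((F `\` eball 0 r) `+` (E `\` eball 0 r)) ->
  (1%:E <= classical_per F (eball 0%R (r + U)))%E.
Proof.
move=> U0 rU mF r0 nF; have [N [[mN N0] _ FE]] := competitor_repr mF nF.
pose w := r + U / 2.
pose b := plateau (- w) w (U / 2); pose p := cst (-1) \* odd_plateau 0 4 1.
have U20 : 0 < U / 2 by rewrite divr_gt0.
have w0 : 0 < w by rewrite addr_gt0.
have sp : smooth p by move=> n; apply: diffnM; [exact: diffn_cst|exact: smooth_odd_plateau].
have sb : smooth b by exact: smooth_plateau.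
have b1 t : `|t| <= r -> b t = 1.
  by rewrite ler_norml => /andP[h1 h2]; rewrite /b plateau_eq1// /w; apply/andP; split; lra.
have b0 : b 0 = 1 by rewrite b1// normr0 ltW.
have p_le1 t : `|p t| <= 1.
  rewrite /p /= mulN1r normrN odd_plateauE//.
  by case: ifP => _; rewrite ?normrN ger0_norm ?plateau_ge0 ?plateau_le1.
have p_out t : ~~ (`|t| < 4) -> p t = 0.
  move=> h; rewrite /p /= odd_plateauE//; case: ifP => _;
    by rewrite plateau_eq0// ?oppr0 ?mulr0//; apply: contra h => /andP[].
have b_le1 t : `|b t| <= 1 by rewrite ger0_norm ?plateau_ge0 ?plateau_le1.
have b_out t : w <= `|t| -> b t = 0.
  move=> h; apply: plateau_eq0 => //; apply/negP => /andP[h1 h2]; move: h.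
  by rewrite leNgt ltr_norml h1 h2.
have db t : `|t| < r -> derive1 b t = 0.
  move=> tr; rewrite derive1E -(derive_cst (1 : R) t 1); apply: near_eq_derive.
  have : nbhs t (`]- r, r[%classic : set R).
    by apply: open_nbhs_nbhs; split; [exact: interval_open|rewrite /= in_itv/= -ltr_norml].
  by apply: filterS => s; rewrite /= in_itv/= -ltr_norml => /ltW /b1.
pose T (i : 'I_2) : plane -> R := if i == 0 then tensor b p else tensor (cst 0) (cst 0).
have sc : smooth (cst 0 : R -> R) by move=> n; exact: diffn_cst.
have C1T i : C_ 1 (T i) by rewrite /T; case: ifP => _; exact: C_tensor.
have T_box i x : ~ box (- w) w (- 4) 4 x -> T i x = 0.
  rewrite /T; case: ifP => _; last by rewrite /tensor mul0r.
  move=> xb; have [h|h] := leP w `|x.1|; first by rewrite /tensor b_out ?mul0r.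
  rewrite /tensor p_out ?mulr0//; apply/negP => h1; apply: xb.
  by split; rewrite /= in_itv/= -ler_norml ltW.
have T_out i x : ~ box (- (w + 4)) (w + 4) (- (w + 4)) (w + 4) x -> T i x = 0.
  move=> xb; apply: T_box; apply: contra_not xb => -[]; rewrite /= !in_itv/= => /andP[? ?] /andP[? ?].
  by split; rewrite /= in_itv/=; apply/andP; split; lra.
apply: (@le_trans _ _ (\int[leb2]_(x in F) (\sum_(i < 2) partial i (T i) x)%:E)%E); last first.
  apply: ereal_sup_ubound; exists T => //; split => [i|x].
    apply: (@Cc_box _ 1 _ (- w) w (- 4) 4) => //; first exact: T_box.
    apply: box_eball0; rewrite ?addr_gt0 ?(ltW w0)//.
    rewrite -subr_gt0 (_ : _ - _ = (r * U - 16) + 3 / 4 * U ^+ 2); last by rewrite /w; field.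
    have := exprn_gt0 2 U0; lra.
  rewrite sum_ord2 /T /= /tensor mul0r expr0n addr0.
  by rewrite -real_normK ?num_real// normrM exprn_ile1// mulr_ile1.
have -> : (\int[leb2]_(x in F) (\sum_(i < 2) partial i (T i) x)%:E =
           \int[leb2]_(x in E) (\sum_(i < 2) partial i (T i) x)%:E)%E.
  apply: (eq_integral_off_null mN N0) => x Nx; rewrite /patch.
  have [xr|xr] := pselect (eball 0 r x).
    suff -> : \sum_(i < 2) partial i (T i) x = 0 by case: ifP; case: ifP.
    rewrite sum_ord2 /T /= partial0_tensor// partial1_tensor// /tensor mul0r addr0 db ?mul0r//.
    move: xr; rewrite eball0E// => xr; rewrite -(@ltr_pXn2r _ 2) ?nnegrE ?(ltW r0)//.
    by rewrite real_normK ?num_real//; apply: le_lt_trans xr; rewrite lerDl sqr_ge0.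
  congr (if _ then _ else _); apply/idP/idP => /set_mem h; apply/mem_set.
    by apply/(FE x Nx xr).
  by apply/(FE x Nx xr).
rewrite -chamfered0 (divergence_chamfered (lexx 0) C1T T_out).
rewrite [X in (_ <= _ + X)%E](_ : _ = 0%E); last first.
  by apply: integral0_eq => t _; rewrite flux0E /T /= /tensor mul0r oppr0; case: ifP => // _; case: ifP.
rewrite adde0; apply: (@le_trans _ _ (2 * (4 - 0 - 2 * 1))%:E); first by rewrite lee_fin; lra.
apply: integral_flux_ge => //; first by lra.
by move=> t; rewrite /T /= /tensor /= b0 mul1r /p /= mulN1r.
Qed.

End classical_perimeter_lower.

(** * The perimeter gap at small scale, and the perimeter at large scale *)

Section powers.
Context {R : realType}.

(** Through (1 - x)^gamma <= exp (- gamma x) <= 1 / (1 + gamma x), which holds for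
    large and for small exponents alike. *)
Lemma bernoulli_powR (gamma x : R) : 0 < gamma -> 0 <= x <= 1 ->
  gamma / (1 + gamma) * x <= 1 - (1 - x) `^ gamma.
Proof.
move=> g0 /andP[x0 x1]; have g1 : 0 < 1 + gamma by rewrite addr_gt0.
move: x1; rewrite le_eqVlt => /orP[/eqP ->|x1].
  by rewrite subrr powR0 ?gt_eqF// subr0 mulr1 ler_pdivrMr// mul1r lerDr.
have gx : 0 < 1 + gamma * x by rewrite ltr_wpDr// mulr_ge0// ltW.
have h : (1 - x) `^ gamma <= (1 + gamma * x)^-1.
  rewrite /powR gt_eqF ?subr_gt0//.
  apply: (@le_trans _ _ (expR (- (gamma * x)))).
    by rewrite ler_expR -mulrN ler_wpM2l ?(ltW g0)// le_ln1Dx// ltrN2.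
  by rewrite expRN lef_pV2 ?posrE ?expR_gt0// expR_ge1Dx.
apply: (@le_trans _ _ (1 - (1 + gamma * x)^-1)); last by rewrite lerD2l lerN2.
rewrite (_ : 1 - _ = gamma * x / (1 + gamma * x)); last by field; rewrite gt_eqF.
rewrite mulrAC ler_wpM2l//; first by rewrite mulr_ge0// ltW.
by rewrite lef_pV2 ?posrE// lerD2l ler_piMr// ltW.
Qed.

Lemma powR_gap (gamma p q d : R) : 0 < gamma -> 0 < p -> 0 <= q -> 0 <= d -> q + d <= p ->
  gamma / (1 + gamma) * (d / p) * p `^ gamma <= p `^ gamma - q `^ gamma.
Proof.
move=> g0 p0 q0 d0 qdp.
have x01 : 0 <= d / p <= 1.
  rewrite divr_ge0 ?(ltW p0)//= ler_pdivrMr// mul1r; lra.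
have hq : q `^ gamma <= p `^ gamma * (1 - d / p) `^ gamma.
  rewrite -powRM ?(ltW p0)//; last by case/andP: x01; lra.
  have -> : p * (1 - d / p) = p - d by field; rewrite gt_eqF.
  by apply: ge0_ler_powR; rewrite ?nnegrE ?(ltW g0)//; lra.
have := ler_wpM2r (powR_ge0 p gamma) (bernoulli_powR g0 x01).
by rewrite mulrBl mul1r [_ * p `^ gamma in leRHS]mulrC; lra.
Qed.

Lemma powR_le_root (k d r : R) : 0 < d -> 0 <= k -> 0 <= r -> r <= k `^ d^-1 -> r `^ d <= k.
Proof.
move=> d0 k0 r0 rk; rewrite -[k]powRr1// -(@mulVf _ d) ?gt_eqF// powRrM.
by apply: ge0_ler_powR; rewrite ?nnegrE ?powR_ge0 ?(ltW d0).
Qed.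

Lemma powR_dominates (K C beta : R) : 0 < K -> 0 <= C -> beta < 4 ->
  exists2 r0 : R, 0 < r0 & forall r, 0 < r <= r0 -> C * r ^+ 4 < K * r `^ beta.
Proof.
move=> K0 C0 b4; have d0 : 0 < 4 - beta by rewrite subr_gt0.
have C1 : 0 < C + 1 by rewrite ltr_wpDl.
have KC : 0 < K / (C + 1) by rewrite divr_gt0.
exists ((K / (C + 1)) `^ (4 - beta)^-1); first exact: powR_gt0.
move=> r /andP[r0 rr].
have h : r `^ (4 - beta) <= K / (C + 1).
  by apply: powR_le_root => //; exact: ltW.
rewrite -powR_mulrn ?(ltW r0)// (_ : 4%:R = beta + (4 - beta)); last by ring.
rewrite powRD; last by apply/implyP => _; rewrite gt_eqF.
rewrite mulrCA [ltRHS]mulrC ltr_pM2l ?powR_gt0//.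
move: h; rewrite ler_pdivlMr// mulrDr mulr1 mulrC.
by have := powR_gt0 (4 - beta) r0; lra.
Qed.

End powers.

Section saddle_per_star.
Context {R : realType}.
Local Notation plane := (R * R)%type.
Local Notation borel_plane := (measurableTypeR R * measurableTypeR R)%type.
Local Notation leb2 := (@leb2 R).
Local Notation E := (@E_saddle R).
Variables (Upsilon sigma : R).
Hypotheses (hUpsilon : 0 < Upsilon <= 1 / 100) (hsigma : 0 < sigma <= 1).

Let U0 : 0 < Upsilon. Proof. by case/andP : hUpsilon. Qed.
Let sg0 : 0 < sigma. Proof. by case/andP : hsigma. Qed.
Let sg01 : sigma != 1 -> 0 < sigma < 1.
Proof. by move=> s1; rewrite sg0 lt_neqAle s1; case/andP : hsigma. Qed.

Lemma frac_per_ge0 s (A O : set plane) : (0 <= frac_per s A O)%E.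
Proof. by rewrite adde_ge0 ?interaction_ge0. Qed.

Lemma classical_per_ge0 (A O : set plane) : (0 <= classical_per A O)%E.
Proof.
apply: ereal_sup_ubound; exists (fun=> tensor (cst 0) (cst 0)).
  split=> [i|x]; last by rewrite sum_ord2 /tensor mul0r expr0n addr0 ler01.
  split; first by apply: C_tensor; exact: smooth_cst.
    apply: (@compact_supp_box _ _ 0 0 0 0); apply: supp_sub => x _; exact: mul0r.
  rewrite /supp (_ : [set _ | _] = set0) ?closure0//.
  by apply/seteqP; split => // x /=; rewrite /tensor mul0r eqxx.
apply: integral0_eq => x _; rewrite sum_ord2 partial0_tensor ?partial1_tensor//; try exact: smooth_cst.
by rewrite /tensor derive1_cstE mul0r addr0.
Qed.

Lemma per_star_ge0 (A O : set plane) : (0 <= per_star Upsilon sigma A O)%E.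
Proof. by rewrite /per_star; case: ifP => _; [exact: classical_per_ge0|exact: frac_per_ge0]. Qed.

Lemma per_star_saddle_fin r : 0 < r -> per_star Upsilon sigma E (eball 0%R r) \is a fin_num.
Proof.
move=> r0; rewrite ge0_fin_numE ?per_star_ge0// /per_star; case: ifPn => [_|s1].
  rewrite thicken_eball// -chamfered0.
  by rewrite (le_lt_trans (classical_per_chamfered_le (lexx 0) _ _)) ?ltry ?addr_ge0 ?addr_gt0// ltW.
by rewrite (le_lt_trans (frac_per_saddle_le (sg01 s1) r0)) ?ltry.
Qed.

(** For the fractional perimeter the lower bound grows like r^(2 - sigma). For the
    classical one the radius has to be large depending on [Upsilon], the width of the
    annulus where [F] is prescribed. *)
Lemma per_star_competitor_ge1 : exists2 r : R, 0 < r & forall F : set plane, lmeasurable F ->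
  leb2.-negligible ((F `\` eball 0 r) `+` (E `\` eball 0 r)) ->
  (1%:E <= per_star Upsilon sigma F (eball 0%R r))%E.
Proof.
have [s1|s1] := eqVneq sigma 1.
  have r0 : 0 < 16 / Upsilon by rewrite divr_gt0.
  exists (16 / Upsilon) => // F mF nF; rewrite /per_star s1 eqxx thicken_eball//.
  by apply: classical_per_competitor_ge => //; rewrite divfK ?gt_eqF.
(* The power of 4 r in the lower bound is at most 3, and (4 * 64)^3 = 64^4. *)
exists 64 => // F mF nF; rewrite /per_star (negbTE s1).
apply: le_trans (frac_per_competitor_ge (sg01 s1) _ mF nF) => //.
rewrite lee_fin ler_pdivlMl ?powR_gt0 ?mulr_gt0// mulr1.
have h64 : (4 * 64) ^+ 3 = 64 ^+ 4 :> R.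
  by rewrite exprMn [RHS]exprS; congr (_ * _); rewrite -[64]/(4 * 16)%:R; ring.
rewrite -h64 -powR_mulrn//; apply: ler_powR; first by rewrite -natrM ler1n.
by case/andP : hsigma => _; lra.
Qed.

(** The competitor set is obtained from squares or chamfers of size [r / 4]. If
    sigma < 1, the perimeter p and its decrease are both of order r^(2 - sigma), so
    that p^gamma decreases by a fixed fraction: beta = gamma (2 - sigma), which is less
    than 4 exactly because gamma < 4 / (2 - sigma). If sigma = 1, the perimeter is that
    in the ball of radius r + Upsilon, which stays away from 0, and the decrease is of
    order r: beta = 1. *)
Lemma per_star_gap (gamma : R) : 0 < gamma < 4 / (2 - sigma) ->
  exists K beta r1 : R, [/\ 0 < K, beta < 4, 0 < r1 & forall r : R, 0 < r <= r1 ->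
    exists F p q, [/\ measurable (F : set borel_plane), E `<=` F,
      forall x, ~ box (- (r / 4)) (r / 4) (- (r / 4)) (r / 4) x -> F x -> E x,
      per_star Upsilon sigma E (eball 0 r) = p%:E /\
      per_star Upsilon sigma F (eball 0 r) = q%:E &
      [/\ 0 <= q, q <= p, p <= 1 & K * r `^ beta <= p `^ gamma - q `^ gamma]]].
Proof.
move=> /andP[g0 g4]; have k0 : 0 < gamma / (1 + gamma) by rewrite divr_gt0// addr_gt0.
have [s1|s1] := eqVneq sigma 1.
  exists (gamma / (1 + gamma) * 4^-1 * (4 * Upsilon) `^ gamma), 1, 8^-1; split => //.
  - have u4 : 0 < (4 * Upsilon) `^ gamma by apply: powR_gt0; rewrite mulr_gt0.
    by rewrite mulr_gt0// mulr_gt0.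
  - by lra.
  move=> r /andP[r0 r8].
  have rU : 0 < r + Upsilon by rewrite addr_gt0.
  have r40 : 0 < r / 4 by rewrite divr_gt0.
  have rle : r / 4 <= r + Upsilon by have := U0; lra.
  have pE : per_star Upsilon sigma E (eball 0 r) = (4 * (r + Upsilon))%:E.
    rewrite /per_star s1 eqxx thicken_eball//; apply/eqP; rewrite eq_le classical_per_saddle_ge// andbT.
    by have := classical_per_chamfered_le (lexx 0) (ltW rU) rU; rewrite subr0 chamfered0.
  have qE : (per_star Upsilon sigma (chamfered (r / 4)) (eball 0%R r) <= (4 * (r + Upsilon) - r / 4)%:E)%E.
    rewrite /per_star s1 eqxx thicken_eball//; exact: classical_per_chamfered_le (ltW r40) rle rU.
  have qf : per_star Upsilon sigma (chamfered (r / 4)) (eball 0 r) \is a fin_num.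
    by rewrite ge0_fin_numE ?per_star_ge0// (le_lt_trans qE) ?ltry.
  pose q := fine (per_star Upsilon sigma (chamfered (r / 4)) (eball 0 r)).
  have q0 : 0 <= q by rewrite fine_ge0// per_star_ge0.
  have qd : q + r / 4 <= 4 * (r + Upsilon).
    by move: qE; rewrite -(fineK qf) lee_fin -/q; lra.
  exists (chamfered (r / 4)), (4 * (r + Upsilon)), q; split.
  - exact: measurable_chamfered.
  - by rewrite -chamfered0 => x; rewrite /chamfered /= => -[[? [?|?]]|[? [?|?]]];
      [left|left|right|right]; split => //; by [left|right; lra].
  - move=> -[x y] xb; rewrite /chamfered /E_saddle /= => xy.
    have {}xb : ~ (- (r / 4) <= x <= r / 4 /\ - (r / 4) <= y <= r / 4).
      by apply: contra_not xb => -[? ?]; split; rewrite /= in_itv.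
    have xy' : [/\ 0 < y & 0 < x \/ y - r / 4 < x] \/ [/\ y < 0 & x < 0 \/ x < y + r / 4].
      by case: xy => [[]|[]]; [left|right].
    clear xy; case: xy' => -[y0 [x0|x0]].
    + exact: mulr_gt0.
    + have [x'|x'] := ltP 0 x; first exact: mulr_gt0.
      by exfalso; apply: xb; split; apply/andP; split; lra.
    + by rewrite nmulr_rgt0.
    + have [x'|x'] := ltP x 0; first by rewrite nmulr_rgt0.
      by exfalso; apply: xb; split; apply/andP; split; lra.
  - by rewrite fineK.
  - split => //; [by lra| |].
      by move/andP : hUpsilon => -[]; lra.
    have p0 : 0 < 4 * (r + Upsilon) by rewrite mulr_gt0.
    apply: le_trans (powR_gap g0 p0 q0 (ltW r40) qd).
    rewrite powRr1 ?(ltW r0)// (_ : _ * r = gamma / (1 + gamma) * (r / 4) * (4 * Upsilon) `^ gamma); last by ring.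
    apply: ler_pM; rewrite ?powR_ge0 ?(ltW (mulr_gt0 k0 r40))//.
      rewrite ler_wpM2l ?(ltW k0)// ler_peMr ?(ltW r40)// invf_ge1//.
      by have := U0; move/andP : hUpsilon => -[]; lra.
    by apply: ge0_ler_powR; rewrite ?nnegrE ?mulr_ge0 ?(ltW U0) ?(ltW g0) ?(ltW rU)//; lra.
have hs := sg01 s1; have [_ sl1] := andP hs.
pose C : R := 4 * (8 * pi / (sigma * (1 - sigma))).
have C0 : 0 < C by rewrite /C !mulr_gt0 ?pi_gt0// invr_gt0 mulr_gt0// subr_gt0.
have s2 : 0 < 2 - sigma by lra.
have [k kp kE] : exists2 k : R, 0 < k & forall t, (t / 4) ^+ 4 = k * t ^+ 4.
  by exists (4^-1 ^+ 4) => [|t]; [exact: exprn_gt0|rewrite exprMn mulrC].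
exists (gamma / (1 + gamma) * (k / C) * k `^ gamma), ((2 - sigma) * gamma), (C^-1 `^ (2 - sigma)^-1); split.
- by rewrite mulr_gt0 ?powR_gt0// mulr_gt0// divr_gt0.
- by move: g4; rewrite ltr_pdivlMr// mulrC.
- by rewrite powR_gt0// invr_gt0.
move=> r /andP[r0 rr]; have r40 : 0 < r / 4 by rewrite divr_gt0.
set a : R := r `^ (2 - sigma).
have a0 : 0 < a by exact: powR_gt0.
have aC : a <= C^-1.
  by apply: powR_le_root; rewrite ?invr_ge0 ?(ltW r0) ?(ltW C0).
pose F := E `|` (square2 (r / 4) `|` square4 (r / 4)).
have m2 : measurable (square2 (r / 4) : set borel_plane) by exact: measurable_obox.
have m4 : measurable (square4 (r / 4) : set borel_plane) by exact: measurable_obox.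
have sq_box : square2 (r / 4) `|` square4 (r / 4) `<=` box (- (r / 4)) (r / 4) (- (r / 4)) (r / 4).
  by move=> x [] [] /=; rewrite /box /= !in_itv/= => /andP[h1 h2] /andP[h3 h4];
    split; apply/andP; split; lra.
have boxO : box (- (r / 4)) (r / 4) (- (r / 4)) (r / 4) `<=` eball 0 r.
  by apply: box_eball0; rewrite ?(ltW r40)//; nra.
have mO : measurable (eball (0 : plane) r : set borel_plane).
  by apply: open_borel_plane; exact: open_eball0.
have gap := frac_per_square_gap sigma r40 mO (subset_trans sq_box boxO).
have ige := interaction_squares_ge hs r40.
have pf := per_star_saddle_fin r0.
have pC := frac_per_saddle_le hs r0; rewrite -/C -/a in pC.
pose p := fine (per_star Upsilon sigma E (eball 0 r)).
have pE : frac_per sigma E (eball 0%R r) = p%:E.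
  by rewrite /p fineK// /per_star (negbTE s1).
have dE : ((4 * (r / 4)) `^ (2 + sigma))^-1 * (r / 4) ^+ 4 = k * a.
  rewrite (_ : 4 * (r / 4) = r); last by field.
  rewrite kE mulrCA; congr (_ * _); rewrite /a -powR_mulrn ?(ltW r0)// -powRN -powRD; last by apply/implyP => _; rewrite gt_eqF.
  by congr (_ `^ _); ring.
rewrite dE in ige.
have qlt : (frac_per sigma F (eball 0%R r) + (k * a)%:E <= p%:E)%E.
  by rewrite -pE; apply: le_trans gap; rewrite leeD2l.
have qf : frac_per sigma F (eball 0%R r) \is a fin_num.
  rewrite ge0_fin_numE ?frac_per_ge0//; apply: (@le_lt_trans _ _ p%:E); rewrite ?ltry//.
  by apply: le_trans qlt; rewrite leeDl// lee_fin mulr_ge0// ltW.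
pose q := fine (frac_per sigma F (eball 0%R r)).
have q0 : 0 <= q by rewrite fine_ge0// frac_per_ge0.
have qd : q + k * a <= p by move: qlt; rewrite -(fineK qf) -EFinD lee_fin.
rewrite pE lee_fin in pC.
have d0 : 0 < k * a by rewrite mulr_gt0.
have p0 : 0 < p by lra.
exists F, p, q; split.
- by apply: measurableU; [exact: measurable_saddle|exact: measurableU].
- exact: subsetUl.
- by move=> x xb [//|/sq_box].
- by rewrite /per_star (negbTE s1); split; [exact: pE|rewrite /q fineK].
- split => //; [by lra| |].
    by rewrite (le_trans pC)// -ler_pdivlMl// mulr1.
  apply: le_trans (powR_gap g0 p0 q0 (ltW d0) qd).
  rewrite powRrM -/a (_ : _ * a `^ gamma = gamma / (1 + gamma) * (k / C) * (k * a) `^ gamma); last first.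
    by rewrite (powRM _ (ltW kp) (ltW a0)) [RHS]mulrA.
  apply: ler_pM; rewrite ?powR_ge0//.
  + by apply: mulr_ge0; rewrite ?(ltW k0)// divr_ge0 ?(ltW kp) ?(ltW C0).
  + rewrite ler_wpM2l ?(ltW k0)// -mulrA ler_wpM2l ?(ltW kp)// ler_pdivlMr// mulrC ler_pdivrMr//; lra.
  + by apply: ge0_ler_powR; rewrite ?nnegrE ?(ltW p0) ?(ltW g0) ?(ltW d0)//; lra.
Qed.

End saddle_per_star.

(** * Minimality at large scale and its failure at small scale *)

Section pairs.
Context {R : realType}.
Local Notation plane := (R * R)%type.
Local Notation borel_plane := (measurableTypeR R * measurableTypeR R)%type.
Local Notation leb2 := (@leb2 R).
Local Notation E := (@E_saddle R).
Local Notation u := (@u_saddle R).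

(** A test function approximates itself. *)
Lemma H10_Ccinfty (O : set plane) a b c d phi : open O -> O `<=` box a b c d ->
  Ccinfty O phi -> H10 O phi.
Proof.
move=> oO Ob Cphi; have [C1phi _ _] := Ccinfty_Cc1 Cphi.
split=> [|eps eps0]; first exact: H1_C1 Ob _ C1phi.
exists phi => //; rewrite /sqr_H1_norm.
have C1z : C_ 1 (phi \- phi) by exact: C1B.
rewrite (dirichlet_C1 oO Ob C1z) !integral0_eq ?adde0 ?lte_fin// => x _.
  by rewrite sum_ord2 !partialB// !subrr expr0n addr0.
by rewrite /= subrr expr0n.
Qed.

Lemma admissible_C1 Upsilon sigma (r : R) v (F : set borel_plane) : 0 < r -> C_ 1 v ->
  measurable F -> (per_star Upsilon sigma F (eball 0%R r) < +oo)%E ->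
  (forall x, F x -> 0 <= v x) -> (forall x, ~ F x -> v x <= 0) ->
  admissible_pair Upsilon sigma (eball 0 r) v F.
Proof.
move=> r0 C1v mF pF vF vFc; split => //; first split.
- by apply: borel_lmeasurable_fun => //; apply: continuous_borel; move/C1P : C1v => [].
- exact: H1_C1 (open_eball0 r0) (eball0_box r0) _ C1v.
- exact: borel_lmeasurable.
- exact: aeW.
- exact: aeW.
Qed.

Lemma saddle_ge0 x : E x -> 0 <= u x.
Proof. exact: ltW. Qed.

Lemma saddle_le0 x : ~ E x -> u x <= 0.
Proof. by move/negP; rewrite -leNgt. Qed.

Lemma admissible_saddle Upsilon sigma (r : R) : 0 < Upsilon <= 1 / 100 -> 0 < sigma <= 1 ->
  0 < r -> admissible_pair Upsilon sigma (eball 0 r) u E.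
Proof.
move=> hU hs r0; apply: admissible_C1 => //; [exact: C1_saddle|exact: measurable_saddle| | |].
- by rewrite -ge0_fin_numE ?per_star_ge0//; exact: per_star_saddle_fin.
- exact: saddle_ge0.
- exact: saddle_le0.
Qed.

Lemma dirichlet_ge0 (O : set plane) v : (0 <= dirichlet O v)%E.
Proof. by apply: integral_ge0 => x _; rewrite lee_fin sumr_ge0// => i _; exact: sqr_ge0. Qed.

Lemma dirichlet_C1_lty (r : R) v : 0 < r -> C_ 1 v -> (dirichlet (eball 0%R r) v < +oo)%E.
Proof.
move=> r0 C1v; have oO := open_eball0 r0; have Ob := eball0_box r0.
have mO := open_borel_plane oO.
have i2 i : leb2.-integrable (eball (0 : plane) r) (fun x => (partial i v x ^+ 2)%:E).
  have [_ h] := square_integrable_continuous mO Ob (@C1_continuous_partial _ v i C1v); exact: h.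
rewrite (dirichlet_C1 oO Ob C1v).
under eq_integral do rewrite sum_ord2 EFinD.
by rewrite integralD//; apply: lte_add_pinfty; apply: integrable_lty.
Qed.

End pairs.

Theorem theorem1p1 (R : realType) (Upsilon sigma : R)
    (hUpsilon : 0 < Upsilon <= 1 / 100) (hsigma : 0 < sigma <= 1) :
  exists2 Ko : R, 2 < Ko &
    forall Phi : R -> R,
      (forall t, 0 <= t -> 0 <= Phi t) ->
      (forall s t, 0 <= s -> s <= t -> Phi s <= Phi t) ->
      lsc_halfline Phi ->
      Phi t @[t --> +oo] --> +oo ->
      (exists2 gamma : R, 0 < gamma < 4 / (2 - sigma) &
        forall t, 0 <= t <= 1 -> Phi t = t `^ gamma) ->
      (forall t, 2 <= t <= Ko -> Phi t = 1) ->
      exists Ro ro : R,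
        [/\ 0 < ro, ro < Ro,
            minimal_pair Upsilon sigma Phi (eball 0 Ro) u_saddle E_saddle &
            forall r, 0 < r <= ro ->
              ~ minimal_pair Upsilon sigma Phi (eball 0 r) u_saddle E_saddle].
Proof.
have [Ro Ro0 Ro1] := per_star_competitor_ge1 hUpsilon hsigma.
have Pfin := per_star_saddle_fin hUpsilon hsigma Ro0.
set P := per_star Upsilon sigma (@E_saddle R) (eball 0 Ro) in Pfin.
(* Ko has to reach the perimeter of the saddle set in the large ball. *)
exists (Num.max 3 (fine P)); first by rewrite lt_max ltr_nat.
move=> Phi Phi0 Phi_mono _ _ [gamma hgamma Phi_pow] Phi_flat.
have Phi_ge1 t : 1 <= t -> 1 <= Phi t.
  move=> t1; rewrite -(_ : Phi 1 = 1); first exact: Phi_mono.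
  by rewrite Phi_pow ?powR1// ler01 lexx.
have Phi_le1 t : 0 <= t -> t <= Num.max 3 (fine P) -> Phi t <= 1.
  move=> t0 tK; have [t2|t2] := leP 2 t; first by rewrite Phi_flat// t2.
  rewrite -(_ : Phi 2 = 1); first by apply: Phi_mono => //; exact: ltW.
  by rewrite Phi_flat// lexx le_max ler_nat.
have [C C0 hC] := @dirichlet_flattened_le R.
have [K [beta [r1 [K0 b4 r10 gap]]]] := per_star_gap hUpsilon hsigma hgamma.
have [r2 r20 dom] := powR_dominates K0 C0 b4.
exists Ro, (Num.min (Ro / 2) (Num.min r1 r2)); split.
- by rewrite !lt_min r10 r20 divr_gt0.
- by rewrite gt_min; apply/orP; left; lra.
- have oO := open_eball0 Ro0; have Ob := eball0_box Ro0.
  split; first exact: admissible_saddle.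
    apply: lte_add_pinfty; first by apply: dirichlet_C1_lty => //; exact: C1_saddle.
    by rewrite -/P -(fineK Pfin) ltry.
  move=> v F [[_ H1v] mF Ffin _ _] H10v nF; apply: leeD.
    exact: dirichlet_saddle_le oO Ob _ H1v H10v.
  have F1 := Ro1 F mF nF.
  have Ff : per_star Upsilon sigma F (eball 0%R Ro) \is a fin_num.
    by rewrite ge0_fin_numE ?per_star_ge0.
  rewrite -/P -(fineK Pfin) -(fineK Ff) /= lee_fin; apply: (@le_trans _ _ 1).
    by apply: Phi_le1; rewrite ?fine_ge0 ?per_star_ge0// le_max lexx orbT.
  by apply: Phi_ge1; rewrite -lee_fin fineK.
move=> r /andP[r0]; rewrite !le_min => /and3P[_ rr1 rr2] [_ _ hmin].
have r40 : 0 < r / 4 by rewrite divr_gt0.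
have [|F [p [q [mF EF FE [pE qE] [q0 qp p1 hgap]]]]] := gap r; first by rewrite r0.
have box_sub s : 0 < s -> s <= r / 2 -> box (- s) s (- s) s `<=` eball 0 r.
  by move=> s0 sr; apply: box_eball0; rewrite ?(ltW s0)//; nra.
have C1v := @C1_flattened R (r / 4).
have H10v : H10 (eball 0 r) (flattened (r / 4) \- (@u_saddle R)).
  apply: H10_Ccinfty (open_eball0 r0) (eball0_box r0) _.
  by apply: Ccinfty_flattened => //; apply: box_sub; rewrite ?mulr_gt0//; lra.
have adm : admissible_pair Upsilon sigma (eball 0 r) (flattened (r / 4)) F.
  apply: admissible_C1 => //; first by rewrite qE ltry.
    move=> x Fx; have [bx|bx] := pselect (box (- (r / 4)) (r / 4) (- (r / 4)) (r / 4) x).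
      by rewrite flattened_eq0.
    have [t t0 ->] := flattened_factor x r40.
    by rewrite mulr_ge0// saddle_ge0//; exact: FE.
  move=> x Fx; have [t t0 ->] := flattened_factor x r40.
  by rewrite mulr_ge0_le0// saddle_le0// => /EF.
have nF : leb2.-negligible ((F `\` eball 0 r) `+` (@E_saddle R `\` eball 0 r)).
  rewrite (_ : _ `+` _ = set0); first exact: negligible_set0.
  apply/seteqP; split => // x [[[Fx xr] h]|[[Ex xr] h]].
    by apply: h; split => //; apply: FE => // bx; apply: xr; apply: box_sub bx => //; lra.
  by apply: h; split => //; exact: EF.
have := hmin _ _ adm H10v nF; rewrite /energy pE qE /= => hE.
have := hC r r0; have := dirichlet_ge0 (eball 0 r) (@u_saddle R).
move: hE; rewrite !Phi_pow; [|by rewrite q0 (le_trans qp)|by rewrite (le_trans q0 qp)].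
move=> hE u0 vC; have : ((p `^ gamma)%:E <= (C * r ^+ 4)%:E + (q `^ gamma)%:E)%E.
  apply: (@le_trans _ _ (dirichlet (eball 0%R r) (@u_saddle R) + (p `^ gamma)%:E)%E).
    by rewrite leeDr.
  by apply: (le_trans hE); rewrite leeD2r.
rewrite -EFinD lee_fin => hh.
by have := dom r; rewrite r0 rr2 => /(_ isT); lra.
Qed.
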